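(* Let $\Omega(t)$ be a moving domain with associated stationary reference domain $\hat\Omega$, let $D,B$ be the differential and boundary operators of the problem, and let $\alpha$ be a real constant. Then the following two statements are equivalent: (1) For all $\phi\in\mathcal{U}$ satisfying $B\phi=0$ (on $\partial\Omega$), the energy estimate $$\big(\phi, D\phi\big)_{\Omega}+\tfrac12\big(\phi,(n^T\dot x)\,\phi\big)_{\partial\Omega}\le \alpha\|\phi\|_\Omega^2$$ holds. (2) The transformed spatial operator satisfies the semi-bounded property $$\big(\hat\phi,\hat D\hat\phi\big)_{\hat\Omega}\le\alpha\|\hat\phi\|_{\hat\Omega}^2$$ for all $\hat\phi\in\hat{\mathcal{U}}$ satisfying $\hat B\hat\phi=0$ (on $\partial\hat\Omega$).
   Context: Problem: $u_t=D(u,x,t)u+F(x,t)$ for $x\in\Omega=\Omega(t)\subset\mathbb{R}^p$, $t_0<t<T$; $B(u,x,t)u=g(x,t)$ for $x\in\partial\Omega$; $u(x,t_0)=u_0(x)$. Here $u_t$ is the partial time derivative at fixed physical coordinate $x=(x_1,\dots,x_p)^T$, $D$ is a (possibly nonlinear) differential operator and $B$ a boundary operator; $D\phi$ abbreviates $D(\phi,x,t)\phi$ and $B\phi$ abbreviates $B(\phi,x,t)\phi$. $\mathcal{U}$ is the set of all functions $\phi(x,t)$ such that $\phi_t$, $\nabla\phi$ and $D\phi$ exist and are continuous on the closure of the space-time computational domain. Domain motion: there is a stationary reference domain $\hat\Omega$ and, for each $t$, a bijective coordinate mapping $x=x(\hat x,t)$, $\hat x=\hat x(x,t)$ between $\hat\Omega$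 and $\Omega(t)$, globally continuous and twice continuously differentiable on the closure of each of finitely many non-overlapping subdomains (blocks/elements) of the computational domain. The coordinate velocity is $\dot x=(\dot x_1,\dots,\dot x_p)^T$, $\dot x_i(x,t)=\frac{\partial x_i}{\partial t}(\hat x,t)$ at $\hat x=\hat x(x,t)$. The Jacobian determinant $J(x,t)=\det(\partial x/\partial\hat x)$ is strictly positive. $n$ is the outward unit normal of $\Omega$. Inner products: $(\phi,\psi)_\Omega=\int_\Omega\phi\psi\,dV$, $(\phi,\psi)_{\partial\Omega}=\oint_{\partial\Omega}\phi\psi\,dS$, $\|\phi\|_\Omega^2=(\phi,\phi)_\Omega$, and likewise on $\hat\Omega$ (in the variable $\hat x$). The domains are such that the usual integration-by-parts formula $(\phi,\psi_{x_i})_\Omega=-(\phi_{x_i},\psi)_\Omega+(\phi,n_i\psi)_{\partial\Omega}$ holds. All estimates are understood at each time $t$. Operators: $D_m\phi=\frac12\big[\dot x^T(\nabla\phi)+\nabla\cdot(\dot x\phi)\big]$ (defined piecewise on the subdomains). Variable substitution: to $\phi$ on $\Omega(t)$ corresponds $\hat\phi(\hat x,t)=\sqrt{J(x(\hat x,t),t)}\,\phi(x(\hat x,t),t)$ on $\hat\Omega$; $\hat{\mathcal{U}}=\{\hat\phi:\phi\in\mathcal{U}\}$. The transformed operators are $\hat D=\sqrt J\,(D+D_m)\,\sqrt J^{-1}$ and $\hat B=B\sqrt J^{-1}$, i.e. $\hat D\hat\phi=\sqrt J\,(D\phi+D_m\phi)$ and $\hat B\hat\phi=B\phi$ (evaluated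 at $x=x(\hat x,t)$). *)

(* Defs.v *)
From HB Require Import structures.
From mathcomp Require Import all_boot all_order all_algebra.
From mathcomp Require Import all_classical all_reals all_analysis.

Set Implicit Arguments.
Unset Strict Implicit.
Unset Printing Implicit Defensive.

Import Order.TTheory GRing.Theory Num.Theory.
Import numFieldNormedType.Exports.

Local Open Scope classical_set_scope.
Local Open Scope ring_scope.

Definition borel (R : realType) (p : nat) :=
  g_sigma_algebraType (@open 'rV[R]_p).

(* Product of [p] copies of the one-dimensional Lebesgue measure, computed by
   slicing along the first coordinate.  It is a plain set function; integrals
   only evaluate it on the Borel sets. *)
Fixpoint lebesgue (R : realType) (p : nat) : set 'rV[R]_p -> \bar R :=
  match p return set 'rV[R]_p -> \bar R with
  | 0%N => fun A => (\1_A 0)%:E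
  | m.+1 => fun A =>
      (\int[@lebesgue_measure R]_s
         @lebesgue R m [set v : 'rV[R]_m | A (row_mx (s%:M : 'rV[R]_1) v)])%E
  end.

(* The norm that the library puts on ['rV[R]_p] is the sup norm. *)
Definition eucl_norm (R : realType) (p : nat) (v : 'rV[R]_p) : R :=
  Num.sqrt (\sum_i v 0 i ^+ 2).

Definition dotp (R : realType) (p : nat) (v w : 'rV[R]_p) : R :=
  \sum_i v 0 i * w 0 i.

Definition diam (R : realType) (p : nat) (A : set 'rV[R]_p) : \bar R :=
  ereal_sup [set (eucl_norm (z.1 - z.2))%:E | z in A `*` A].

(* The case distinction only matters for [m = 0], where [0 ^+ 0 = 1]. *)
Definition diam_pow (R : realType) (p m : nat) (A : set 'rV[R]_p) : \bar R :=
  if A == set0 then 0%E else (diam A ^+ m)%E.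

Definition hausdorff_content (R : realType) (p m : nat) (delta : R)
    (A : set 'rV[R]_p) : \bar R :=
  ereal_inf [set (\sum_(0 <= k <oo) diam_pow m (C k))%E |
    C in [set C : nat -> set 'rV[R]_p |
      A `<=` \bigcup_k C k /\ forall k, (diam (C k) <= delta%:E)%E]].

(* [m]-dimensional Hausdorff measure, normalized by (volume of the unit ball
   of [R^m]) / 2^m so that it is [m]-dimensional area. *)
Definition hausdorff (R : realType) (p m : nat) (A : set 'rV[R]_p) : \bar R :=
  (lebesgue [set v : 'rV[R]_m | (eucl_norm v <= 1)%R] * ((2^-1 : R) ^+ m)%R%:E *
   ereal_sup [set hausdorff_content m delta A | delta in [set d : R | (0 < d)%R]])%E.

Definition surface (R : realType) (p : nat) : set 'rV[R]_p -> \bar R :=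
  @hausdorff R p p.-1.

Definition vol_ip (R : realType) (p : nat) (A : set 'rV[R]_p)
    (f g : 'rV[R]_p -> R) : R :=
  fine (@integral _ (borel R p) R (@lebesgue R p) A
          (fun x => (f x * g x)%:E)).

Definition surf_ip (R : realType) (p : nat) (A : set 'rV[R]_p)
    (f g : 'rV[R]_p -> R) : R :=
  fine (@integral _ (borel R p) R (@surface R p) A
          (fun x => (f x * g x)%:E)).

Definition vol_sqnorm (R : realType) (p : nat) (A : set 'rV[R]_p)
    (f : 'rV[R]_p -> R) : R := vol_ip A f f.

Definition bdry (V : topologicalType) (A : set V) : set V :=
  closure A `\` A°.

(* [nu] is the outward unit normal of [A] at the boundary point [y]: near [y],
   [A] is the half space [dotp nu (x - y) < 0] up to arbitrarily thin cones. *)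
Definition outward_unit_normal (R : realType) (p : nat) (A : set 'rV[R]_p)
    (y nu : 'rV[R]_p) : Prop :=
  eucl_norm nu = 1 /\
  forall eps : R, 0 < eps -> \forall x \near y,
    (dotp nu (x - y) < - (eps * eucl_norm (x - y)) -> A x) /\
    (eps * eucl_norm (x - y) < dotp nu (x - y) -> ~ A x).

(* All partial derivatives of order at most [k] along the directions [e] exist
   in [S] and extend continuously to the closure of [S]. *)
Fixpoint Ck_closure (R : realType) (V : normedModType R) (I : Type) (e : I -> V)
    (k : nat) (S : set V) (f : V -> R) : Prop :=
  {within closure S, continuous f} /\
  match k with
  | 0%N => True
  | k'.+1 => forall i : I, exists g : V -> R,
      (forall z, S z -> is_derive z (e i) f (g z)) /\ Ck_closure e k' S g
  end.

Definition space_dir (R : realType) (p : nat) (i : 'I_p) : 'rV[R]_p :=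
  delta_mx 0 i.

(* [Some i] is the direction of [x_i], [None] the direction of time. *)
Definition spacetime_dir (R : realType) (p : nat) (o : option 'I_p) :
    'rV[R]_p * R :=
  if o is Some i then (space_dir R i, 0) else (0, 1).

(* Fields [phi(x,t)] are functions on all of [R^p * R]; only their values on the
   closure of the space-time domain are meaningful. *)
Definition field (R : realType) (p : nat) := 'rV[R]_p * R -> R.

Definition slice (R : realType) (p : nat) (phi : field R p) (t : R) :
  'rV[R]_p -> R := fun x => phi (x, t).

Record geometry (R : realType) (p : nat) := Geometry {
  t_start : R;
  t_end : R;
  dom_ref : set 'rV[R]_p;
  nblocks : nat;
  block_ref : 'I_nblocks -> set 'rV[R]_p;
  dom : R -> set 'rV[R]_p;
  x_of : 'rV[R]_p -> R -> 'rV[R]_p;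
  xhat_of : 'rV[R]_p -> R -> 'rV[R]_p;
  normal : 'rV[R]_p -> R -> 'rV[R]_p
}.

Section Geometry.
Variables (R : realType) (p : nat) (G : geometry R p).
Implicit Types (phi : field R p) (t : R) (x : 'rV[R]_p).

Definition dom_st : set ('rV[R]_p * R) :=
  [set z | t_start G < z.2 < t_end G /\ dom G z.2 z.1].

Definition block (k : 'I_(nblocks G)) t : set 'rV[R]_p :=
  (x_of G ^~ t) @` block_ref k.

Definition block_ref_st (k : 'I_(nblocks G)) : set ('rV[R]_p * R) :=
  block_ref k `*` [set t | t_start G < t < t_end G].

(* det (dx/dxhat) inside a block, as a function of [(xhat, t)] *)
Definition jacdet (z : 'rV[R]_p * R) : R :=
  \det (\matrix_(i, j)
    'D_(space_dir R j) (fun y => x_of G y z.2 0 i) z.1).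

(* continuous extension of [jacdet] from the [k]-th block to its closure *)
Definition jacdet_block (k : 'I_(nblocks G)) (z : 'rV[R]_p * R) : R :=
  lim (jacdet @ within (block_ref_st k) (nbhs z)).

(* The Jacobian determinant is two-valued on the interfaces between blocks; there
   the value coming from one of the adjacent blocks is taken. *)
Definition jacdet_ref (z : 'rV[R]_p * R) : R :=
  if [pick k | `[< closure (block_ref (g := G) k) z.1 >]] is Some k
  then jacdet_block k z else 1.

Definition J x t : R := jacdet_ref (xhat_of G x t, t).

Definition xdot x t : 'rV[R]_p :=
  \row_i derive1 (fun s => x_of G (xhat_of G x t) s 0 i) t.

(* Set to 0 on the interfaces, where the derivatives need not exist. *)
Definition pderiv t (i : 'I_p) (f : 'rV[R]_p -> R) : 'rV[R]_p -> R :=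
  ('D_(space_dir R i) f) \_ (\bigcup_k block k t).

Definition piecewise_C1 t (f : 'rV[R]_p -> R) : Prop :=
  {within closure (dom G t), continuous f} /\
  forall k, Ck_closure (@space_dir R p) 1 (block k t) f.

Definition integration_by_parts t : Prop :=
  forall (f g : 'rV[R]_p -> R) (i : 'I_p),
    piecewise_C1 t f -> piecewise_C1 t g ->
    vol_ip (dom G t) f (pderiv t i g) =
      - vol_ip (dom G t) (pderiv t i f) g
      + surf_ip (bdry (dom G t)) f (fun x => normal G x t 0 i * g x).

Definition subdivision (A : set 'rV[R]_p) (n : nat)
    (blk : 'I_n -> set 'rV[R]_p) : Prop :=
  [/\ forall k, open (blk k) /\ blk k `<=` A,
      forall k l, k != l -> blk k `&` blk l = set0,
      closure A = \bigcup_k closure (blk k) &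
      lebesgue (A `\` \bigcup_k blk k) = 0%E].

Record moving_domain : Prop := MovingDomain {
  md_time : t_start G < t_end G;
  md_ref_open : open (dom_ref G);
  md_ref_bounded : bounded_set (dom_ref G);
  md_ref_blocks : subdivision (dom_ref G) (@block_ref _ _ G);
  md_open : forall t, t_start G <= t <= t_end G -> open (dom G t);
  md_image : forall t, t_start G <= t <= t_end G ->
    (x_of G ^~ t) @` dom_ref G = dom G t;
  md_image_closure : forall t, t_start G <= t <= t_end G ->
    (x_of G ^~ t) @` closure (dom_ref G) = closure (dom G t);
  md_inverse : forall t, t_start G <= t <= t_end G ->
    forall y, closure (dom_ref G) y -> xhat_of G (x_of G y t) t = y;
  md_continuous :
    {within closure (dom_ref G) `*` [set t | t_start G <= t <= t_end G],
      continuous (fun z : 'rV[R]_p * R => x_of G z.1 z.2)};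
  md_C2 : forall k i,
    Ck_closure (@spacetime_dir R p) 2 (block_ref_st k)
      (fun z => x_of G z.1 z.2 0 i);
  md_J_gt0 : forall k z, closure (block_ref_st k) z -> 0 < jacdet_block k z;
  md_blocks : forall t, t_start G < t < t_end G ->
    subdivision (dom G t) (fun k => block k t);
  md_surface_finite : forall t, t_start G < t < t_end G ->
    (surface (bdry (dom G t)) < +oo)%E;
  md_normal_measurable : forall t, t_start G < t < t_end G -> forall i,
    measurable_fun (bdry (dom G t) : set (borel R p))
      (fun x : borel R p => normal G x t 0 i);
  md_normal : forall t, t_start G < t < t_end G ->
    surface [set x | bdry (dom G t) x /\
                     ~ outward_unit_normal (dom G t) x (normal G x t)] = 0%E;
  md_ibp : forall t, t_start G < t < t_end G -> integration_by_parts t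
}.

(* A possibly nonlinear operator: [A phi z = Some v] means that [A phi] exists at
   [z] and equals [v].  A differential operator is local: its value at a point
   of the closed space-time domain only depends on the germ of [phi] there. *)
Definition local_operator (W : Type)
    (A : field R p -> 'rV[R]_p * R -> option W) : Prop :=
  forall phi psi z, closure dom_st z ->
    (\forall w \near within (closure dom_st) (nbhs z), phi w = psi w) ->
    A phi z = A psi z.

Definition op_val (A : field R p -> 'rV[R]_p * R -> option R) phi : field R p :=
  fun z => odflt 0 (A phi z).

Definition space_U (D : field R p -> 'rV[R]_p * R -> option R) :
    set (field R p) :=
  [set phi | Ck_closure (@spacetime_dir R p) 1 dom_st phi /\
     exists g : field R p, {within closure dom_st, continuous g} /\
       forall z, closure dom_st z -> D phi z = Some (g z)].

Definition Dm phi : field R p := fun z =>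
  2^-1 * (\sum_i xdot z.1 z.2 0 i * pderiv z.2 i (slice phi z.2) z.1
        + \sum_i pderiv z.2 i (fun y => xdot y z.2 0 i * slice phi z.2 y) z.1).

Definition hat phi : field R p := fun z =>
  Num.sqrt (J (x_of G z.1 z.2) z.2) * phi (x_of G z.1 z.2, z.2).

Definition unhat (phih : field R p) : field R p := fun z =>
  (Num.sqrt (J z.1 z.2))^-1 * phih (xhat_of G z.1 z.2, z.2).

Definition hat_D (D : field R p -> 'rV[R]_p * R -> option R)
    (phih : field R p) : field R p := fun z =>
  let x := (x_of G z.1 z.2, z.2) in
  Num.sqrt (J x.1 x.2) * (op_val D (unhat phih) x + Dm (unhat phih) x).

Definition hat_B (W : Type) (B : field R p -> 'rV[R]_p * R -> option W)
    (phih : field R p) : 'rV[R]_p * R -> option W := fun z =>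
  B (unhat phih) (x_of G z.1 z.2, z.2).

Definition space_Uhat (D : field R p -> 'rV[R]_p * R -> option R) :
    set (field R p) := hat @` space_U D.

End Geometry.

(* Main.v *)
(* At each fixed time, the substitution phi^ = sqrt(J) phi turns both sides of the
   one estimate into both sides of the other.  By the change of variables x = x(xhat, t),
   done block by block since the interfaces are null sets, |phi^|^2 = |phi|^2 and
   (phi^, D^ phi^) = (phi, D phi) + (phi, D_m phi), and integration by parts leaves
   only the boundary term of (phi, D_m phi), which is 1/2 (phi, (n . xdot) phi).
   Locality of D and B gives D (unhat phi^) = D phi, because unhat (hat phi) and phi
   agree on the closed domain only.

   Change of variables: after the linear case, the two measures A -> integral of
   f o X * |det| over A and A -> integral of f over X(A) are compared on small dyadic
   cubes, where X is close to its linearization.  The surface measure is a metric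
   outer measure, hence a measure on the Borel sets, which makes surface integrals
   additive; the outward normal is only known to be a unit vector almost everywhere. *)

From HB Require Import structures.
From mathcomp Require Import all_boot all_order all_algebra fingroup perm.
From mathcomp Require Import all_classical all_reals all_analysis.
From mathcomp Require Import measurable_realfun.
From mathcomp Require Import ring lra.
Require Import Defs.

Set Implicit Arguments.
Unset Strict Implicit.
Unset Printing Implicit Defensive.

Import Order.TTheory GRing.Theory Num.Theory.
Import numFieldNormedType.Exports.

Local Open Scope classical_set_scope.
Local Open Scope ring_scope.

(** * Lebesgue measure on [R^p] and linear maps *)

(** The inverse mapping is given only pointwise, so its regularity has to be earned: continuity
    comes from compactness of the closed reference domain, and differentiability from that of the
    mapping together with this continuity. In the comparison on small cubes each direction of
    differentiability yields one inclusion: the mapping bounds the image of a cube from outside, its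
    inverse from inside. Neither bound is uniform in the base point, hence a comparison of measures
    that tolerates a threshold depending on the point.

    On the interfaces the integrands carry conventional values and are not shown to be measurable,
    so discarding a null set must work for an integrand that is measurable only off it. The
    coordinate velocity, in contrast, is a time derivative at a fixed reference point and equals the
    continuous extension from every adjacent block, so it is continuous across the interfaces. This
    makes its components times phi admissible in the integration by parts, which asks for global
    continuity as well as piecewise smoothness. *)

Lemma open_borel (R : realType) p (A : set 'rV[R]_p) :
  open A -> @measurable _ (borel R p) A.
Proof. by move=> oA; apply: sub_sigma_algebra. Qed.

Lemma closed_borel (R : realType) p (A : set 'rV[R]_p) :
  closed A -> @measurable _ (borel R p) A.
Proof. by move/closed_openC/open_borel/measurableC; rewrite setCK. Qed.

Lemma within_continuous_borel (R : realType) p (D : set 'rV[R]_p) (f : 'rV[R]_p -> R) :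
  @measurable _ (borel R p) D -> {within D, continuous f} ->
  measurable_fun (D : set (borel R p)) (f : borel R p -> R).
Proof.
move=> mD /continuousP cf; apply: (measurability _ (RGenOpens.measurableE R)).
move=> _ [_ [a [b ->] <-]].
have oab : open `]a, b[%classic by exact: interval_open.
have /open_subspaceP [V oV VD] := cf _ oab.
rewrite setIC -VD; apply: measurableI => //; exact: open_borel.
Qed.

Lemma coord_borel (R : realType) p i :
  measurable_fun setT (fun v : borel R p => (v : 'rV[R]_p) 0 i).
Proof.
apply: within_continuous_borel; first exact: measurableT.
by apply: continuous_subspaceT; exact: coord_continuous.
Qed.

(** Half-open, so that the boxes are stable under intersection and the dyadic ones tile the space
    exactly. *)
Definition hbox (R : realType) p (a b : 'rV[R]_p) : set 'rV[R]_p :=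
  [set v | forall i, a 0 i <= v 0 i < b 0 i].

(** The floor function makes it immediate that each point lies in exactly one cube of each level. *)
Definition dcube (R : realType) p (n : nat) (z : 'rV[int]_p) : set 'rV[R]_p :=
  [set v | forall i, Num.floor (2 ^+ n * v 0 i) = z 0 i].

Arguments dcube R {p} n z _.

Lemma dcubeE (R : realType) p n (z : 'rV[int]_p) : dcube R n z =
  hbox (\row_i ((z 0 i)%:~R / 2 ^+ n)) (\row_i (((z 0 i)%:~R + 1) / 2 ^+ n)).
Proof.
have e0 : (0 : R) < 2 ^+ n by rewrite exprn_gt0.
apply/seteqP; split => v /= H i; have := H i.
  rewrite !mxE => <-; rewrite ler_pdivrMr// ltr_pdivlMr// [v 0 i * _]mulrC.
  by have := floor_itv (2 ^+ n * v 0 i); rewrite intrD.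
rewrite !mxE ler_pdivrMr// ltr_pdivlMr// mulrC => H'.
by apply: floor_def; rewrite intrD.
Qed.

Lemma measurable_hbox (R : realType) p (a b : 'rV[R]_p) : @measurable _ (borel R p) (hbox a b).
Proof.
have -> : hbox a b = \bigcap_(i in [set: 'I_p])
    ((fun v : 'rV[R]_p => v 0 i) @^-1` `[a 0 i, b 0 i[%classic).
  apply/seteqP; split => [v H i _|v H i]; first by rewrite /= in_itv /=; exact: H.
  by have := H i I; rewrite /= in_itv.
apply: fin_bigcap_measurable => //=.
move=> i _; rewrite -[X in measurable X]setTI; apply: coord_borel => //.
Qed.

Lemma hboxI (R : realType) p (a b c d : 'rV[R]_p) : hbox a b `&` hbox c d =
  hbox (\row_i Num.max (a 0 i) (c 0 i)) (\row_i Num.min (b 0 i) (d 0 i)).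
Proof.
apply/seteqP; split => [v [H1 H2] i|v H].
  by rewrite !mxE ge_max lt_min; have /andP[-> ->] := H1 i; have /andP[-> ->] := H2 i.
by split => i; have := H i; rewrite !mxE ge_max lt_min => /andP[/andP[? ?] /andP[? ?]]; apply/andP.
Qed.

Lemma dcube_diam (R : realType) p n (z : 'rV[int]_p) (x y : 'rV[R]_p) i :
  dcube R n z x -> dcube R n z y -> `|x 0 i - y 0 i| < (2 ^+ n)^-1.
Proof.
rewrite dcubeE => /(_ i) + /(_ i); rewrite !mxE mulrDl mul1r.
have H (a b u w : R) : a <= u < a + b -> a <= w < a + b -> `|u - w| < b.
  by move=> /andP[? ?] /andP[? ?]; rewrite ltr_norml; apply/andP; split; lra.
exact: H.
Qed.

Lemma dcube_near (R : realType) p (A : set 'rV[R]_p) x : nbhs x A ->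
  \forall n \near \oo, forall z, dcube R n z x -> dcube R n z `<=` A.
Proof.
move=> /nbhs_ballP[e /= e0 eA].
have /cvgrPdist_lt /(_ _ e0) := @cvg_geometric R 1 (2^-1) ltac:(rewrite ger0_norm; lra).
apply: filterS => n /=; rewrite sub0r normrN mul1r.
rewrite ger0_norm ?exprn_ge0 ?invr_ge0// exprVn => ne z zx y zy; apply: eA.
by split => // i j; rewrite (ord1 i); apply: lt_trans ne; exact: dcube_diam zx zy.
Qed.

Lemma dcube_floor (R : realType) p n (x : 'rV[R]_p) :
  dcube R n (\row_i Num.floor (2 ^+ n * x 0 i)) x.
Proof. by move=> i; rewrite mxE. Qed.

(** Small cubes around a point of A stay inside A. The index set of all pairs (level, corner) is
    countable; the empty set stands in for the cubes that leave A. *)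
Lemma open_bigcup_dcube (R : realType) p (A : set 'rV[R]_p) : open A ->
  A = \bigcup_(nz in [set: nat * 'rV[int]_p])
      (if `[< dcube R nz.1 nz.2 `<=` A >] then dcube R nz.1 nz.2 else set0).
Proof.
move=> oA; apply/seteqP; split => [x Ax|x [[n z] _ /=]].
  have /dcube_near[N _ /(_ N (leqnn N))] : nbhs x A by apply: open_nbhs_nbhs.
  move=> /(_ _ (dcube_floor N x)) H; exists (N, \row_i Num.floor (2 ^+ N * x 0 i)) => //=.
  by rewrite asboolT//; exact: dcube_floor.
by case: asboolP => [zA|_] //; exact: zA.
Qed.

(** Boxes form a generating family stable under intersection, as uniqueness of measures requires;
    they also reduce measurability of maps into the space to preimages of boxes. *)
Lemma borel_gen_hbox (R : realType) p :
  @measurable _ (borel R p) = <<s [set A | exists a b : 'rV[R]_p, A = hbox a b] >>.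
Proof.
apply/seteqP; split.
  apply: smallest_sub; first exact: smallest_sigma_algebra.
  move=> A oA; rewrite (open_bigcup_dcube oA).
  apply: (@countable_bigcupT_measurable _ (g_sigma_algebraType [set A | exists a b : 'rV[R]_p, A = hbox a b])).
    exact: countableP.
  move=> [n z]; case: ifP => _; last exact: measurable0.
  by apply: sub_sigma_algebra; rewrite dcubeE; do 2 eexists.
apply: smallest_sub; first exact: (@sigma_algebra_measurable _ (borel R p)).
by move=> _ [a [b ->]]; exact: measurable_hbox.
Qed.


(** * Slicing along the first coordinate; [lebesgue] as a measure on the Borel sets *)

Definition vcons (R : realType) (p : nat) (s : R) (v : 'rV[R]_p) : 'rV[R]_p.+1 :=
  row_mx (s%:M : 'rV[R]_1) v.

Lemma vcons0 (R : realType) p (s : R) (v : 'rV[R]_p) : vcons s v 0 0 = s.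
Proof. by rewrite /vcons -(lshift0 p 0) (@row_mxEl _ 1 1 p) mxE eqxx mulr1n. Qed.

Lemma vconsS (R : realType) p (s : R) (v : 'rV[R]_p) i :
  vcons s v 0 (lift 0 i) = v 0 i.
Proof. by rewrite /vcons -rshift1 (@row_mxEr _ 1 1 p). Qed.

Lemma vcons_hbox (R : realType) p (a b : 'rV[R]_p.+1) s v :
  hbox a b (vcons s v) <->
  a 0 0 <= s < b 0 0 /\ hbox (\row_i a 0 (lift 0 i)) (\row_i b 0 (lift 0 i)) v.
Proof.
split=> [H|[H1 H2] i].
  split; first by have := H 0; rewrite vcons0.
  by move=> i; have := H (lift 0 i); rewrite vconsS !mxE.
by case: (unliftP 0 i) => [j|] ->; rewrite ?vcons0 ?vconsS//; have := H2 j; rewrite !mxE.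
Qed.

Lemma measurable_fun_into_borel (R : realType) d (T : measurableType d) p
    (f : T -> 'rV[R]_p) :
  (forall a b, measurable (f @^-1` hbox a b)) ->
  measurable_fun setT (f : T -> borel R p).
Proof.
move=> H; apply: (measurability _ (borel_gen_hbox R p)).
by move=> _ [_ [a [b ->]] <-]; rewrite setTI; exact: H.
Qed.

Lemma measurable_vcons (R : realType) p :
  measurable_fun setT
    ((fun sv => vcons sv.1 sv.2) : measurableTypeR R * borel R p -> borel R p.+1).
Proof.
apply: measurable_fun_into_borel => a b.
have -> : (fun sv : measurableTypeR R * borel R p => vcons sv.1 sv.2) @^-1` hbox a b =
   `[a 0 0, b 0 0[%classic `*` hbox (\row_i a 0 (lift 0 i)) (\row_i b 0 (lift 0 i)).
  by apply/seteqP; split => -[s v] /=; rewrite in_itv /= => /vcons_hbox.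
by apply: measurableX; [exact: measurable_itv|exact: measurable_hbox].
Qed.

Lemma lebesgueS (R : realType) p (A : set 'rV[R]_p.+1) :
  lebesgue A = (\int[@lebesgue_measure R]_s @lebesgue R p [set v | A (vcons s v)])%E.
Proof. by []. Qed.

Lemma lebesgue_ge0 (R : realType) p (A : set 'rV[R]_p) : (0 <= lebesgue A)%E.
Proof.
elim: p A => [|p IH] A; first by rewrite /= lee_fin.
by rewrite lebesgueS; apply: integral_ge0.
Qed.

(** The truncation at 0 gives empty boxes volume 0. *)
Definition hvol (R : realType) p (a b : 'rV[R]_p) : R :=
  \prod_i Num.max 0 (b 0 i - a 0 i).

Lemma coord_le_norm (R : realType) p (v : 'rV[R]_p) i : `|v 0 i| <= `|v|.
Proof.
rewrite [leRHS]/Num.norm /= mx_normrE; apply/bigmax_geP; right => /=.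
by exists (0, i).
Qed.

Lemma hbox_cover (R : realType) p :
  \bigcup_n hbox (const_mx (- n%:R) : 'rV[R]_p) (const_mx n%:R) = setT.
Proof.
apply/seteqP; split => // v _.
exists (Num.bound `|v|) => // i; rewrite !mxE.
have H : `|v 0 i| < (Num.bound `|v|)%:R.
  apply: le_lt_trans (archi_boundP (normr_ge0 v)).
  exact: coord_le_norm.
by move: H; rewrite ltr_norml => /andP[/ltW -> ->].
Qed.

Lemma hbox_sigma_finite (R : realType) p (m : {measure set (borel R p) -> \bar R}) :
  (forall a b, m (hbox a b) = (hvol a b)%:E) -> sigma_finite setT m.
Proof.
move=> mh; exists (fun n => hbox (const_mx (- n%:R)) (const_mx n%:R)).
  by rewrite hbox_cover.
by move=> n; split; [exact: measurable_hbox|rewrite mh ltry].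
Qed.

Section sigma_finite_measure_of.
Context d (T : measurableType d) (R : realType) (m : {measure set T -> \bar R}).
Hypothesis sf : sigma_finite setT m.

(** The measure m under a new name, to which the sigma-finiteness [sf] can be attached as a
    structure; the product construction demands it. *)
Definition sigma_finite_measure_of : set T -> \bar R := m.

HB.instance Definition _ := isMeasure.Build _ _ _ sigma_finite_measure_of
  (measure0 m) (measure_ge0 m) (@measure_semi_sigma_additive _ _ _ m).

HB.instance Definition _ := Measure_isSigmaFinite.Build _ _ _ sigma_finite_measure_of sf.
Definition sigma_finite_pack : {sigma_finite_measure set T -> \bar R} :=
  sigma_finite_measure_of.
End sigma_finite_measure_of.

Lemma measurable_slice (R : realType) p (A : set 'rV[R]_p.+1) s :
  @measurable _ (borel R p.+1) A ->
  @measurable _ (borel R p) [set v | A (vcons s v)].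
Proof.
move=> mA.
have := @measurable_vcons R p measurableT _ mA; rewrite setTI => /(measurable_xsection s).
by congr measurable; apply/seteqP; split => v; rewrite /xsection/= inE.
Qed.

(** By induction, slicing agrees on Borel sets with the image of a product measure under [vcons].
    The box volumes are carried along because they give the sigma-finiteness that the next product
    needs. *)
Lemma lebesgue_measure_ex (R : realType) p :
  exists m : {measure set (borel R p) -> \bar R},
   (forall A, measurable A -> m A = lebesgue A) /\
   forall a b, m (hbox a b) = (hvol a b)%:E.
Proof.
elim: p => [|p [m [mE mh]]].
  exists (@dirac _ (borel R 0) 0 R); split => // a b.
  by rewrite /= diracE /hvol big_ord0 mem_set// => -[].
pose m' : {sigma_finite_measure set (borel R p) -> \bar R} :=
  sigma_finite_pack (hbox_sigma_finite mh).
pose mu := measure_function_pushforward__canonical__measure_function_Measure (@lebesgue_measure R \x m')%E (@measurable_vcons R p).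
have m'E : (m' : set _ -> _) = m by [].
have muE (A : set 'rV[R]_p.+1) : @measurable _ (borel R p.+1) A -> 
   mu A = (\int[@lebesgue_measure R]_s m [set v | A (vcons s v)])%E.
  move=> mA; apply: eq_integral => s _ /=; congr (m _).
  by apply/seteqP; split => v; rewrite /xsection/= inE.
exists mu; split=> [A mA|a b].
  by rewrite muE// lebesgueS; apply: eq_integral => s _; rewrite mE//; exact: measurable_slice.
rewrite muE; last exact: measurable_hbox.
(* The slice of a box is the box of the remaining coordinates when s lies in the first side, and
   empty otherwise. *)
transitivity (\int[@lebesgue_measure R]_s (hvol (\row_i a 0 (lift 0 i))
    (\row_i b 0 (lift 0 i)) * \1_(`[a 0 0, b 0 0[%classic) s)%:E)%E.
  apply: eq_integral => s _; rewrite indicE; have [|] := boolP (s \in _).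
    rewrite inE /= in_itv /= => sab; rewrite mulr1 -mh; congr (m _).
    by apply/seteqP; split => v /=; rewrite vcons_hbox// => -[].
  rewrite notin_setE /= in_itv /= => sab; rewrite mulr0; apply/eqP.
  rewrite -[X in m X](_ : set0 = _) ?measure0//.
  by apply/seteqP; split => v //=; rewrite vcons_hbox => -[].
under eq_integral do rewrite EFinM.
rewrite integralZl//; last first.
  exact: integrable_indic_itv.
rewrite integral_indic ?setIT; [|exact: measurableT|exact: measurable_itv].
rewrite /= lebesgue_measure_itv /= [in RHS]/hvol big_ord_recl muleC.
rewrite /hvol EFinM; congr (_ * _)%E.
  case: ltP => ab; last by rewrite max_l// subr_le0 -lee_fin.
  by rewrite max_r// subr_ge0 ltW// -lte_fin.
by congr EFin; apply: eq_bigr => i _; rewrite !mxE.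
Qed.

Definition leb (R : realType) p : set (borel R p) -> \bar R := @lebesgue R p.
Arguments leb R p : clear implicits.

Section leb_measure.
Context (R : realType) (p : nat).
Local Notation mu := (leb R p).

Let mu0 : mu set0 = 0%E.
Proof. by have [m [mE _]] := lebesgue_measure_ex R p; rewrite /leb -mE// measure0. Qed.

Let mu_ge0 A : (0 <= mu A)%E.
Proof. exact: lebesgue_ge0. Qed.

Let mu_sigma : semi_sigma_additive mu.
Proof.
move=> F mF tF mUF; have [m [mE _]] := lebesgue_measure_ex R p.
rewrite /leb -mE//; under eq_fun do under eq_bigr do rewrite -mE//.
exact: measure_semi_sigma_additive.
Qed.

HB.instance Definition _ := isMeasure.Build _ _ _ mu mu0 mu_ge0 mu_sigma.

Lemma leb_hbox a b : mu (hbox a b) = (hvol a b)%:E.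
Proof.
by have [m [mE mh]] := lebesgue_measure_ex R p; rewrite /leb -mE//; exact: measurable_hbox.
Qed.

HB.instance Definition _ :=
  Measure_isSigmaFinite.Build _ _ _ mu (hbox_sigma_finite leb_hbox).

End leb_measure.

Lemma lebS (R : realType) p (A : set 'rV[R]_p.+1) :
  leb R p.+1 A = (\int[@lebesgue_measure R]_s leb R p [set v | A (vcons s v)])%E.
Proof. by []. Qed.

Lemma measurable_leb_slice (R : realType) p (A : set 'rV[R]_p.+1) :
  @measurable _ (borel R p.+1) A ->
  measurable_fun setT (fun s : measurableTypeR R => leb R p [set v | A (vcons s v)]).
Proof.
move=> mA; have := @measurable_vcons R p measurableT _ mA; rewrite setTI.
move=> /(measurable_fun_xsection (leb R p)); apply: eq_measurable_fun => s _ /=.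
by congr (leb R p _); apply/seteqP; split => v; rewrite /xsection/= inE.
Qed.

Lemma leb_unique (R : realType) p (m : {measure set (borel R p) -> \bar R}) :
  (forall a b, m (hbox a b) = (hvol a b)%:E) ->
  forall A, measurable A -> m A = leb R p A.
Proof.
move=> mh A mA; apply/esym.
apply: (@measure_unique _ R (borel R p) [set A | exists a b : 'rV[R]_p, A = hbox a b]
  (fun n => hbox (const_mx (- n%:R)) (const_mx n%:R))) => //.
- exact: borel_gen_hbox.
- by move=> _ _ [a [b ->]] [c [d ->]]; rewrite hboxI; do 2 eexists.
- by move=> n; do 2 eexists.
- exact: hbox_cover.
- by move=> _ [a [b ->]]; rewrite mh; exact: leb_hbox.
- by move=> n; rewrite /= leb_hbox ltry.
Qed.

Definition push d d' (T : measurableType d) (T' : measurableType d') (R : realType)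
    (m : {measure set T -> \bar R}) (f : T -> T') (mf : measurable_fun setT f) :
    {measure set T' -> \bar R} :=
  measure_function_pushforward__canonical__measure_function_Measure m mf.

Lemma pushE d d' (T : measurableType d) (T' : measurableType d') (R : realType)
    (m : {measure set T -> \bar R}) (f : T -> T') (mf : measurable_fun setT f) A :
  push m mf A = m (f @^-1` A).
Proof. by []. Qed.


(** * Lebesgue measure under translations and invertible matrices *)

Lemma coords_borel (R : realType) d (T : measurableType d) p (f : T -> 'rV[R]_p) :
  (forall i, measurable_fun setT (fun t => f t 0 i)) ->
  measurable_fun setT (f : T -> borel R p).
Proof.
move=> mf; apply: measurable_fun_into_borel => a b.
have -> : f @^-1` hbox a b = \bigcap_(i in [set: 'I_p])
    ((fun t => f t 0 i) @^-1` `[a 0 i, b 0 i[%classic).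
  apply/seteqP; split => [v H i _|v H i]; first by rewrite /= in_itv /=; exact: H.
  by have := H i I; rewrite /= in_itv.
apply: fin_bigcap_measurable => //= i _.
by rewrite -[X in measurable X]setTI; exact: mf.
Qed.

Lemma translate_borel (R : realType) p (c : 'rV[R]_p) :
  measurable_fun setT (fun v : borel R p => (v : 'rV[R]_p) + c : borel R p).
Proof.
apply: (@coords_borel _ _ (borel R p) _ (fun v : 'rV[R]_p => v + c)) => i.
under eq_fun do rewrite mxE.
apply: measurable_funD; first exact: coord_borel.
exact: measurable_cst.
Qed.

Lemma leb_translate (R : realType) p (c : 'rV[R]_p) (A : set 'rV[R]_p) :
  @measurable _ (borel R p) A -> leb R p [set v | A (v + c)] = leb R p A.
Proof.
move=> mA; apply: (@leb_unique _ _ (push (leb R p) (translate_borel c))) => // a b.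
rewrite pushE (_ : _ @^-1` _ = hbox (a - c) (b - c)).
  rewrite /= leb_hbox; congr EFin; apply: eq_bigr => i _.
  by rewrite !mxE opprB addrA subrK.
by apply/seteqP; split => v /= H i; have := H i; rewrite !mxE lerBlDr ltrBrDr.
Qed.

Lemma mulmx_borel (R : realType) p (T : 'M[R]_p) :
  measurable_fun setT (fun v : borel R p => (v : 'rV[R]_p) *m T : borel R p).
Proof.
apply: (@coords_borel _ _ (borel R p) _ (fun v : 'rV[R]_p => v *m T)) => i.
under eq_fun do rewrite mxE.
apply: measurable_sum => j; apply: measurable_funM; first exact: coord_borel.
exact: measurable_cst.
Qed.

Lemma mul_perm_mxE (R : realType) p (s : 'S_p) (v : 'rV[R]_p) i :
  (v *m perm_mx s) 0 i = v 0 (s^-1%g i).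
Proof. by rewrite -{1}[s]invgK -col_permE !mxE. Qed.

Lemma leb_perm (R : realType) p (s : 'S_p) (A : set 'rV[R]_p) :
  @measurable _ (borel R p) A -> leb R p [set v | A (v *m perm_mx s)] = leb R p A.
Proof.
move=> mA; apply: (@leb_unique _ _ (push (leb R p) (mulmx_borel (perm_mx s)))) => // a b.
rewrite pushE (_ : _ @^-1` _ = hbox (a *m perm_mx s^-1) (b *m perm_mx s^-1)).
  rewrite /= leb_hbox; congr EFin; rewrite /hvol [LHS](reindex_inj (@perm_inj _ s^-1)).
  by apply: eq_bigr => i _; rewrite !mul_perm_mxE invgK permKV.
apply/seteqP; split => v /= H i.
  by have := H (s i); rewrite !mul_perm_mxE invgK permK.
by have := H (s^-1%g i); rewrite !mul_perm_mxE invgK permKV.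
Qed.

(** Written with the preimage of A, so that the property passes to products of matrices without
    inverses. *)
Definition linvol (R : realType) p (T : 'M[R]_p) := forall A : set 'rV[R]_p,
  @measurable _ (borel R p) A -> (`|\det T|%:E * leb R p [set v | A (v *m T)] = leb R p A)%E.

Lemma linvolM (R : realType) p (S T : 'M[R]_p) : linvol S -> linvol T -> linvol (S *m T).
Proof.
move=> hS hT A mA.
have mTA : @measurable _ (borel R p) [set v | A (v *m T)].
  by have := mulmx_borel T measurableT mA; rewrite setTI.
rewrite -(hT _ mA) -(hS _ mTA).
rewrite muleA -EFinM -normrM mulrC -det_mulmx; congr (_ * leb _ _ _)%E.
by apply/seteqP; split => v /=; rewrite mulmxA.
Qed.

Lemma linvol_perm (R : realType) p (s : 'S_p) : linvol (perm_mx s : 'M[R]_p).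
Proof. by move=> A mA; rewrite det_perm normrX normrN1 expr1n mul1e leb_perm. Qed.

Lemma lebesgue_measure_scale (R : realType) (a : R) (A : set (measurableTypeR R)) : a != 0 ->
  measurable A ->
  (`|a|%:E * @lebesgue_measure R ((fun x : R => (x * a)%R) @^-1` A) = @lebesgue_measure R A)%E.
Proof.
move=> a0 mA.
have ms : measurable_fun setT (fun x : measurableTypeR R => (x * a)%R : measurableTypeR R).
  exact: mulrr_measurable.
have [na naE] : exists na : {nonneg R}, na%:num = `|a| by exists (`|a|%:nng).
pose m : {measure set (measurableTypeR R) -> \bar R} :=
  mscale na (push (@lebesgue_measure R) ms).
rewrite -naE; apply/esym/(@lebesgue_measure_unique _ m) => // _ [[x y]] _ <-.
rewrite lebesgue_measure_itv /m /= /mscale /= /pushforward naE.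
have na0 : (0 < `|a|) by rewrite normr_gt0.
move: a0; rewrite neq_lt => /orP[a0|a0].
  (* A negative factor swaps the endpoints, hence also which of them is included; the length does
     not change. *)
  rewrite (_ : _ @^-1` _ = `[y / a, x / a[%classic).
    rewrite lebesgue_measure_itv /= !lte_fin ltr_nM2r ?invr_lt0//.
    case: ifP => // _; last by rewrite mule0.
    by rewrite ltr0_norm//; congr EFin; field; rewrite lt_eqF.
  apply/seteqP; split => z /=; rewrite !in_itv /= => /andP[]; rewrite ?ler_ndivrMr ?ltr_ndivlMr//.
    by move=> -> ->.
  by move=> -> ->.
rewrite (_ : _ @^-1` _ = `]x / a, y / a]%classic).
  rewrite lebesgue_measure_itv /= !lte_fin ltr_pM2r ?invr_gt0//.
  case: ifP => // _; last by rewrite mule0.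
  by rewrite gtr0_norm//; congr EFin; field; rewrite gt_eqF.
by apply/seteqP; split => z /=; rewrite !in_itv /= ler_pdivlMr// ltr_pdivrMr.
Qed.

Lemma integral_scale (R : realType) (a : R) (g : measurableTypeR R -> \bar R) : a != 0 ->
  measurable_fun setT g -> (forall x, 0 <= g x)%E ->
  (`|a|%:E * \int[@lebesgue_measure R]_s g (s * a)%R = \int[@lebesgue_measure R]_s g s)%E.
Proof.
move=> a0 mg g0.
have ms : measurable_fun setT (fun x : measurableTypeR R => (x * a)%R : measurableTypeR R).
  exact: mulrr_measurable.
have [na naE] : exists na : {nonneg R}, na%:num = `|a| by exists (`|a|%:nng).
pose m : {measure set (measurableTypeR R) -> \bar R} :=
  mscale na (push (@lebesgue_measure R) ms).
transitivity (\int[m]_s g s)%E; last first.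
  apply: eq_measure_integral => A mA _; rewrite /m /= /mscale naE; exact: (lebesgue_measure_scale a0 mA).
rewrite ge0_integral_mscale// naE; congr (_ * _)%E.
by rewrite ge0_integral_pushforward.
Qed.

(** With a vanishing lower left block the new first coordinate depends on s alone, so slices go to
    slices. *)
Lemma vcons_mulmx (R : realType) p (s : R) (v : 'rV[R]_p) (T : 'M[R]_(1 + p)) :
  dlsubmx T = 0 ->
  (vcons s v : 'rV_(1 + p)) *m T = vcons (s * T 0 0) (v *m drsubmx T + s *: ursubmx T).
Proof.
move=> T0; rewrite -[T in LHS]submxK T0 /vcons mul_row_block mulmx0 addr0.
congr row_mx; last by rewrite addrC mul_scalar_mx.
by rewrite [ulsubmx T]mx11_scalar -scalar_mxM /ulsubmx !mxE lshift0.
Qed.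

(** Induction on the dimension: on the slice at s the map is the lower right block followed by a
    translation that depends only on s, and in s it is a scaling by [T 0 0]. *)
Lemma linvol_trig (R : realType) p (T : 'M[R]_p) :
  (forall i j : 'I_p, (j < i)%N -> T i j = 0) -> (forall i, T i i != 0) -> linvol T.
Proof.
elim: p T => [T _ _ A mA|p IH T T0 T1 A mA].
  rewrite det_mx00 normr1 mul1e; congr (leb _ _ _).
  by apply/seteqP; split => v /=; rewrite !thinmx0.
have dl0 : dlsubmx (T : 'M[R]_(1 + p)) = 0.
  by apply/matrixP => i j; rewrite !mxE ord1 T0.
have IHT : linvol (drsubmx (T : 'M[R]_(1 + p))).
  apply: IH => [i j ij|i]; rewrite !mxE; first by rewrite T0.
  exact: T1.
have detT : \det T = T 0 0 * \det (drsubmx (T : 'M[R]_(1 + p))).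
  rewrite -[T in LHS](@submxK _ 1 p 1 p) dl0.
  rewrite (det_ublock (n1 := 1)); congr (_ * _).
  by rewrite det_mx11 !mxE lshift0.
pose g s := leb R p [set v | A (vcons s v)].
have mg : measurable_fun setT (g : measurableTypeR R -> _) by exact: measurable_leb_slice.
have g0 x : (0 <= g x)%E by exact: measure_ge0.
rewrite [RHS]lebS -(integral_scale (T1 0) mg g0) lebS detT normrM EFinM -muleA; congr (_ * _)%E.
rewrite -ge0_integralZl//; last first.
  apply: (@measurable_leb_slice _ _ [set v | A (v *m T)]).
  by have := mulmx_borel T measurableT mA; rewrite setTI.
apply: eq_integral => s _; rewrite /g.
have mAs : @measurable _ (borel R p) [set v | A (vcons (s * T 0 0) v)] by exact: measurable_slice.
rewrite -(leb_translate (s *: ursubmx (T : 'M[R]_(1 + p))) mAs).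
have mAs' : @measurable _ (borel R p) [set v | [set v | A (vcons (s * T 0 0) v)] (v + s *: ursubmx (T : 'M[R]_(1 + p)))].
  by have := translate_borel (s *: ursubmx (T : 'M[R]_(1 + p))) measurableT mAs; rewrite setTI.
rewrite -(IHT _ mAs'); congr (_ * leb _ _ _)%E.
by apply/seteqP; split => v /=; rewrite (vcons_mulmx _ _ dl0).
Qed.

(* LUP decomposition.  Slicing along the first coordinate treats upper triangular
   matrices; L becomes one when the order of the coordinates is reversed. *)
Lemma linvol_unitmx (R : realType) p (T : 'M[R]_p) : T \in unitmx -> linvol T.
Proof.
case: p T => [|p] T uT; first by apply: linvol_trig => -[].
have := cormen_lup_correct T; have := cormen_lup_perm T.
have := cormen_lup_lower T; have := cormen_lup_upper T; have := cormen_lup_detL T.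
case: (cormen_lup T) => -[P L] U /= dL hU hL /is_perm_mxP[s ->] PT.
have {}PT : perm_mx s *m T = L *m U := PT.
pose r : 'S_p.+1 := perm (@rev_ord_inj p.+1).
have rr : (r^-1 = r)%g.
  apply/permP => i; apply: (@perm_inj _ r); rewrite permKV !permE/=.
  by rewrite rev_ordK.
have Lr : linvol (perm_mx r *m L *m perm_mx r).
  rewrite -row_permE -{2}rr -col_permE.
  apply: linvol_trig => [i j ij|i]; rewrite !mxE !permE.
    rewrite hL /=; last by rewrite leq_sub2l// ltnW.
    by rewrite -val_eqE /= eqn_sub2lE// gtn_eqF.
  by rewrite hL// eqxx oner_eq0.
have Lv : linvol L.
  have <- : perm_mx r *m (perm_mx r *m L *m perm_mx r) *m perm_mx r = L.
    by rewrite !mulmxA -perm_mxM -{1}rr mulVg perm_mx1 mul1mx -mulmxA -perm_mxM -{1}rr mulVg perm_mx1 mulmx1.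
  have Pr := linvol_perm (R := R) r.
  exact: linvolM (linvolM Pr Lr) Pr.
(* A zero on the diagonal of U would make the determinant of T vanish. *)
have Uv : linvol U.
  apply: linvol_trig => // i; apply/eqP => Ui0.
  have : \det (perm_mx s *m T) = 0.
    rewrite PT det_mulmx -(det_tr U) [\det U^T]det_trig.
      by rewrite (bigD1 i)//= mxE Ui0 mul0r mulr0.
    by apply/is_trig_mxP => k l kl; rewrite mxE hU.
  by move/eqP; rewrite -[_ == _]negbK -unitfE -unitmxE unitmx_mul uT unitmx_perm.
have -> : T = perm_mx s^-1%g *m (L *m U).
  by rewrite -PT mulmxA -perm_mxM mulVg perm_mx1 mul1mx.
by apply: linvolM; [exact: linvol_perm|exact: linvolM].
Qed.

Lemma leb_image_mulmx (R : realType) p (T : 'M[R]_p) (A : set 'rV[R]_p) :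
  T \in unitmx -> @measurable _ (borel R p) A ->
  leb R p [set v | A (v *m invmx T)] = (`|\det T|%:E * leb R p A)%E.
Proof.
move=> uT mA; have := linvol_unitmx uT.
have mTA : @measurable _ (borel R p) [set v | A (v *m invmx T)].
  by have := mulmx_borel (invmx T) measurableT mA; rewrite setTI.
move=> /(_ _ mTA) <-; congr (_ * leb _ _ _)%E.
by apply/seteqP; split => v /=; rewrite mulmxK.
Qed.

(** * Change of variables *)

Section density.
Local Open Scope ereal_scope.
Context d (T : measurableType d) (R : realType) (m : {measure set T -> \bar R}).
Variable g : T -> \bar R.
Hypotheses (mg : measurable_fun setT g) (g0 : forall x, 0 <= g x).

Definition density_fun (A : set T) : \bar R := \int[m]_(x in A) g x.

Let d0 : density_fun set0 = 0.
Proof. by rewrite /density_fun integral_set0. Qed.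

Let dge0 A : 0 <= density_fun A.
Proof. by apply: integral_ge0. Qed.

Let dsigma : semi_sigma_additive density_fun.
Proof.
move=> F mF tF mUF; rewrite /density_fun ge0_integral_bigcup//; last exact: measurable_funTS.
by apply: is_cvg_nneseries => n _ _; exact: integral_ge0.
Qed.

HB.instance Definition _ := isMeasure.Build _ _ _ density_fun d0 dge0 dsigma.

Definition density : {measure set T -> \bar R} := density_fun.

Lemma densityE A : density A = \int[m]_(x in A) g x.
Proof. by []. Qed.

End density.

(** * Dyadic comparison of measures and linear approximation *)

Lemma dcube_triv (R : realType) p n (z z' : 'rV[int]_p) (x : 'rV[R]_p) :
  dcube R n z x -> dcube R n z' x -> z = z'.
Proof. by move=> H H'; apply/rowP => i; rewrite -(H i) (H' i). Qed.

Lemma measurable_dcube (R : realType) p n (z : 'rV[int]_p) : @measurable _ (borel R p) (dcube R n z).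
Proof. by rewrite dcubeE; exact: measurable_hbox. Qed.

(* Only the cubes around a point that are small enough, depending on the point,
   are compared: the points for which all cubes of level at least n are good
   increase to U. *)
Lemma dyadic_comparison (R : realType) p (m1 m2 : {measure set (borel R p) -> \bar R})
    (U : set 'rV[R]_p) (K : R) : open U -> 0 <= K ->
  (forall x, U x -> \forall n \near \oo, forall z, dcube R n z x ->
     (m1 (dcube R n z) <= K%:E * m2 (dcube R n z))%E) ->
  (m1 U <= K%:E * m2 U)%E.
Proof.
move=> oU K0 H.
pose good n z := dcube R n z `<=` U /\ (m1 (dcube R n z) <= K%:E * m2 (dcube R n z))%E.
(* Coding the corners by natural numbers turns the good cubes of one level into a disjoint sequence,
   as countable additivity needs. *)
pose F n k : set (borel R p) := [set x | exists z, [/\ pickle z = k, good n z & dcube R n z x]].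
pose D n := \bigcup_k F n k.
pose E n := \bigcap_(m in [set m | (n <= m)%N]) D m.
have FP n k : F n k = set0 \/ exists2 z, good n z & F n k = dcube R n z.
  have [[z [zk gz]]|nz] := pselect (exists z, pickle z = k /\ good n z).
    right; exists z => //; apply/seteqP; split=> [x [z' [z'k _]]|x zx]; last by exists z.
    by have -> : z' = z by apply: (pcan_inj pickleK); rewrite z'k.
  left; apply/seteqP; split => // x [z [zk gz _]]; apply: nz; exists z; split => //.
have mF n k : measurable (F n k).
  by have [->|[z _ ->]] := FP n k; [exact: measurable0|exact: measurable_dcube].
have FU n k : F n k `<=` U.
  by have [->|[z [zU _] ->]] := FP n k.
have mU : @measurable _ (borel R p) U by exact: open_borel.
have mD k : measurable (D k) by apply: bigcupT_measurable => ?; exact: mF.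
have mE k : measurable (E k).
  apply: bigcap_measurable => //; exists k => //=.
have tF n : trivIset setT (F n).
  apply/trivIsetP => i j _ _; apply: contra_neqP => /eqP/set0P[x [[z [zi gz zx]] [z' [zj _ z'x]]]].
  by rewrite -zi -zj (dcube_triv zx z'x).
have DU n : D n `<=` U by apply: bigcup_sub => k _; exact: FU.
have ED n : E n `<=` D n by move=> x; apply => /=.
have m1D n : (m1 (D n) <= K%:E * m2 U)%E.
  apply: (@le_trans _ _ (K%:E * m2 (D n))%E); last first.
    by apply: lee_pmul => //; apply: le_measure => //; rewrite inE.
  rewrite !measure_bigcup// -nneseriesZl//; last first.
  apply: lee_nneseries => // k _.
  have [->|[z [_ gz] ->]] := FP n k; first by rewrite !measure0 mule0.
  exact: gz.
have UE : U = \bigcup_n E n.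
  apply/seteqP; split => [x Ux|x [n _ /ED/DU]//].
  have /dcube_near[N1 _ H1] : nbhs x U by apply: open_nbhs_nbhs.
  have [N2 _ H2] := H _ Ux.
  exists (maxn N1 N2) => // n /=; rewrite geq_max => /andP[n1 n2].
  have xf := dcube_floor n x.
  exists (pickle (\row_i Num.floor (2 ^+ n * x 0 i))) => //.
  exists (\row_i Num.floor (2 ^+ n * x 0 i)); split => //; split; [exact: H1|exact: H2].
have ndE : nondecreasing_seq E.
  move=> n m nm; apply/subsetPset => x Ex k /= mk; apply: Ex => /=; exact: leq_trans mk.
have mUE : measurable (\bigcup_n E n) by apply: bigcupT_measurable.
rewrite {1}UE; have /cvg_lim <- := nondecreasing_cvg_mu (mu := m1) mE mUE ndE => //.
apply: lime_le; first by apply: ereal_nondecreasing_is_cvgn => n m nm /=; apply: le_measure; rewrite ?inE//; exact/subsetPset/ndE.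
apply: nearW => n /=; apply: le_trans (m1D n); apply: le_measure; rewrite ?inE//; exact: ED.
Qed.

Lemma mulmx_bound (R : realType) p q (M : 'M[R]_(p, q)) :
  exists2 C : R, 0 < C & forall w : 'rV[R]_p, `|w *m M| <= C * `|w|.
Proof.
exists (p%:R * `|M| + 1) => [|w]; first by rewrite ltr_wpDl ?mulr_ge0.
have C0 : 0 <= (p%:R * `|M| + 1) * `|w| by rewrite mulr_ge0// addr_ge0// mulr_ge0.
rewrite [leLHS]/Num.norm /= mx_normrE; apply/bigmax_leP; split => // -[i j] _ /=.
rewrite mxE (le_trans (ler_norm_sum _ _ _))//.
apply: (@le_trans _ _ (\sum_(k < p) `|w| * `|M|)).
  apply: ler_sum => k _; rewrite normrM ler_pM//.
    by rewrite ord1; exact: coord_le_norm.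
  rewrite [leRHS]/Num.norm /= mx_normrE; apply/bigmax_geP; right => /=.
  by exists (k, j).
rewrite sumr_const card_ord -[leLHS]mulr_natr mulrDl mul1r ler_wpDr//.
by rewrite mulrC [`|w| * _]mulrC mulrA.
Qed.

(** Fréchet differentiability at x. Matrices act on row vectors from the right, so T is the
    transposed Jacobian matrix: entry (i, j) is the derivative of component j in direction i. *)
Definition lin_approx (R : realType) p q (f : 'rV[R]_p -> 'rV[R]_q) (x : 'rV[R]_p) (T : 'M[R]_(p, q)) :=
  forall e : R, 0 < e -> \forall y \near x, `|f y - f x - (y - x) *m T| <= e * `|y - x|.

Lemma lin_approx_cvg (R : realType) p q (f : 'rV[R]_p -> 'rV[R]_q) (x : 'rV[R]_p) T :
  lin_approx f x T -> f y @[y --> x] --> f x.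
Proof.
move=> fT; have [C C0 CT] := mulmx_bound T.
apply/(@cvgrPdist_lt _ 'rV[R]_q _ (nbhs x) _ f) => e e0.
have C1 : 0 < C + 1 by rewrite addr_gt0.
have /= := fT 1 ltr01.
have : \forall y \near x, `|x - y| < e / (C + 1).
  apply/nbhs_ballP; exists (e / (C + 1)); first by rewrite /= divr_gt0.
  by move=> y; rewrite -ball_normE.
apply: filterS2 => y; rewrite ltr_pdivlMr// distrC => yx.
rewrite mul1r => H; rewrite distrC; apply: le_lt_trans yx.
rewrite -[f y - f x](subrK ((y - x) *m T)).
apply: (le_trans (ler_normD _ _)).
rewrite mulrDr mulr1 addrC lerD//; rewrite mulrC; exact: CT.
Qed.

Lemma hvol_cube (R : realType) p (a b : 'rV[R]_p) (r : R) : 0 <= r ->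
  (forall i, b 0 i - a 0 i = r) -> hvol a b = r ^+ p.
Proof.
move=> r0 H; rewrite /hvol (eq_bigr (fun=> r)) ?prodr_const ?card_ord// => i _.
by rewrite H max_r.
Qed.

Definition dlow (R : realType) p n (z : 'rV[int]_p) : 'rV[R]_p := \row_i ((z 0 i)%:~R / 2 ^+ n).
(** A negative e shrinks the cube, so one formula serves for the outer and the inner
    approximation. *)
Definition dcube_pad (R : realType) p n (z : 'rV[int]_p) (e : R) : set 'rV[R]_p :=
  hbox (dlow R n z - const_mx e) (dlow R n z + const_mx ((2 ^+ n)^-1 + e)).

Lemma dcube_pad0 (R : realType) p n (z : 'rV[int]_p) : dcube R n z = dcube_pad n z 0.
Proof.
rewrite dcubeE /dcube_pad; congr hbox; apply/rowP => i; rewrite !mxE ?subr0 ?addr0//.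
by rewrite mulrDl mul1r.
Qed.

Lemma leb_dcube_pad (R : realType) p n (z : 'rV[int]_p) (k : R) : 0 <= 1 + 2 * k ->
  leb R p (dcube_pad n z (k / 2 ^+ n)) = ((1 + 2 * k) ^+ p * ((2 ^+ n)^-1) ^+ p)%:E.
Proof.
move=> k0; rewrite leb_hbox; congr EFin; rewrite -exprMn; apply: hvol_cube => [|i].
  by rewrite mulr_ge0// invr_ge0 exprn_ge0.
by rewrite !mxE; ring.
Qed.

Lemma leb_dcube (R : realType) p n (z : 'rV[int]_p) :
  leb R p (dcube R n z) = (((2 ^+ n)^-1) ^+ p)%:E.
Proof.
have -> : dcube R n z = dcube_pad n z (0 / 2 ^+ n) by rewrite mul0r dcube_pad0.
by rewrite leb_dcube_pad mulr0 addr0 // expr1n mul1r.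
Qed.

(** The set is the image of A under the affine map that sends u to (u - x) T + c, written as a
    preimage under its inverse. *)
Lemma leb_affine (R : realType) p (T : 'M[R]_p) (c x : 'rV[R]_p) (A : set 'rV[R]_p) :
  T \in unitmx -> @measurable _ (borel R p) A ->
  @measurable _ (borel R p) [set v | A ((v - c) *m invmx T + x)] /\
  leb R p [set v | A ((v - c) *m invmx T + x)] = (`|\det T|%:E * leb R p A)%E.
Proof.
move=> uT mA; rewrite -(leb_translate x mA).
have mA' : @measurable _ (borel R p) [set v | A (v + x)].
  by have := translate_borel x measurableT mA; rewrite setTI.
rewrite -leb_image_mulmx//.
have mA'' : @measurable _ (borel R p) [set v | A (v *m invmx T + x)].
  by have := mulmx_borel (invmx T) measurableT mA'; rewrite setTI.
split; first by have := translate_borel (- c) measurableT mA''; rewrite setTI.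
by rewrite -(leb_translate (- c) mA'').
Qed.
Section CoV.
Context (R : realType) (p : nat) (U V : set 'rV[R]_p) (X Y : 'rV[R]_p -> 'rV[R]_p).
Variable (T : 'rV[R]_p -> 'M[R]_p).
Hypotheses (oU : open U) (oV : open V).
Hypothesis XV : forall x, U x -> V (X x).
Hypothesis YU : forall y, V y -> U (Y y).
Hypothesis XK : forall x, U x -> Y (X x) = x.
Hypothesis YK : forall y, V y -> X (Y y) = y.
Hypothesis uT : forall x, U x -> T x \in unitmx.
Hypothesis dX : forall x, U x -> lin_approx X x (T x).
Hypothesis dY : forall x, U x -> lin_approx Y (X x) (invmx (T x)).

Lemma dcube_norm n (z : 'rV[int]_p) (x u : 'rV[R]_p) :
  dcube R n z x -> dcube R n z u -> `|u - x| <= (2 ^+ n)^-1.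
Proof.
move=> zx zu; rewrite [leLHS]/Num.norm /= mx_normrE; apply/bigmax_leP; split => //.
by move=> [i j] _ /=; rewrite !mxE ord1; exact/ltW/dcube_diam/zx.
Qed.

Lemma expr2n_cvg (e : R) : 0 < e -> \forall n \near \oo, (2 ^+ n)^-1 < e.
Proof.
move=> e0.
have /cvgrPdist_lt /(_ _ e0) := @cvg_geometric R 1 (2^-1) ltac:(rewrite ger0_norm; lra).
apply: filterS => n /=; rewrite sub0r normrN mul1r.
by rewrite ger0_norm ?exprn_ge0 ?invr_ge0// exprVn.
Qed.

Lemma dcube_uniform (P : 'rV[R]_p -> Prop) x : (\forall y \near x, P y) ->
  \forall n \near \oo, forall z, dcube R n z x -> forall y, `|y - x| <= (2 ^+ n)^-1 -> P y.
Proof.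
move=> /nbhs_ballP[e /= e0 eP]; have := expr2n_cvg e0; apply: filterS => n ne z zx y yx.
apply: eP; rewrite -ball_normE /ball_ /= distrC; exact: le_lt_trans ne.
Qed.

(** The error of the linearization is small relative to the side of the cube, so the image of the
    cube under X lies in the affine image of a slightly larger cube. *)
Lemma preimage_upper x (k : R) : U x -> 0 < k -> \forall n \near \oo, forall z, dcube R n z x ->
  V `&` Y @^-1` (dcube R n z) `<=`
    [set v | dcube_pad n z (k / 2 ^+ n) ((v - X x) *m invmx (T x) + x)].
Proof.
move=> Ux k0; have [C C0 CT] := mulmx_bound (invmx (T x)).
(* Pulling the error back by the inverse of [T x] multiplies it by at most C; the ratio k / C leaves
   k times the side. *)
have := dX Ux (divr_gt0 k0 C0) => /dcube_uniform; apply: filterS => n H z zx v [Vv zv] /=.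
have := H z zx _ (dcube_norm zx zv); rewrite YK//.
set er := v - X x - _ => Her.
have vE : (v - X x) *m invmx (T x) + x = Y v + er *m invmx (T x).
  have -> : v - X x = er + (Y v - x) *m T x by rewrite /er subrK.
  by rewrite mulmxDl mulmxK ?uT// -addrA subrK addrC.
have erk : `|er *m invmx (T x)| <= k / 2 ^+ n.
  apply: le_trans (CT _) _; apply: (@le_trans _ _ (C * (k / C * (2 ^+ n)^-1))).
    rewrite ler_pM2l//; apply: le_trans Her _; rewrite ler_pM2l ?divr_gt0//; exact: dcube_norm.
  by rewrite !mulrA [C * k]mulrC mulfK// gt_eqF.
rewrite vE => i; have := zv; rewrite dcube_pad0 => /(_ i).
have := le_trans (coord_le_norm _ i) erk; rewrite ler_norml.
set w := er *m _; rewrite !mxE.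
have H' (a b c d e : R) : - e <= c <= e -> a - 0 <= b < a + (d + 0) -> a - e <= b + c < a + (d + e).
  by move=> /andP[? ?] /andP[? ?]; apply/andP; split; lra.
exact: H'.
Qed.

(** This inclusion rests on the differentiability of Y: a point in the affine image of the smaller
    cube is sent by Y close to its linear preimage, hence into the full cube. *)
Lemma preimage_lower x (k : R) : U x -> 0 < k -> \forall n \near \oo, forall z, dcube R n z x ->
  [set v | dcube_pad n z (- (k / 2 ^+ n)) ((v - X x) *m invmx (T x) + x)] `<=` 
  V `&` Y @^-1` (dcube R n z).
Proof.
move=> Ux k0; have [C C0 CT] := mulmx_bound (T x).
have nV : \forall v \near X x, V v by apply: open_nbhs_nbhs; split => //; exact: XV.
have /nbhs_ballP[e /= e0 eP] : nbhs (X x) (V `&` [set y | `|Y y - Y (X x) - (y - X x) *m invmx (T x)| <= k / C * `|y - X x|]).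
  exact: filterI nV (dY Ux (divr_gt0 k0 C0)).
(* From this level on, the affine image of the cube stays in the ball of radius e, where membership
   in V and the estimate for Y are available. *)
have := expr2n_cvg (divr_gt0 e0 C0); apply: filterS => n ne z zx v /= zv.
set w := (v - X x) *m invmx (T x) in zv.
have kn0 : 0 <= k / 2 ^+ n by rewrite divr_ge0// ltW// exprn_gt0.
have wxz : dcube R n z (w + x).
  rewrite dcube_pad0 => i; have := zv i; rewrite !mxE.
  have H' (a b d t : R) : 0 <= t -> a - - t <= b < a + (d + - t) -> a - 0 <= b < a + (d + 0).
    by move=> ? /andP[? ?]; apply/andP; split; lra.
  exact: H'.
have vX : v - X x = w *m T x by rewrite /w mulmxKV ?uT.
have vr : `|v - X x| <= C * (2 ^+ n)^-1.
  rewrite vX; apply: le_trans (CT _) _; rewrite ler_pM2l//.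
  by have := dcube_norm zx wxz; rewrite addrK.
have [Vv] : (V `&` [set y | `|Y y - Y (X x) - (y - X x) *m invmx (T x)| <= k / C * `|y - X x|]) v.
  apply: eP; rewrite -ball_normE /ball_ /= distrC; apply: le_lt_trans vr _.
  by rewrite mulrC -ltr_pdivlMr.
rewrite /= XK// -/w => Her; split => //=.
have erk : `|Y v - x - w| <= k / 2 ^+ n.
  apply: le_trans Her _; apply: (@le_trans _ _ (k / C * (C * (2 ^+ n)^-1))).
    by rewrite ler_pM2l// divr_gt0.
  by rewrite !mulrA mulfVK// gt_eqF.
rewrite dcube_pad0 => i; have := zv i.
have := le_trans (coord_le_norm _ i) erk; rewrite ler_norml.
rewrite !mxE; set wi := w 0 i.
have H' (a b c d t x0 : R) : - t <= b - x0 - c <= t -> a - - t <= c + x0 < a + (d + - t) -> a - 0 <= b < a + (d + 0).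
  by move=> /andP[? ?] /andP[? ?]; apply/andP; split; lra.
exact: H'.
Qed.

Lemma integral_le_cst d (W : measurableType d) (m : {measure set W -> \bar R}) (A : set W)
    (f : W -> R) (c : R) : measurable A -> measurable_fun A f ->
  (forall x, A x -> 0 <= f x <= c) -> (\int[m]_(x in A) (f x)%:E <= c%:E * m A)%E.
Proof.
move=> mA mf H; rewrite -integral_cst//; apply: ge0_le_integral => //.
- by move=> x /H/andP[? ?]; rewrite lee_fin.
- exact/measurable_EFinP.
- by move=> x /H/andP[? ?]; rewrite lee_fin; lra.
Qed.

Lemma integral_ge_cst d (W : measurableType d) (m : {measure set W -> \bar R}) (A : set W)
    (f : W -> R) (c : R) : measurable A -> measurable_fun A f -> 0 <= c ->
  (forall x, A x -> c <= f x) -> (c%:E * m A <= \int[m]_(x in A) (f x)%:E)%E.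
Proof.
move=> mA mf c0 H; rewrite -integral_cst//; apply: ge0_le_integral => //.
exact/measurable_EFinP.
Qed.

Lemma open_continuous_borel (W : set 'rV[R]_p) (f : 'rV[R]_p -> R) : open W ->
  (forall x, W x -> f y @[y --> x] --> f x) ->
  measurable_fun (W : set (borel R p)) (f : borel R p -> R).
Proof.
move=> oW cf; apply: within_continuous_borel; first exact: open_borel.
by apply: continuous_in_subspaceT => x; rewrite inE; exact: cf.
Qed.

Lemma near_mul_bound (K c : R) (f : 'rV[R]_p -> R) (x : 'rV[R]_p) : 1 < K -> f x = c -> 0 < c ->
  f y @[y --> x] --> f x -> \forall y \near x, c / K <= f y <= K * c.
Proof.
move=> K1 fx c0 cf.
have K0 : 0 < K by lra.
have H1 : c / K < f x by rewrite fx ltr_pdivrMr// ltr_pMr.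
have H2 : f x < K * c by rewrite fx ltr_pMl.
have : nbhs (f x) `]c / K, K * c[%classic.
  by apply: open_nbhs_nbhs; split; [exact: interval_open|rewrite /= in_itv /= H1 H2].
move/cf => H3; apply: (@filterS _ (nbhs x) _ _ _ _ H3) => y.
by rewrite /= in_itv /= => /andP[/ltW -> /ltW ->].
Qed.

(** Both powers tend to 1 with k; the bound 1/2 keeps the shrunken side 1 - 2 k nonnegative. *)
Lemma expr_pad (K : R) : 1 < K -> exists2 k : R, 0 < k <= 2^-1 &
  (1 + 2 * k) ^+ p <= K /\ K^-1 <= (1 - 2 * k) ^+ p.
Proof.
move=> K1; have K0 : 0 < K by lra.
have c1 : ((1 + 2 * k) ^+ p : R) @[k --> (0:R)] --> ((1 + 2 * 0) ^+ p : R).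
  apply: (@cvg_comp _ _ _ (fun k : R => 1 + 2 * k) (fun t => t ^+ p)); last exact: exprn_continuous.
  by apply: cvgD; [exact: cvg_cst|apply: cvgM; [exact: cvg_cst|exact: cvg_id]].
have c2 : ((1 - 2 * k) ^+ p : R) @[k --> (0:R)] --> ((1 - 2 * 0) ^+ p : R).
  apply: (@cvg_comp _ _ _ (fun k : R => 1 - 2 * k) (fun t => t ^+ p)); last exact: exprn_continuous.
  by apply: cvgB; [exact: cvg_cst|apply: cvgM; [exact: cvg_cst|exact: cvg_id]].
rewrite !mulr0 ?addr0 ?subr0 expr1n in c1 c2.
have K2 : K^-1 < 1 by rewrite invf_lt1.
have : nbhs (1 : R) `]K^-1, K[%classic.
  by apply: open_nbhs_nbhs; split; [exact: interval_open|rewrite /= in_itv /= K1 K2].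
move=> /[dup] /c1 + /c2.
move=> /nbhs_ballP[e2 /= e20 H2] /nbhs_ballP[e1 /= e10 H1].
pose k := Num.min 2^-1 (Num.min e1 e2 / 2).
have m0 : 0 < Num.min e1 e2 by rewrite lt_min e10 e20.
have k0 : 0 < k by rewrite lt_min divr_gt0// andbT; lra.
have kh : k <= 2^-1 by rewrite ge_min lexx.
have km : k < Num.min e1 e2 by rewrite (@le_lt_trans _ _ (Num.min e1 e2 / 2)) ?ge_min ?lexx ?orbT//; lra.
move: km; rewrite lt_min => /andP[ke1 ke2].
exists k; first by rewrite k0.
have kb e : k < e -> ball (0 : R) e k by rewrite -ball_normE /ball_ /= sub0r normrN gtr0_norm.
have := H2 k (kb _ ke2); have := H1 k (kb _ ke1); rewrite /= !in_itv /=.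
by move=> /andP[/ltW ? _] /andP[_ /ltW ?].
Qed.

Variable f : 'rV[R]_p -> R.
Hypothesis f0 : forall y, V y -> 0 < f y.
Hypothesis cf : forall y, V y -> f z @[z --> y] --> f y.
Let J (x : 'rV[R]_p) : R := `|\det (T x)|.
Hypothesis cJ : forall x, U x -> J y @[y --> x] --> J x.

Let J0 x : U x -> 0 < J x.
Proof. by move=> Ux; rewrite normr_gt0 -unitfE -unitmxE; exact: uT. Qed.

Let cX x : U x -> X y @[y --> x] --> X x.
Proof. by move=> Ux; apply: lin_approx_cvg (dX Ux). Qed.

Let cY y : V y -> Y z @[z --> y] --> Y y.
Proof. by move=> Vy; have := lin_approx_cvg (dY (YU Vy)); rewrite YK. Qed.

Let cfX x : U x -> f (X y) @[y --> x] --> f (X x).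
Proof. by move=> Ux; apply: cvg_comp (cX Ux) (cf (XV Ux)). Qed.

(** Y is controlled only on V; the extension by 0 is measurable everywhere, so that a measure can be
    pushed forward along it. *)
Let Y' (v : borel R p) : borel R p := if v \in V then Y v else 0.

Let mY' : measurable_fun setT Y'.
Proof.
apply: (@coords_borel _ _ (borel R p) _ Y') => i.
have -> : (fun t => Y' t 0 i) = (fun v => Y v 0 i) \_ V.
  by apply/funext => v; rewrite /patch /Y'; case: ifP; rewrite ?mxE.
apply/(measurable_restrictT _ (open_borel oV)).
apply: open_continuous_borel => // y Vy.
exact: (@cvg_comp _ _ _ Y (fun v : 'rV[R]_p => v 0 i) _ _ _ (cY Vy) (@coord_continuous _ _ _ 0 i _)).
Qed.

Let g1 : borel R p -> \bar R := (EFin \o f) \_ V.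
Let g2 : borel R p -> \bar R := (fun x => (f (X x) * J x)%:E) \_ U.

Let mf : measurable_fun (V : set (borel R p)) (f : borel R p -> R).
Proof. exact: open_continuous_borel. Qed.

Let cfJ x : U x -> f (X y) * J y @[y --> x] --> f (X x) * J x.
Proof. by move=> Ux; exact: (cvgM (cfX Ux) (cJ Ux)). Qed.

Let mfJ : measurable_fun (U : set (borel R p)) ((fun x => f (X x) * J x) : borel R p -> R).
Proof. exact: open_continuous_borel. Qed.

Let mg1 : measurable_fun setT g1.
Proof.
apply/(measurable_restrictT _ (open_borel oV)).
exact/measurable_EFinP.
Qed.

Let mg2 : measurable_fun setT g2.
Proof.
apply/(measurable_restrictT _ (open_borel oU)).
exact/measurable_EFinP.
Qed.

Let g10 x : (0 <= g1 x)%E.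
Proof. by apply: erestrict_ge0 => y Vy; rewrite lee_fin ltW// f0. Qed.

Let g20 x : (0 <= g2 x)%E.
Proof. by apply: erestrict_ge0 => y Uy; rewrite lee_fin ltW// mulr_gt0 ?J0//; exact/f0/XV. Qed.

(** Pushing forward along Y brings the integral over V to the U side, where both measures can be
    tested on the same cubes. *)
Let m1 := push (density (leb R p) mg1 g10) mY'.
Let m2 := density (leb R p) mg2 g20.

Let mYQ (Q : set (borel R p)) : measurable Q -> @measurable _ (borel R p) (V `&` Y @^-1` Q).
Proof.
move=> mQ; have -> : V `&` Y @^-1` Q = V `&` Y' @^-1` Q.
  by apply/seteqP; split => y [Vy]; rewrite /Y' /= mem_set.
apply: measurableI; first exact: open_borel.
by have := mY' measurableT mQ; rewrite setTI.
Qed.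

Let m1E (Q : set (borel R p)) : measurable Q ->
  m1 Q = (\int[leb R p]_(y in V `&` Y @^-1` Q) (f y)%:E)%E.
Proof.
move=> mQ; rewrite /m1 pushE densityE /g1 -integral_mkcondr; congr (integral _ _ _).
by apply/seteqP; split => y; rewrite /Y' /=; [move=> [+ Vy]|move=> [Vy +]; split => //]; rewrite mem_set.
Qed.

Let m2E (Q : set (borel R p)) : Q `<=` U ->
  m2 Q = (\int[leb R p]_(x in Q) (f (X x) * J x)%:E)%E.
Proof.
by move=> QU; rewrite /m2 densityE /g2 -integral_mkcondr; congr (integral _ _ _); exact/setIidPl.
Qed.

(* One factor K each for the volume of the image of the cube, the oscillation of
   f and the oscillation of (f \o X) * J. *)
Let local_bounds (K : R) x : 1 < K -> U x -> \forall n \near \oo, forall z, dcube R n z x ->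
  (m1 (dcube R n z) <= (K ^+ 3)%:E * m2 (dcube R n z))%E /\
  (m2 (dcube R n z) <= (K ^+ 3)%:E * m1 (dcube R n z))%E.
Proof.
move=> K1 Ux; have K0 : 0 < K by lra.
have [k /andP[k0 kh] [kK Kk]] := expr_pad K1.
have fX0 : 0 < f (X x) by apply: f0; exact: XV.
have c0 : 0 < f (X x) * J x by rewrite mulr_gt0// J0.
have N1 := dcube_uniform (near_mul_bound K1 erefl fX0 (cfX Ux)).
have N2 := dcube_uniform (near_mul_bound K1 erefl c0 (cfJ Ux)).
have N3 : \forall n \near \oo, forall z, dcube R n z x -> dcube R n z `<=` U.
  by apply: dcube_near; exact: open_nbhs_nbhs.
have N4 := preimage_upper Ux k0; have N5 := preimage_lower Ux k0.
apply: filterS (filterI (filterI (filterI N1 N2) N3) (filterI N4 N5)) => n [[[{}N1 {}N2] {}N3] [{}N4 {}N5]] z zx.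
move: (N1 z zx) (N2 z zx) (N3 z zx) (N4 z zx) (N5 z zx) => {}N1 {}N2 {}N3 {}N4 {}N5.
pose r := ((2 ^+ n)^-1 : R) ^+ p.
have r0 : 0 < r by rewrite exprn_gt0// invr_gt0 exprn_gt0.
have mQ := @measurable_dcube R p n z.
have [mU' lU] := leb_affine (X x) x (uT Ux) (@measurable_hbox R p (dlow R n z - const_mx (k / 2 ^+ n)) (dlow R n z + const_mx ((2 ^+ n)^-1 + k / 2 ^+ n))).
have [mL' lL] := leb_affine (X x) x (uT Ux) (@measurable_hbox R p (dlow R n z - const_mx (- (k / 2 ^+ n))) (dlow R n z + const_mx ((2 ^+ n)^-1 - k / 2 ^+ n))).
pose m := leb R p (V `&` Y @^-1` (dcube R n z)).
have mle : (m <= (K * J x * r)%:E)%E.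
  apply: (@le_trans _ _ (leb R p [set v | dcube_pad n z (k / 2 ^+ n) ((v - X x) *m invmx (T x) + x)])).
    by apply: le_measure => //; rewrite inE//; exact: mYQ.
  rewrite lU leb_dcube_pad; last lra.
  by rewrite -EFinM lee_fin -/r -/(J x) mulrA ler_pM2r// mulrC ler_pM2r// J0.
have mge : ((J x * r / K)%:E <= m)%E.
  apply: (@le_trans _ _ (leb R p [set v | dcube_pad n z (- (k / 2 ^+ n)) ((v - X x) *m invmx (T x) + x)])); last first.
    by apply: le_measure => //; rewrite inE//; exact: mYQ.
  rewrite lL -mulNr leb_dcube_pad; last lra.
  rewrite -EFinM lee_fin -/r -/(J x) mulrN mulrA mulrAC ler_pM2r// ler_pM2l// ; exact: J0.
have fV v : (V `&` Y @^-1` (dcube R n z)) v -> f (X x) / K <= f v <= K * f (X x).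
  by move=> [Vv zv]; rewrite -[v]YK//; apply: N1; exact: dcube_norm zx zv.
have fQ u : dcube R n z u -> f (X x) * J x / K <= f (X u) * J u <= K * (f (X x) * J x).
  by move=> zu; apply: N2; exact: dcube_norm zx zu.
have a_le : (m1 (dcube R n z) <= (K * f (X x))%:E * (K * J x * r)%:E)%E.
  rewrite m1E//; apply: (@le_trans _ _ ((K * f (X x))%:E * m)%E); last first.
    by apply: lee_wpmul2l => //; rewrite lee_fin mulr_ge0 ?ltW.
  apply: integral_le_cst; first exact: mYQ.
    by apply: measurable_funS mf => //; exact: open_borel.
  by move=> v vV; rewrite ltW/=; [have /andP[] := fV _ vV|case: vV => Vv _; exact: f0].
have a_ge : ((f (X x) / K)%:E * (J x * r / K)%:E <= m1 (dcube R n z))%E.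
  rewrite m1E//; apply: (@le_trans _ _ ((f (X x) / K)%:E * m)%E).
    by apply: lee_wpmul2l => //; rewrite lee_fin divr_ge0 ?ltW.
  apply: integral_ge_cst; first exact: mYQ.
  - by apply: measurable_funS mf => //; exact: open_borel.
  - by rewrite divr_ge0// ltW.
  - by move=> v vV; have /andP[] := fV _ vV.
have b_le : (m2 (dcube R n z) <= (K * (f (X x) * J x))%:E * r%:E)%E.
  rewrite m2E// -(leb_dcube R n z); apply: integral_le_cst => //.
    by apply: measurable_funS mfJ => //; exact: open_borel.
  move=> u zu; have /andP[_ ->] := fQ _ zu; rewrite andbT ltW// mulr_gt0 ?J0//; [apply/f0/XV|]; exact: N3.
have b_ge : ((f (X x) * J x / K)%:E * r%:E <= m2 (dcube R n z))%E.
  rewrite m2E// -(leb_dcube R n z); apply: integral_ge_cst => //.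
  - by apply: measurable_funS mfJ => //; exact: open_borel.
  - by rewrite divr_ge0// ltW.
  - by move=> u zu; have /andP[] := fQ _ zu.
have K3 : (0 <= (K ^+ 3)%:E)%E by rewrite lee_fin exprn_ge0// ltW.
split.
  apply: (le_trans a_le); apply: le_trans (lee_pmul K3 _ (lexx _) b_ge); last first.
    by rewrite -EFinM lee_fin mulr_ge0// ?ltW// divr_gt0.
  by rewrite -!EFinM lee_fin le_eqVlt; apply/orP; left; apply/eqP; field; rewrite gt_eqF.
apply: (le_trans b_le); apply: le_trans (lee_pmul K3 _ (lexx _) a_ge); last first.
  by rewrite -EFinM lee_fin !mulr_ge0// ?invr_ge0 ?ltW// J0.
by rewrite -!EFinM lee_fin le_eqVlt; apply/orP; left; apply/eqP; field; rewrite gt_eqF.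
Qed.

Lemma change_of_variables_pos :
  (\int[leb R p]_(y in V) (f y)%:E = \int[leb R p]_(x in U) (f (X x) * J x)%:E)%E.
Proof.
have mU : @measurable _ (borel R p) U by exact: open_borel.
have -> : (\int[leb R p]_(y in V) (f y)%:E)%E = m1 U.
  rewrite m1E//; congr (integral _ _ _); apply/seteqP; split => y //=; last by case.
  by move=> Vy; split => //; exact: YU.
rewrite -m2E//.
have lim_le (a b : \bar R) : (0 <= b)%E ->
    (forall K : R, 1 < K -> (a <= (K ^+ 3)%:E * b)%E) -> (a <= b)%E.
  move=> b0 H; apply/lee_addgt0Pr => e e0.
  have [->|boo] := eqVneq b +oo%E; first by rewrite addye// leey.
  have b1 : b \is a fin_num by rewrite ge0_fin_numE// lt_neqAle boo leey.
  move: b0 H; rewrite -(fineK b1); move: (fine b) => r; rewrite lee_fin => r0 H.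
  (* For t at most 1, (1 + t)^3 <= 1 + 7 t because 3 + 3 + 1 = 7. The excess 7 t r is then at most
     e, and r + 1 avoids a division by zero. *)
  pose t := Num.min 1 (e / (7 * (r + 1))).
  have t0 : 0 < t by rewrite lt_min ltr01 divr_gt0//; lra.
  have t1 : t <= 1 by rewrite ge_min lexx.
  have te : t * (7 * (r + 1)) <= e by rewrite -ler_pdivlMr ?ge_min ?lexx ?orbT//; lra.
  have K1 : 1 < 1 + t by lra.
  apply: le_trans (H _ K1) _; rewrite -EFinM -EFinD lee_fin.
  have t3 : (1 + t) ^+ 3 <= 1 + 7 * t by nra.
  have := ler_wpM2r r0 t3; nra.
by apply/eqP; rewrite eq_le; apply/andP; split; apply: lim_le => // K K1;
  apply: dyadic_comparison => //; rewrite ?exprn_ge0//; try lra;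
  move=> x Ux; have := local_bounds K1 Ux; apply: filterS => n H z /H[].
Qed.
End CoV.

(* Adding a constant to f makes it positive; this is why V has finite measure. *)
Theorem change_of_variables (R : realType) (p : nat) (U V : set 'rV[R]_p)
    (X Y : 'rV[R]_p -> 'rV[R]_p) (T : 'rV[R]_p -> 'M[R]_p) (f : 'rV[R]_p -> R) (C : R) :
  open U -> open V ->
  (forall x, U x -> V (X x)) -> (forall y, V y -> U (Y y)) ->
  (forall x, U x -> Y (X x) = x) -> (forall y, V y -> X (Y y) = y) ->
  (forall x, U x -> T x \in unitmx) ->
  (forall x, U x -> lin_approx X x (T x)) ->
  (forall x, U x -> lin_approx Y (X x) (invmx (T x))) ->
  (forall x, U x -> `|\det (T y)| @[y --> x] --> `|\det (T x)|) ->
  (forall y, V y -> f z @[z --> y] --> f y) ->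
  (leb R p V < +oo)%E -> (forall y, V y -> `|f y| <= C) ->
  (\int[leb R p]_(y in V) (f y)%:E = \int[leb R p]_(x in U) (f (X x) * `|\det (T x)|)%:E)%E.
Proof.
move=> oU oV XV YU XK YK uT dX dY cJ cf Voo fC.
pose K : R := `|C| + 1.
have K0 : 0 < K by rewrite ltr_wpDl.
have mV : @measurable _ (borel R p) V by exact: open_borel.
have mU : @measurable _ (borel R p) U by exact: open_borel.
have fK0 y : V y -> 0 < f y + K.
  by move=> /fC; have := ler_norm C; have := ler_norm (- f y); rewrite normrN /K; lra.
have cfK y : V y -> f z + K @[z --> y] --> f y + K.
  by move=> Vy; exact: (cvgD (cf _ Vy) (cvg_cst _)).
have cov1 := change_of_variables_pos oU oV XV YU XK YK uT dX dY fK0 cfK cJ.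
have cK (y : 'rV[R]_p) : V y -> K @[z --> y] --> K.
  by move=> _; exact: (@cvg_cst _ K _ (nbhs y) _).
have cov2 := @change_of_variables_pos _ _ _ _ _ _ _ oU oV XV YU XK YK uT dX dY (fun=> K) (fun _ _ => K0) cK cJ.
have cJ' x : U x -> (fun y => `|\det (T y)|) y @[y --> x] --> `|\det (T x)| := cJ x.
have mfV : measurable_fun (V : set (borel R p)) (f : borel R p -> R).
  exact: open_continuous_borel.
have iV (g : 'rV[R]_p -> R) : measurable_fun (V : set (borel R p)) (g : borel R p -> R) ->
   (forall y, V y -> `|g y| <= 2 * K) -> (leb R p).-integrable V (EFin \o g).
  move=> mg gb; apply: measurable_bounded_integrable => //.
  exists (2 * K); split; first exact: num_real.
  by move=> M KM y Vy /=; apply: le_trans (gb _ Vy) (ltW KM).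
have fb y : V y -> `|f y| <= K.
  by move=> Vy; apply: le_trans (fC _ Vy) _; rewrite /K; have := ler_norm C; lra.
have i1 : (leb R p).-integrable V (EFin \o (fun y => f y + K)).
  apply: iV => [|y Vy]; first by apply: measurable_funD => //; exact: measurable_cst.
  by rewrite (le_trans (ler_normD _ _))// (gtr0_norm K0); have := fb _ Vy; lra.
have i2 : (leb R p).-integrable V (EFin \o (fun y => K)).
  by apply: iV => [|y Vy]; [exact: measurable_cst|rewrite gtr0_norm//; lra].
have cX x : U x -> X y @[y --> x] --> X x by move=> Ux; apply: lin_approx_cvg (dX _ Ux).
(* The determinant is not assumed bounded on U, so integrability there is transported from V by the
   positive case. *)
have iU (g : 'rV[R]_p -> R) : (forall y, V y -> 0 < g y) -> (forall y, V y -> g z @[z --> y] --> g y) ->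
    (leb R p).-integrable V (EFin \o g) ->
    (leb R p).-integrable U (EFin \o (fun x => g (X x) * `|\det (T x)|)).
  move=> g0 cg /integrableP[_ ig]; apply/integrableP; split.
    apply/measurable_EFinP; apply: open_continuous_borel => // x Ux.
    apply: cvgM (cJ x Ux); exact: cvg_comp (cX _ Ux) (cg _ (XV _ Ux)).
  have -> : (\int[leb R p]_(x in U) `|(EFin \o (fun x => (g (X x) * `|\det (T x)|)%R)) x| =
     \int[leb R p]_(x in U) (g (X x) * `|\det (T x)|)%:E)%E.
    apply: eq_integral => x /[!inE] Ux /=; rewrite ger0_norm// mulr_ge0//; exact/ltW/g0/XV.
  rewrite -(change_of_variables_pos oU oV XV YU XK YK uT dX dY g0 cg cJ).
  congr (_ < _)%E : ig; apply: eq_integral => y /[!inE] Vy /=; rewrite ger0_norm//; exact/ltW/g0.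
transitivity (\int[leb R p]_(y in V) ((f y + K)%:E - K%:E))%E.
  by apply: eq_integral => y _; rewrite -EFinB addrK.
rewrite (integralB_EFin (open_borel oV) i1 i2) cov1 cov2.
rewrite -(integralB_EFin (open_borel oU) (iU _ fK0 cfK i1) (iU _ (fun _ _ => K0) cK i2)).
by apply: eq_integral => x _; rewrite -EFinB mulrDl addrK.
Qed.

(** * Surface measure *)

Section caratheodory_sublevel.
Context (R : realType) (T : Type) (H : {outer_measure set T -> \bar R}) (f : T -> R).
(** The metric property, for separation measured along f only; a metric outer measure has it when f
    is Lipschitz, as the coordinates are. *)
Hypothesis H_sep : forall A B (e : R), 0 < e ->
  (forall a b, A a -> B b -> f a + e <= f b) -> (H A + H B <= H (A `|` B))%E.

Section layers.
Variables (X : set T) (c : R).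
Hypothesis Xoo : (H X < +oo)%E.

(** Shells accumulating at the level c: 1/(n+1) < c - f <= 1/n, without upper bound for n = 0. In
    reciprocal form the index of the shell is a truncation. *)
Let layer (n : nat) : set T :=
  [set x | [/\ X x, f x < c & n%:R <= (c - f x)^-1 < n.+1%:R]].

Let layer_lt n x : layer n x -> (n.+1%:R)^-1 < c - f x.
Proof.
by move=> [_ fc /andP[_ h]]; rewrite -[ltRHS]invrK ltf_pV2// posrE ?invr_gt0 ?ltr0n// subr_gt0.
Qed.

Let layer_ge n x : layer n.+1 x -> c - f x <= (n.+1%:R)^-1.
Proof.
by move=> [_ fc /andP[h _]]; rewrite -[leLHS]invrK lef_pV2// posrE ?invr_gt0 ?ltr0n// subr_gt0.
Qed.

Let layer_bigcup : X `&` [set x | f x < c] = \bigcup_n layer n.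
Proof.
apply/seteqP; split => [x [Xx /= fc]|x [n _ [Xx fc _]]//].
exists (Num.truncn (c - f x)^-1) => //; split => //.
by apply: Num.Theory.truncn_itv; rewrite invr_ge0 subr_ge0 ltW.
Qed.

Let layer_sub n : layer n `<=` X.
Proof. by move=> x []. Qed.

Let sep (n : nat) A B : (forall a, A a -> (n.+1%:R)^-1 < c - f a) ->
  (forall b, B b -> c - f b <= (n.+2%:R)^-1) -> (H A + H B <= H (A `|` B))%E.
Proof.
move=> hA hB; apply: (@H_sep _ _ ((n.+1%:R)^-1 - (n.+2%:R)^-1)).
  by rewrite subr_gt0 ltf_pV2 ?posrE ?ltr0n// ltr_nat.
have h (x y u w : R) : x < c - u -> c - w <= y -> u + (x - y) <= w by lra.
by move=> a b /hA ha /hB hb; exact: h ha hb.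
Qed.

(** Here q is the parity. A whole shell lies between two shells of equal parity, so each new one is
    separated from the union of the earlier ones. *)
Let sum_layers (q N : nat) : (\sum_(k < N) H (layer (k.*2 + q)) <= H X)%E.
Proof.
suff : (\sum_(k < N) H (layer (k.*2 + q)) <=
    H (\big[setU/set0]_(k < N) layer (k.*2 + q)))%E.
  move=> /le_trans; apply; apply: le_outer_measure.
  by rewrite -(bigcup_mkord N (fun k => layer (k.*2 + q))); apply: bigcup_sub => k _; exact: layer_sub.
elim: N => [|N IH]; first by rewrite !big_ord0 outer_measure0.
rewrite !big_ord_recr /=; apply: le_trans (leeD2r _ IH) _.
case: N {IH} => [|N]; first by rewrite !big_ord0 outer_measure0 add0e set0U.
apply: (@sep (N.*2 + q)%N) => [a|b].
  rewrite -(bigcup_mkord _ (fun k => layer (k.*2 + q))) => -[k /= kN /layer_lt]; apply: le_lt_trans.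
  rewrite lef_pV2 ?posrE ?ltr0n// ler_nat ltnS leq_add2r leq_double; exact: kN.
by rewrite doubleS !addSn => /layer_ge.
Qed.

(** Isolates the shells close to the level c; by parity they fall into two tails, each of small
    total measure for large N. *)
Let evenodd N : (\bigcup_n layer n `<=` [set x | X x /\ (N.*2.+1%:R)^-1 < c - f x] `|`
   (\bigcup_(k in ~` `I_N) layer (k.*2 + 0) `|` \bigcup_(k in ~` `I_N) layer (k.*2 + 1)))%classic.
Proof.
move=> x [n _ nx].
have [nN|Nn] := leqP n N.*2.
  left; split; first exact: layer_sub nx.
  apply: le_lt_trans (layer_lt nx).
  by rewrite lef_pV2 ?posrE ?ltr0n// ler_nat ltnS.
right; have nh : ~ (n./2 < N)%N.
  by apply/negP; rewrite -leqNgt -[N]doubleK half_leq// ltnW.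
case on : (odd n); [right|left]; exists n./2 => //.
  by move: nx; rewrite -{1}[n]odd_double_half on addnC.
by move: (odd_double_half n); rewrite on add0n addn0 => ->.
Qed.

(* Layers of the same parity are at positive distance from each other, so [H] is
   additive on them and the tails of their measures tend to 0. *)
Lemma caratheodory_layers :
  (H (X `&` [set x | (f x < c)%R]) + H (X `&` ~` [set x | (f x < c)%R]) <= H X)%E.
Proof.
have h0 q k : (0 <= H (layer (k.*2 + q)))%E by exact: outer_measure_ge0.
have tail q : (\sum_(N <= k <oo) H (layer (k.*2 + q)))%E @[N --> \oo] --> 0%E.
  apply: (@nneseries_tail_cvg _ (fun k => H (layer (k.*2 + q))) xpredT) => //.
  apply: le_lt_trans Xoo; apply: lime_le; first exact: is_cvg_nneseries.
  by apply: nearW => N; rewrite big_mkord; exact: sum_layers.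
apply/lee_addgt0Pr => e e0.
have small q : \forall N \near \oo, (\sum_(N <= k <oo) H (layer (k.*2 + q)) < (e / 2)%:E)%E.
  have : nbhs 0%E [set x : \bar R | (x < (e / 2)%:E)%E].
    apply: open_nbhs_nbhs; split; first exact: open_ereal_lt_ereal.
    by rewrite /= lte_fin divr_gt0.
  by move/(tail q).
have [N _ /(_ N (leqnn N))[s0 s1]] := filterI (small 0%N) (small 1%N).
(* The points with c - f above 1/(2N+1) are separated from the complement of the sublevel set, so
   [H_sep] applies to them; in [B2] the remaining shells cost at most e. *)
have B1 : (H [set x | X x /\ ((N.*2.+1%:R)^-1 < c - f x)%R] + H (X `&` ~` [set x | (f x < c)%R]) <= H X)%E.
  set S1 := [set x | X x /\ _]; set S2 := X `&` _.
  apply: (@le_trans _ _ (H (S1 `|` S2))).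
    apply: (@sep (N.*2)) => [a []//|b [_ /= /negP]]; rewrite -leNgt => h.
    by apply: (@le_trans _ _ 0); [rewrite subr_le0|rewrite invr_ge0].
  by apply: le_outer_measure => x [[]|[]].
have B2 : (H (X `&` [set x | (f x < c)%R]) <= H [set x | X x /\ ((N.*2.+1%:R)^-1 < c - f x)%R] + e%:E)%E.
  rewrite layer_bigcup; apply: le_trans (le_outer_measure H _ _ (@evenodd N)) _.
  apply: le_trans (outer_measureU2 _ _ _) _; apply: leeD2l.
  apply: le_trans (outer_measureU2 _ _ _) _.
  rewrite [e in leRHS]splitr EFinD; apply: leeD.
    by apply: le_trans (ltW s0); exact: outer_measure_sigma_subadditive_tail.
  by apply: le_trans (ltW s1); exact: outer_measure_sigma_subadditive_tail.
apply: le_trans (leeD2r _ B2) _; rewrite addeAC; exact: leeD2r.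
Qed.
End layers.

Lemma caratheodory_sublevel c : H.-caratheodory [set x | f x < c].
Proof.
apply: le_caratheodory_measurable => X.
have [Xoo|] := ltP (H X) +oo%E; first exact: caratheodory_layers.
by rewrite leye_eq => /eqP ->; rewrite leey.
Qed.

End caratheodory_sublevel.

(** * Hausdorff measure on the Borel sets *)

Lemma eucl_norm_ge0 (R : realType) p (v : 'rV[R]_p) : 0 <= eucl_norm v.
Proof. exact: sqrtr_ge0. Qed.

Lemma coord_le_eucl (R : realType) p (v : 'rV[R]_p) i : `|v 0 i| <= eucl_norm v.
Proof.
rewrite -sqrtr_sqr ler_sqrt; last by apply: sumr_ge0 => j _; exact: sqr_ge0.
by rewrite (bigD1 i)//= lerDl; apply: sumr_ge0 => j _; exact: sqr_ge0.
Qed.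

Section hausdorff.
Context (R : realType) (p m : nat).
Local Open Scope ereal_scope.

Lemma diam_ge (A : set 'rV[R]_p) a b : A a -> A b -> (eucl_norm (a - b))%:E <= diam A.
Proof. by move=> Aa Ab; apply: ereal_sup_ubound; exists (a, b). Qed.

Lemma diam_pow_ge0 (A : set 'rV[R]_p) : 0 <= diam_pow m A.
Proof.
rewrite /diam_pow; case: ifPn => // /set0P[a Aa]; apply: expe_ge0.
by apply: le_trans (diam_ge Aa Aa); rewrite lee_fin eucl_norm_ge0.
Qed.

Lemma diam_pow0 : diam_pow m (set0 : set 'rV[R]_p) = 0.
Proof. by rewrite /diam_pow eqxx. Qed.

(** As a supremum over no pairs; hence the empty set passes every bound on diameters and can pad a
    cover. *)
Lemma diam0 : diam (set0 : set 'rV[R]_p) = -oo.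
Proof.
rewrite /diam (_ : [set _ | _ in _] = set0) ?ereal_sup0//.
by apply/seteqP; split => // x [[? ?] []].
Qed.

(** A type on which every set is measurable, so that [mu_ext] ranges over covers by arbitrary
    sets. *)
Let allsets := g_sigma_algebraType [set: set 'rV[R]_p].

(** The infinite cost encodes the constraint on diameters, which turns the content into an outer
    measure of the form [mu_ext]. *)
Let pre (delta : R) (C : set allsets) : \bar R :=
  if diam C <= delta%:E then diam_pow m C else +oo.

Let pre0 delta : pre delta set0 = 0.
Proof. by rewrite /pre diam0 leNye diam_pow0. Qed.

Let pre_ge0 delta C : 0 <= pre delta C.
Proof. by rewrite /pre; case: ifP => // _; exact: diam_pow_ge0. Qed.

Let contentE delta : hausdorff_content m delta = mu_ext (pre delta).
Proof.
apply/funext => A; apply/eqP; rewrite eq_le; apply/andP; split.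
  apply: le_ereal_inf_tmp => _ [C [_ AC] <-].
  have [Cd|] := pselect (forall k, diam (C k) <= delta%:E).
    apply: ereal_inf_lbound; exists C; first by split.
    by apply: eq_eseriesr => k _; rewrite /pre Cd.
  move=> /existsNP[k /negP Cd].
  rewrite [leRHS](eseries_pinfty _ _ (k := k)) ?leey// /pre ?(negbTE Cd)// => n _.
  by rewrite -ltNye (lt_le_trans _ (pre_ge0 _ _)).
apply: le_ereal_inf_tmp => _ [C [AC Cd] <-].
apply: ereal_inf_lbound; exists C.
  by split => // k; apply: sub_sigma_algebra.
by apply: eq_eseriesr => k _; rewrite /pre Cd.
Qed.

Definition hausdorff_raw (A : set 'rV[R]_p) : \bar R :=
  ereal_sup [set hausdorff_content m delta A | delta in [set d : R | (0 < d)%R]].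

Let content_ge0 delta A : 0 <= hausdorff_content m delta (A : set 'rV[R]_p).
Proof. by rewrite contentE; exact: mu_ext_ge0. Qed.

Let raw_ge (delta : R) A : (0 < delta)%R -> hausdorff_content m delta A <= hausdorff_raw A.
Proof. by move=> d0; apply: ereal_sup_ubound; exists delta. Qed.

Let raw_ge0 A : 0 <= hausdorff_raw A.
Proof. exact: le_trans (content_ge0 1 A) (raw_ge A ltr01). Qed.

Let raw0 : hausdorff_raw set0 = 0.
Proof.
apply/eqP; rewrite eq_le raw_ge0 andbT; apply: ge_ereal_sup => _ [d _ <-].
by rewrite contentE mu_ext0.
Qed.

Let le_raw : {homo hausdorff_raw : A B / A `<=` B >-> A <= B}.
Proof.
move=> A B AB; apply: ge_ereal_sup => _ [d d0 <-]; apply: le_trans (raw_ge B d0).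
by rewrite contentE; exact: le_mu_ext.
Qed.

Let raw_sigma_subadditive : sigma_subadditive hausdorff_raw.
Proof.
move=> F; apply: ge_ereal_sup => _ [d d0 <-].
rewrite contentE; apply: le_trans (mu_ext_sigma_subadditive _ _) _ => //.
by apply: lee_nneseries => [k _ _|k _]; rewrite -contentE; [exact: content_ge0|exact: raw_ge].
Qed.

HB.instance Definition _ := isOuterMeasure.Build R 'rV[R]_p hausdorff_raw
  raw0 raw_ge0 le_raw raw_sigma_subadditive.

Lemma content_decr (d d' : R) (A : set 'rV[R]_p) : (d <= d')%R ->
  hausdorff_content m d' A <= hausdorff_content m d A.
Proof.
move=> dd; apply: ereal_inf_le_tmp => _ [C [AC Cd] <-]; exists C => //; split => // k.
by apply: le_trans (Cd k) _; rewrite lee_fin.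
Qed.

(** A set of diameter less than e cannot meet both A and B, so a fine cover of the union splits into
    a cover of A and one of B without sharing any member. *)
Lemma hausdorff_metric (A B : set 'rV[R]_p) (e : R) : (0 < e)%R ->
  (forall a b, A a -> B b -> (e <= eucl_norm (a - b))%R) ->
  hausdorff_raw A + hausdorff_raw B <= hausdorff_raw (A `|` B).
Proof.
move=> e0 sepAB.
have content_add (d : R) : (0 < d < e)%R ->
    hausdorff_content m d A + hausdorff_content m d B <= hausdorff_content m d (A `|` B).
  move=> /andP[d0 de]; apply: le_ereal_inf_tmp => _ [C [ABC Cd] <-].
  pose CA k := if `[< C k `&` A !=set0 >] then C k else set0.
  pose CB k := if `[< C k `&` B !=set0 >] then C k else set0.
  have sub0 (P : bool) k : diam (if P then C k else set0) <= d%:E.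
    by case: P; [exact: Cd|rewrite diam0 leNye].
  apply: (@le_trans _ _ (\sum_(0 <= k <oo) diam_pow m (CA k) + \sum_(0 <= k <oo) diam_pow m (CB k))).
    apply: leeD; apply: ereal_inf_lbound.
      exists CA => //; split => [a Aa|k]; last exact: sub0.
      have [k _ Cka] : (\bigcup_k C k) a by apply: ABC; left.
      by exists k => //; rewrite /CA asboolT//; exists a.
    exists CB => //; split => [b Bb|k]; last exact: sub0.
    have [k _ Ckb] : (\bigcup_k C k) b by apply: ABC; right.
    by exists k => //; rewrite /CB asboolT//; exists b.
  rewrite -nneseriesD//; [|by move=> *; exact: diam_pow_ge0..].
  apply: lee_nneseries => [k _ _|k _]; first by apply: adde_ge0; exact: diam_pow_ge0.
  rewrite /CA /CB; case: asboolP => [[a [Ca Aa]]|_]; case: asboolP => [[b [Cb Bb]]|_];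
    rewrite ?diam_pow0 ?adde0 ?add0e ?diam_pow_ge0//.
  have := le_trans (diam_ge Ca Cb) (Cd k); rewrite lee_fin => h.
  by have := le_lt_trans (le_trans (sepAB _ _ Aa Bb) h) de; rewrite ltxx.
(* Two independent scales, both dominated by a common finer one, so that the two suprema can be
   taken one after the other. *)
have H1 (d d' : R) : (0 < d)%R -> (0 < d')%R ->
    hausdorff_content m d A + hausdorff_content m d' B <= hausdorff_raw (A `|` B).
  move=> d0 d'0; pose t := (Num.min (e / 2) (Num.min d d'))%R.
  have t0 : (0 < t)%R by rewrite !lt_min d0 d'0 divr_gt0.
  have te : (t < e)%R by apply: (@le_lt_trans _ _ (e / 2)%R); [rewrite ge_min lexx|lra].
  apply: le_trans (raw_ge _ t0); apply: le_trans (content_add t _); last by rewrite t0 te.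
  by apply: leeD; apply: content_decr; rewrite !ge_min lexx ?orbT.
(* The supremum is taken after moving x to the other side, which requires x to be finite; an
   infinite z is trivial. *)
have Hf (x y z : \bar R) : 0 <= z -> (forall d : R, (0 < d)%R -> x + hausdorff_content m d B <= z) -> 0 <= x ->
   x + hausdorff_raw B <= z.
  move=> z0 h x0; case: z z0 h => [z| |] // z0 h; last by rewrite leey.
  have xf : x \is a fin_num.
    rewrite ge0_fin_numE//; apply: le_lt_trans (ltry z); apply: le_trans (h 1%R ltr01).
    by rewrite leeDl.
  rewrite addeC -leeBrDr//; apply: ge_ereal_sup => _ [d d0 <-].
  by rewrite leeBrDr// addeC; exact: h.
apply: (Hf _ 0) => // d d0; rewrite addeC.
have Hf' (x y z : \bar R) : 0 <= z -> (forall d : R, (0 < d)%R -> x + hausdorff_content m d A <= z) -> 0 <= x ->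
   x + hausdorff_raw A <= z.
  move=> z0 h x0; case: z z0 h => [z| |] // z0 h; last by rewrite leey.
  have xf : x \is a fin_num.
    rewrite ge0_fin_numE//; apply: le_lt_trans (ltry z); apply: le_trans (h 1%R ltr01).
    by rewrite leeDl.
  rewrite addeC -leeBrDr//; apply: ge_ereal_sup => _ [d1 d10 <-].
  by rewrite leeBrDr// addeC; exact: h.
by apply: (Hf' _ 0) => // d1 d10; rewrite addeC; exact: H1.
Qed.

(** A box is a finite intersection of differences of sublevel sets of coordinates, and a gap in a
    coordinate is a gap in the Euclidean distance. *)
Lemma caratheodory_borel (A : set (borel R p)) : measurable A ->
  (hausdorff_raw : set 'rV[R]_p -> \bar R).-caratheodory A.
Proof.
rewrite borel_gen_hbox => mA; apply: mA.
split.
  split.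
  - exact: caratheodory_measurable_set0.
  - by move=> B cB; rewrite setTD; exact: caratheodory_measurable_setC.
  - by move=> F cF; exact: caratheodory_measurable_bigcup.
have sl i c : (hausdorff_raw : set 'rV[R]_p -> \bar R).-caratheodory [set v : 'rV[R]_p | (v 0 i < c)%R].
  refine (@caratheodory_sublevel R 'rV[R]_p hausdorff_raw (fun v : 'rV[R]_p => v 0%R i) _ c) => B C e e0 BC.
  apply: (hausdorff_metric e0) => b c' Bb Cc.
  apply: le_trans (coord_le_eucl _ i); rewrite !mxE distrC.
  by apply: le_trans (ler_norm _); have := BC _ _ Bb Cc; lra.
move=> _ [a [b ->]].
have -> : hbox a b = \bigcap_(i in [set: 'I_p]) ([set v : 'rV[R]_p | (v 0 i < b 0 i)%R] `\` [set v : 'rV[R]_p | (v 0 i < a 0 i)%R]).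
  apply/seteqP; split => [v h i _|v h i].
    by have /andP[h1 h2] := h i; split => //=; apply/negP; rewrite -leNgt.
  by have [/= h1 /negP] := h i I; rewrite -leNgt h1 => ->.
apply: (@fin_bigcap_measurable _ (caratheodory_type hausdorff_raw)) => // i _.
by apply: caratheodory_measurable_setD; exact: sl.
Qed.

Let raw_sigma_additive :
  semi_sigma_additive (hausdorff_raw : set (borel R p) -> \bar R).
Proof.
move=> F mF tF mUF.
apply: (@caratheodory_measure_sigma_additive _ _ hausdorff_raw) => //.
  by move=> i; exact: caratheodory_borel.
exact: caratheodory_borel.
Qed.

Definition hausdorff_borel : set (borel R p) -> \bar R := hausdorff_raw.

HB.instance Definition _ := isMeasure.Build _ (borel R p) R hausdorff_borel
  raw0 raw_ge0 raw_sigma_additive.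

End hausdorff.

(** Finiteness turns the normalization constant of [hausdorff] into a real factor by which a measure
    can be scaled. *)
Lemma leb_ball_fin (R : realType) m :
  leb R m [set v : 'rV[R]_m | eucl_norm v <= 1] \is a fin_num.
Proof.
have mB : @measurable _ (borel R m) [set v : 'rV[R]_m | eucl_norm v <= 1].
  have -> : [set v : 'rV[R]_m | eucl_norm v <= 1] =
      setT `&` (fun v : 'rV[R]_m => \sum_i v 0 i ^+ 2) @^-1` `]-oo, 1]%classic.
    have E (v : 'rV[R]_m) : (eucl_norm v <= 1) = (\sum_i v 0 i ^+ 2 <= 1).
      transitivity (Num.sqrt (\sum_i v 0 i ^+ 2) <= Num.sqrt 1); first by rewrite sqrtr1.
      by rewrite ler_sqrt.
    by rewrite setTI; apply/seteqP; split => v; rewrite /= in_itv /= E.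
  have : measurable_fun setT (fun v : borel R m => \sum_i (v : 'rV[R]_m) 0 i ^+ 2).
    by apply: measurable_sum => i; apply: measurable_funX; exact: coord_borel.
  by apply => //; exact: measurable_itv.
rewrite ge0_fin_numE ?measure_ge0//.
apply: (@le_lt_trans _ _ (leb R m (hbox (const_mx (-1)) (const_mx 2)))).
  apply: le_measure; rewrite ?inE//; first exact: measurable_hbox.
  move=> v /= v1 i; rewrite !mxE; have := le_trans (coord_le_eucl v i) v1.
  by rewrite ler_norml => /andP[? ?]; apply/andP; split; lra.
by rewrite leb_hbox ltry.
Qed.

Lemma surface_measureP (R : realType) p :
  exists mu : {measure set (borel R p) -> \bar R}, (mu : set _ -> _) = @surface R p.
Proof.
have c0 : 0 <= fine (leb R p.-1 [set v | eucl_norm v <= 1]) * 2^-1 ^+ p.-1.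
  by rewrite mulr_ge0 ?fine_ge0 ?measure_ge0// exprn_ge0.
exists (mscale (NngNum c0) (@hausdorff_borel R p p.-1)).
apply/funext => A; rewrite /= /mscale /surface /hausdorff /= EFinM fineK//.
exact: leb_ball_fin.
Qed.

(** Valid for arbitrary sets: the exceptional set of the normal is not known to be Borel. *)
Lemma le_surface (R : realType) p (A B : set 'rV[R]_p) : A `<=` B ->
  (surface A <= surface B)%E.
Proof.
move=> AB; apply: lee_wpmul2l; last exact: (le_outer_measure (@hausdorff_raw R p p.-1)).
by rewrite mule_ge0 ?measure_ge0 ?lebesgue_ge0// lee_fin exprn_ge0.
Qed.

(** * First-order expansions *)

Lemma is_derive_line (R : realType) (V : normedModType R) (f : V -> R) (w v : V) (s df : R) :
  is_derive (w + s *: v) v f df -> is_derive s 1 (fun r : R => f (w + r *: v)) df.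
Proof.
move=> [ex val].
have E : (fun h : R => h^-1 *: ((f \o shift (w + s *: v)) (h *: v) - f (w + s *: v))) =
    (fun h : R => h^-1 *: (((fun r : R => f (w + r *: v)) \o shift s) (h *: 1) - f (w + s *: v))).
  apply/funext => h; congr (_ *: (f _ - _)) => /=.
  by rewrite [h *: 1]mulr1 scalerDl addrCA.
by split; [move: ex; rewrite /derivable E|rewrite -val /derive E].
Qed.

(** Mean value theorem: the increment is the derivative at an intermediate point times b - a, and
    that derivative is within e of c. *)
Lemma increment_le (R : realType) (h dh : R -> R) (a b c e : R) :
  (forall s, Num.min a b <= s <= Num.max a b -> is_derive s 1 h (dh s) /\ `|dh s - c| <= e) ->
  `|h b - h a - c * (b - a)| <= e * `|b - a|.
Proof.
wlog ab : a b / a <= b => [W|].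
  have [ab|ba] := orP (le_total a b); first exact: (W a b ab).
  move=> H; have := W b a ba; rewrite minC maxC => /(_ H).
  rewrite [`|a - b|]distrC; congr (_ <= _); rewrite -normrN; congr `|_|; ring.
rewrite (min_l ab) (max_r ab) => H.
have [||z] := @MVT_segment _ h dh _ _ ab.
- by move=> x; rewrite in_itv /= => /andP[/ltW ? /ltW ?]; apply: (H _ _).1; apply/andP.
- apply: derivable_within_continuous => x; rewrite in_itv /= => xab.
  by have [[]] := H _ xab.
rewrite in_itv /= => /H[_ hz] ->.
by rewrite -mulrBl normrM ler_wpM2r.
Qed.

Definition lin_approx1 (R : realType) p (f : 'rV[R]_p -> R) (y : 'rV[R]_p) (a : 'I_p -> R) :=
  forall e : R, 0 < e ->
  \forall z \near y, `|f z - f y - \sum_i a i * (z 0 i - y 0 i)| <= e * `|z - y|.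

(** Vertices of the path from y to z that changes one coordinate at a time. *)
Definition splice (R : realType) p (y z : 'rV[R]_p) (k : nat) : 'rV[R]_p :=
  \row_i (if (i < k)%N then z 0 i else y 0 i).

Lemma splice_step (R : realType) p (y z : 'rV[R]_p) (k : 'I_p) :
  splice y z k.+1 = splice y z k + (z 0 k - y 0 k) *: space_dir R k.
Proof.
apply/rowP => i; rewrite !mxE eqxx /= ltnS leq_eqVlt.
have [->|ik] := eqVneq i k; first by rewrite eqxx /= ltnn mulr1 addrC subrK.
by rewrite val_eqE (negbTE ik) /= mulr0 addr0.
Qed.

Lemma near_forall_fin (R : realType) p (I : finType) (P : I -> 'rV[R]_p -> Prop) (y : 'rV[R]_p) :
  (forall i, \forall z \near y, P i z) -> \forall z \near y, forall i, P i z.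
Proof. by move=> H; apply: (@filter_forall _ _ _ (nbhs y) (nbhs_filter y)). Qed.

Lemma splice_ball (R : realType) p (y z : 'rV[R]_p) (k : 'I_p) (r s : R) : `|z - y| < r ->
  Num.min 0 (z 0 k - y 0 k) <= s <= Num.max 0 (z 0 k - y 0 k) ->
  `|splice y z k + s *: space_dir R k - y| < r.
Proof.
move=> zr hs; apply: le_lt_trans zr.
rewrite [leLHS]/Num.norm /= mx_normrE; apply/bigmax_leP; split => // -[i j] _ /=.
rewrite (ord1 i) {i}; apply: le_trans (coord_le_norm (z - y) j).
rewrite !mxE eqxx /=; have [->|jk] := eqVneq j k; last first.
  by rewrite mulr0 addr0; case: ifP => // _; rewrite subrr normr0.
rewrite ltnn mulr1 addrAC subrr add0r.
have [h|/ltW h] := leP 0 (z 0 k - y 0 k).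
  by move: hs; rewrite (min_l h) (max_r h) => /andP[s0 sz]; rewrite !ger0_norm.
by move: hs; rewrite (min_r h) (max_l h) => /andP[s0 sz]; rewrite !ler0_norm// lerN2.
Qed.

(** The increment telescopes along the path of [splice]; each edge is parallel to an axis, so
    [increment_le] applies to the corresponding partial derivative. *)
Lemma lin_approx_partials (R : realType) p (S : set 'rV[R]_p) (f : 'rV[R]_p -> R)
    (g : 'I_p -> 'rV[R]_p -> R) (y : 'rV[R]_p) : open S -> S y ->
  (forall i z, S z -> is_derive z (space_dir R i) f (g i z)) ->
  (forall i, g i z @[z --> y] --> g i y) ->
  lin_approx1 f y (g ^~ y).
Proof.
move=> oS Sy dg cg e e0.
(* One share of e for each of the p edges; the successor covers p = 0. *)
have e'0 : 0 < e / p.+1%:R by rewrite divr_gt0.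
have : \forall z \near y, S z /\ forall i, `|g i z - g i y| <= e / p.+1%:R.
  apply: filterI; first by apply: open_nbhs_nbhs.
  apply: near_forall_fin => i.
  have : nbhs (g i y) [set x | `|x - g i y| <= e / p.+1%:R].
    apply/nbhs_ballP; exists (e / p.+1%:R) => //= x; rewrite /ball /= distrC; exact: ltW.
  by move/(cg i).
move=> /nbhs_ballP[r /= r0 H]; apply/nbhs_ballP; exists r => //= z.
rewrite -ball_normE /ball_ /= distrC => zr.
have sum_eq (h : nat -> R) n : \sum_(k < n) (h k.+1 - h k) = h n - h 0%N.
  elim: n => [|n IH]; first by rewrite big_ord0 subrr.
  by rewrite big_ord_recr /= IH addrC addrA subrK.
have -> : f z - f y = \sum_(k < p) (f (splice y z k.+1) - f (splice y z k)).
  rewrite (sum_eq (fun k => f (splice y z k))); congr (f _ - f _); apply/rowP => i; rewrite !mxE//.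
  by rewrite ltn_ord.
rewrite -sumrB; apply: le_trans (ler_norm_sum _ _ _) _.
apply: (@le_trans _ _ (\sum_(k < p) e / p.+1%:R * `|z - y|)); last first.
  rewrite sumr_const card_ord -[leLHS]mulr_natr mulrAC ler_wpM2r// -mulrA ler_piMr ?ltW//.
  by rewrite mulrC ltr_pdivrMr// mul1r ltr_nat.
apply: ler_sum => k _; rewrite splice_step.
pose h s := f (splice y z k + s *: space_dir R k).
have := @increment_le _ h (fun s => g k (splice y z k + s *: space_dir R k)) 0 (z 0 k - y 0 k) (g k y) (e / p.+1%:R).
rewrite /h scale0r addr0 !subr0 => HH; apply: le_trans (HH _) _.
  move=> s hs; have [|Sz gz] := H (splice y z k + s *: space_dir R k).
    by rewrite -ball_normE /ball_ /= distrC; exact: splice_ball.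
  by split => //; apply: is_derive_line; exact: dg.
apply: ler_wpM2l; first exact: ltW.
by have := coord_le_norm (z - y) k; rewrite !mxE.
Qed.

Lemma lin_approx_coords (R : realType) p q (f : 'rV[R]_p -> 'rV[R]_q) (y : 'rV[R]_p) (T : 'M[R]_(p, q)) :
  (forall j, lin_approx1 (fun z => f z 0 j) y (T ^~ j)) -> lin_approx f y T.
Proof.
move=> H e e0.
have : \forall z \near y, forall j, `|f z 0 j - f y 0 j - \sum_i T i j * (z 0 i - y 0 i)| <= e * `|z - y|.
  by apply: near_forall_fin => j; exact: H.
apply: filterS => z hz; rewrite [leLHS]/Num.norm /= mx_normrE; apply/bigmax_leP; split.
  by rewrite mulr_ge0// ltW.
move=> [i j] _ /=; rewrite (ord1 i) !mxE; apply: le_trans (hz j); rewrite le_eqVlt; apply/orP; left.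
by apply/eqP; congr `|_ - _|; apply: eq_bigr => k _; rewrite !mxE mulrC.
Qed.

Lemma lin_approx1_comp (R : realType) p q (f : 'rV[R]_p -> 'rV[R]_q) (g : 'rV[R]_q -> R)
    (y : 'rV[R]_p) (T : 'M[R]_(p, q)) (a : 'I_q -> R) :
  lin_approx f y T -> lin_approx1 g (f y) a ->
  lin_approx1 (g \o f) y (fun i => \sum_j a j * T i j).
Proof.
move=> fT ga e e0; have [C C0 CT] := mulmx_bound T.
pose A : R := \sum_j `|a j| + 1.
have A0 : 0 < A by rewrite ltr_wpDl// sumr_ge0.
have C10 : 0 < C + 1 by rewrite addr_gt0.
(* Half of e pays for the error of g, since f expands distances by at most C + 1 near y; the other
   half pays for the error of f, which is weighted by the coefficients of a, of total size at most
   A. *)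
have e1 : 0 < e / 2 / (C + 1) by rewrite !divr_gt0.
have e2 : 0 < e / 2 / A by rewrite !divr_gt0.
have H1 : \forall z \near y, `|g (f z) - g (f y) - \sum_i a i * (f z 0 i - f y 0 i)| <= e / 2 / (C + 1) * `|f z - f y|.
  exact: lin_approx_cvg fT _ (ga _ e1).
have H2 := fT _ e2; have H3 := fT _ ltr01.
apply: filterS (filterI (filterI H1 H2) H3) => z [[h1 h2] h3] /=.
have fz : `|f z - f y| <= (C + 1) * `|z - y|.
  rewrite -[f z - f y](subrK ((z - y) *m T)); apply: (le_trans (ler_normD _ _)).
  by rewrite mulrDl addrC lerD.
have E : \sum_i (\sum_j a j * T i j) * (z 0 i - y 0 i) = \sum_j a j * ((z - y) *m T) 0 j.
  under eq_bigr do rewrite big_distrl /=.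
  rewrite exchange_big; apply: eq_bigr => j _; rewrite mxE big_distrr /=.
  by apply: eq_bigr => i _; rewrite !mxE; ring.
rewrite E.
set u := g (f z) - g (f y).
have -> : u - \sum_j a j * ((z - y) *m T) 0 j =
   (u - \sum_j a j * (f z 0 j - f y 0 j)) + \sum_j a j * (f z - f y - (z - y) *m T) 0 j.
  have -> : \sum_j a j * ((z - y) *m T) 0 j =
      \sum_j (a j * (f z 0 j - f y 0 j) - a j * (f z - f y - (z - y) *m T) 0 j).
    by apply: eq_bigr => j _; rewrite !mxE; ring.
  by rewrite sumrB opprB addrCA addrC.
apply: (le_trans (ler_normD _ _)); rewrite [e]splitr mulrDl; apply: lerD.
  apply: (le_trans h1); apply: (@le_trans _ _ (e / 2 / (C + 1) * ((C + 1) * `|z - y|))).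
    by rewrite ler_wpM2l// ltW.
  by rewrite mulrA divfK ?gt_eqF.
apply: (le_trans (ler_norm_sum _ _ _)).
apply: (@le_trans _ _ (\sum_j `|a j| * (e / 2 / A * `|z - y|))).
  apply: ler_sum => j _; rewrite normrM ler_wpM2l//.
  exact: le_trans (coord_le_norm _ j) h2.
rewrite -big_distrl /= mulrA ler_wpM2r// mulrCA ler_piMr ?divr_ge0 ?ltW//.
by rewrite ltr_pdivrMr// mul1r /A ltrDl.
Qed.

Lemma lin_approx1_is_derive (R : realType) p (f : 'rV[R]_p -> R) (y : 'rV[R]_p) (a : 'I_p -> R) i :
  lin_approx1 f y a -> is_derive y (space_dir R i) f (a i).
Proof.
move=> fa.
have nd : `|space_dir R i| = 1 :> R.
  apply/eqP; rewrite eq_le; apply/andP; split.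
    rewrite [leLHS]/Num.norm /= mx_normrE; apply/bigmax_leP; split => // -[j k] _ /=.
    by rewrite !mxE; case: (_ && _); rewrite ?normr1 ?normr0.
  by have := coord_le_norm (space_dir R i) i; rewrite mxE !eqxx normr1.
have H : (fun h : R => h^-1 *: ((f \o shift y) (h *: space_dir R i) - f y)) @ 0^' --> a i.
  apply/cvgrPdist_le => e e0.
  have /nbhs_ballP[r /= r0 hr] := fa _ e0.
  apply/nbhs_ballP; exists r => // h; rewrite /ball /= sub0r normrN => hr' h0.
  have h0' : 0 < `|h| by rewrite normr_gt0.
  have := hr (h *: space_dir R i + y).
  rewrite -ball_normE /ball_ /= opprD addrCA subrr addr0 normrN normrZ nd mulr1 => /(_ hr').
  rewrite addrK normrZ nd mulr1 (bigD1 i)//= big1 => [|j ji]; last first.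
    by rewrite !mxE eqxx (negbTE ji) /= mulr0 add0r subrr mulr0.
  rewrite !mxE !eqxx /= mulr1 addrK addr0 => H.
  have -> : a i - h^-1 * (f (h *: space_dir R i + y) - f y) =
    - h^-1 * (f (h *: space_dir R i + y) - f y - a i * h) by field.
  by rewrite normrM normrN normfV mulrC ler_pdivrMr.
by split; [apply/cvg_ex; exists (a i)|exact: cvg_lim].
Qed.

(** Substituting Y v into the expansion of X gives an error in terms of the increment of Y, which is
    then absorbed; continuity of Y at the one point suffices. *)
Lemma lin_approx_inverse (R : realType) p (X Y : 'rV[R]_p -> 'rV[R]_p) (y : 'rV[R]_p) (T : 'M[R]_p) :
  T \in unitmx -> lin_approx X y T -> Y (X y) = y -> Y v @[v --> X y] --> y ->
  (\forall v \near X y, X (Y v) = v) -> lin_approx Y (X y) (invmx T).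
Proof.
move=> uT XT Yy cY XY e e0; have [C C0 CT] := mulmx_bound (invmx T).
(* The first bound gives C k <= 1/2, which absorbs the increment u and yields |u| <= 2 C |w|; with
   it the second makes the final error 2 C^2 k |w| at most e |w|. *)
pose k := Num.min (2^-1 / C) (e / (2 * C ^+ 2)).
have k0 : 0 < k by rewrite lt_min !divr_gt0// mulr_gt0// exprn_gt0.
have Ck : C * k <= 2^-1 by rewrite mulrC -ler_pdivlMr ?ge_min ?lexx.
have C2k : 2 * C ^+ 2 * k <= e by rewrite mulrC -ler_pdivlMr ?ge_min ?lexx ?orbT// mulr_gt0// exprn_gt0.
have H1 : \forall v \near X y, `|X (Y v) - X y - (Y v - y) *m T| <= k * `|Y v - y| by exact: cY _ (XT _ k0).
apply: filterS (filterI H1 XY) => v [/= h1 XYv]; rewrite Yy.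
rewrite XYv in h1.
set u := Y v - y in h1 *; set w := v - X y in h1 *.
have E : u - w *m invmx T = - ((w - u *m T) *m invmx T).
  set er := w - u *m T; have -> : w = er + u *m T by rewrite subrK.
  by rewrite mulmxDl mulmxK// opprD addrCA subrr addr0.
have h2 : `|u - w *m invmx T| <= C * (k * `|u|).
  by rewrite E normrN; apply: le_trans (CT _) _; rewrite ler_pM2l.
have h3 : `|u| <= 2 * C * `|w|.
  have : `|u| <= `|u - w *m invmx T| + `|w *m invmx T|.
    by rewrite -{1}[u](subrK (w *m invmx T)) ler_normD.
  have := CT w; have : C * (k * `|u|) <= 2^-1 * `|u| by rewrite mulrA ler_wpM2r.
  lra.
apply: (le_trans h2); apply: (@le_trans _ _ (C * (k * (2 * C * `|w|)))).
  by rewrite ler_pM2l// ler_pM2l.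
have -> : C * (k * (2 * C * `|w|)) = 2 * C ^+ 2 * k * `|w| by ring.
by rewrite ler_wpM2r.
Qed.

(** * Geometry of the moving domain *)

Lemma within_comp (T U W : topologicalType) (A : set T) (B : set U) (h : T -> U) (f : U -> W) :
  {within A, continuous h} -> (forall x, A x -> B (h x)) -> {within B, continuous f} ->
  {within A, continuous (f \o h)}.
Proof.
move=> /subspace_continuousP ch AB /subspace_continuousP cf; apply/subspace_continuousP => x Ax.
move=> P /(cf _ (AB _ Ax)) /= H; have := ch x Ax _ H; rewrite /nbhs /= /within /=.
by apply: filterS => z hz Az; exact: hz Az (AB _ Az).
Qed.

Lemma within_open_cvg (T U : topologicalType) (S A : set T) (f : T -> U) (x : T) :
  open S -> S x -> S `<=` A -> {within A, continuous f} -> f y @[y --> x] --> f x.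
Proof.
move=> oS Sx SA /subspace_continuousP /(_ x (SA _ Sx)) cf P /cf.
rewrite /nbhs /= /within /= => H.
have nS : nbhs x S by apply: open_nbhs_nbhs.
by apply: filterS (filterI H nS) => z [h Sz]; exact: h (SA _ Sz).
Qed.

(** A closed piece that misses the point also misses a neighbourhood of it, so only the finitely
    many pieces through the point matter. *)
Lemma within_cover (T U : topologicalType) n (A : set T) (C : 'I_n -> set T) (f : T -> U) :
  (forall k, closed (C k)) -> A `<=` \bigcup_k C k -> (forall k, {within C k, continuous f}) ->
  {within A, continuous f}.
Proof.
move=> cC AC cf; apply/subspace_continuousP => x Ax P Pfx.
have H k : \forall z \near x, C k z -> P (f z).
  have [Cx|nCx] := pselect (C k x).
    by move/subspace_continuousP : (cf k) => /(_ x Cx P Pfx).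
  have : nbhs x (~` C k) by apply: open_nbhs_nbhs; split => //; exact: closed_openC.
  by apply: filterS => z.
have /filterS : \forall z \near x, forall k, C k z -> P (f z) by exact: filter_forall.
by apply => z h /AC[k _]; exact: h.
Qed.

Lemma within_eq (T U : topologicalType) (A : set T) (f g : T -> U) :
  (forall x, A x -> f x = g x) -> {within A, continuous f} -> {within A, continuous g}.
Proof.
move=> fg /subspace_continuousP cf; apply/subspace_continuousP => x Ax P.
move=> Pg; have /(cf x Ax) : nbhs (f x) P by rewrite fg.
rewrite /nbhs /= /within /=; by apply: filterS => z h Az; have := h Az; rewrite /from_subspace fg.
Qed.

Lemma cvg_sumr (R : realType) T (F : set_system T) (FF : Filter F) I (r : seq I) (f : I -> T -> R) (a : I -> R) :
  (forall i, f i x @[x --> F] --> a i) ->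
  \sum_(i <- r) f i x @[x --> F] --> \sum_(i <- r) a i.
Proof. by move=> H; apply: cvg_big => //; exact: add_continuous. Qed.

Lemma cvg_prodr (R : realType) T (F : set_system T) (FF : Filter F) I (r : seq I) (f : I -> T -> R) (a : I -> R) :
  (forall i, f i x @[x --> F] --> a i) ->
  \prod_(i <- r) f i x @[x --> F] --> \prod_(i <- r) a i.
Proof. by move=> H; apply: cvg_big => //; exact: mul_continuous. Qed.

Lemma cvg_det (R : realType) T (F : set_system T) (FF : Filter F) n (M : T -> 'M[R]_n) (L : 'M[R]_n) :
  (forall i j, M x i j @[x --> F] --> L i j) -> \det (M x) @[x --> F] --> \det L.
Proof.
move=> H; apply: cvg_sumr => s; apply: cvgM; first exact: cvg_cst.
by apply: cvg_prodr => i; exact: H.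
Qed.

Lemma cvg_cofactor (R : realType) T (F : set_system T) (FF : Filter F) n (M : T -> 'M[R]_n) (L : 'M[R]_n) i j :
  (forall i j, M x i j @[x --> F] --> L i j) -> cofactor (M x) i j @[x --> F] --> cofactor L i j.
Proof.
move=> H; apply: cvgM; first exact: cvg_cst.
by apply: cvg_det => k l; under eq_fun do rewrite !mxE; rewrite !mxE; exact: H.
Qed.

Lemma invmxE (R : realType) n (M : 'M[R]_n) i j : M \in unitmx ->
  invmx M i j = (\det M)^-1 * cofactor M j i.
Proof. by move=> uM; rewrite /invmx uM !mxE. Qed.

Lemma closure_setX_pt (T U : topologicalType) (A : set T) (B : set U) x y :
  closure A x -> closure B y -> closure (A `*` B) (x, y).
Proof.
move=> Ax By S [[P Q] [Px Qy] PQS].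
have [a [Aa Pa]] := Ax P Px; have [b [Bb Qb]] := By Q Qy.
by exists (a, b); split => //; exact: PQS.
Qed.

Lemma is_derive_slice_space (R : realType) p (f : 'rV[R]_p * R -> R) (y v : 'rV[R]_p) (t d : R) :
  is_derive (y, t) ((v, 0) : 'rV[R]_p * R) f d -> is_derive y v (fun x => f (x, t)) d.
Proof.
move=> [ex val].
have E : (fun h : R => h^-1 *: ((f \o shift (y, t)) (h *: ((v, 0) : 'rV[R]_p * R)) - f (y, t))) =
    (fun h : R => h^-1 *: (((fun x => f (x, t)) \o shift y) (h *: v) - f (y, t))).
  apply/funext => h; congr (_ *: (f _ - _)); rewrite /shift /=.
  by transitivity (h *: v + y, h *: (0 : R) + t) => //; rewrite scaler0 add0r.
by split; [move: ex; rewrite /derivable E|rewrite -val /derive E].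
Qed.

Lemma is_derive_slice_time (R : realType) p (f : 'rV[R]_p * R -> R) (y : 'rV[R]_p) (t d : R) :
  is_derive (y, t) ((0, 1) : 'rV[R]_p * R) f d -> is_derive t 1 (fun s => f (y, s)) d.
Proof.
move=> [ex val].
have E : (fun h : R => h^-1 *: ((f \o shift (y, t)) (h *: ((0, 1) : 'rV[R]_p * R)) - f (y, t))) =
    (fun h : R => h^-1 *: (((fun s => f (y, s)) \o shift t) (h *: 1) - f (y, t))).
  apply/funext => h; congr (_ *: (f _ - _)); rewrite /shift /=.
  by transitivity (h *: (0 : 'rV[R]_p) + y, h *: (1 : R) + t) => //; rewrite scaler0 add0r.
by split; [move: ex; rewrite /derivable E|rewrite -val /derive E].
Qed.

Lemma slice_within (R : realType) p (S : set ('rV[R]_p * R)) (A : set 'rV[R]_p) t (f : 'rV[R]_p * R -> R) :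
  (forall y, A y -> S (y, t)) -> {within S, continuous f} -> {within A, continuous (fun y => f (y, t))}.
Proof.
move=> AS cf; apply: (within_comp (h := fun y => (y, t)) _ AS cf).
apply: continuous_subspaceT => y P [[A1 B1] /= [Ay Bt] ABP]; apply: filterS Ay => z Az.
by apply: ABP; split => //=; exact: nbhs_singleton.
Qed.

(** * The mapping, its inverse and the coordinate velocity at a fixed time *)

Section geometry.
Context (R : realType) (p : nat) (G : geometry R p) (hG : moving_domain G) (t : R).
Hypothesis ht : t_start G < t < t_end G.
Notation n := (nblocks G).
Notation X := (fun y => x_of G y t).
Notation Y := (fun x => xhat_of G x t).
Notation W := (@block_ref _ _ G).
Notation V := (fun k : 'I_n => block k t).
Notation Om := (dom G t).
Notation Omr := (dom_ref G).

Let htc : t_start G <= t <= t_end G.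
Proof. by move: ht => /andP[/ltW -> /ltW ->]. Qed.

Lemma time_open : open [set s : R | t_start G < s < t_end G].
Proof.
rewrite (_ : [set s | _] = `]t_start G, t_end G[%classic); first exact: interval_open.
by apply/seteqP; split => s; rewrite /= in_itv.
Qed.

Lemma block_ref_open k : open (W k).
Proof. by have [/(_ k)[]] := md_ref_blocks hG. Qed.

Lemma block_ref_sub k : W k `<=` Omr.
Proof. by have [/(_ k)[]] := md_ref_blocks hG. Qed.

Lemma block_open k : open (V k).
Proof. by have [/(_ k)[]] := md_blocks hG ht. Qed.

Lemma block_sub k : V k `<=` Om.
Proof. by have [/(_ k)[]] := md_blocks hG ht. Qed.

Lemma XK y : closure Omr y -> Y (X y) = y.
Proof. exact: (md_inverse hG htc). Qed.

Lemma closure_dom_ex x : closure Om x -> exists2 y, closure Omr y & X y = x.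
Proof. by rewrite -(md_image_closure hG htc) => -[y ? <-]; exists y. Qed.

Lemma X_closure y : closure Omr y -> closure Om (X y).
Proof. by move=> yO; rewrite -(md_image_closure hG htc); exists y. Qed.

Lemma Y_closure x : closure Om x -> closure Omr (Y x).
Proof. by move=> /closure_dom_ex[y yO <-]; rewrite XK. Qed.

Lemma YK x : closure Om x -> X (Y x) = x.
Proof. by move=> /closure_dom_ex[y yO <-]; rewrite XK. Qed.

Lemma block_refP k y : W k y -> V k (X y).
Proof. by move=> Wy; exists y. Qed.

Lemma blockP k x : V k x -> W k (Y x).
Proof. by move=> [y Wy <-]; rewrite XK//; apply: subset_closure; exact: block_ref_sub Wy. Qed.

Lemma domrP y : Omr y -> Om (X y).
Proof. by move=> Oy; rewrite -(md_image hG htc); exists y. Qed.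

Lemma domP x : Om x -> Omr (Y x).
Proof. by rewrite -(md_image hG htc) => -[y Oy <-]; rewrite XK//; exact: subset_closure. Qed.

(** Makes the arbitrary choice of an adjacent block in [jacdet_ref] unambiguous inside a block. *)
Lemma block_ref_triv k l y : W k y -> closure (W l) y -> k = l.
Proof.
move=> Wk cl; apply/eqP; apply: contraT => kl.
have [_ /(_ k l kl) E _ _] := md_ref_blocks hG.
have [z [Wl Wk']] := cl _ (open_nbhs_nbhs (conj (@block_ref_open k) Wk)).
by have : (W k `&` W l) z by []; rewrite E.
Qed.

Lemma block_ref_st_closure k y : closure (W k) y -> closure (block_ref_st (G := G) k) (y, t).
Proof. by move=> cy; apply: closure_setX_pt => //; apply: subset_closure; exact: ht. Qed.

Lemma block_derivs k : exists h : 'I_p -> option 'I_p -> field R p, forall i o,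
  (forall z, block_ref_st (G := G) k z ->
     is_derive z (spacetime_dir R o) (fun z => x_of G z.1 z.2 0 i) (h i o z)) /\
  Ck_closure (@spacetime_dir R p) 1 (block_ref_st (G := G) k) (h i o).
Proof.
have H i o : exists g : field R p,
  (forall z, block_ref_st (G := G) k z ->
     is_derive z (spacetime_dir R o) (fun z => x_of G z.1 z.2 0 i) (g z)) /\
  Ck_closure (@spacetime_dir R p) 1 (block_ref_st (G := G) k) g.
  by have [_ /(_ o)[g]] := md_C2 hG k i; exists g.
by exists (fun i o => sval (cid (H i o))) => i o; exact: svalP (cid (H i o)).
Qed.

(** One fixed choice of the first derivatives of the mapping; on the boundary of the block these are
    their continuous extensions. *)
Definition bder k : 'I_p -> option 'I_p -> field R p := sval (cid (block_derivs k)).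

Lemma bder_derive k i o z : block_ref_st (G := G) k z ->
  is_derive z (spacetime_dir R o) (fun z => x_of G z.1 z.2 0 i) (bder k i o z).
Proof. by move=> kz; have := (svalP (cid (block_derivs k)) i o).1 z kz. Qed.

Lemma bder_C1 k i o :
  Ck_closure (@spacetime_dir R p) 1 (block_ref_st (G := G) k) (bder k i o).
Proof. exact: (svalP (cid (block_derivs k)) i o).2. Qed.

Lemma bder_within k i o : {within closure (W k), continuous (fun y => bder k i o (y, t))}.
Proof.
have [c _] := bder_C1 k i o; apply: slice_within c => y; exact: block_ref_st_closure.
Qed.

(** The transposed Jacobian matrix, in accordance with [lin_approx]. *)
Definition Mjac k y : 'M[R]_p := \matrix_(j, i) bder k i (Some j) (y, t).

Lemma X_lin_approx k y : W k y -> lin_approx X y (Mjac k y).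
Proof.
move=> Wy; apply: lin_approx_coords => i.
have := @lin_approx_partials _ _ _ (fun z => x_of G z t 0 i) (fun j z => bder k i (Some j) (z, t)) y (@block_ref_open k) Wy.
have -> : (Mjac k y)^~ i = (fun j => bder k i (Some j) (y, t)) by apply/funext => j; rewrite mxE.
apply.
- move=> j z Wz; apply: (@is_derive_slice_space _ _ (fun z => x_of G z.1 z.2 0 i)).
  exact: (@bder_derive k i (Some j)).
- move=> j; apply: (within_open_cvg (@block_ref_open k) Wy _ (@bder_within k i (Some j))); exact: subset_closure.
Qed.

Definition hdet k (z : 'rV[R]_p * R) : R := \det (\matrix_(i, j) bder k i (Some j) z).

Lemma hdet_jacdet k z : block_ref_st (G := G) k z -> jacdet G z = hdet k z.
Proof.
case: z => y s kz; rewrite /jacdet /hdet; congr (\det _); apply/matrixP => i j; rewrite !mxE /=.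
have := bder_derive i (Some j) kz; rewrite /spacetime_dir => /(@is_derive_slice_space _ _ (fun z => x_of G z.1 z.2 0 i)).
by move=> [_ ->].
Qed.

Lemma hdet_within k : {within closure (block_ref_st (G := G) k), continuous (hdet k)}.
Proof.
apply/subspace_continuousP => z kz; apply: cvg_det => i j.
under eq_fun do rewrite mxE; rewrite mxE.
have [/subspace_continuousP c _] := bder_C1 k i (Some j); exact: c.
Qed.

Lemma jacdet_blockE k z : closure (block_ref_st (G := G) k) z -> jacdet_block k z = hdet k z.
Proof.
move=> cz; have PF := within_nbhs_proper cz.
apply: cvg_lim => // P Pz.
have /subspace_continuousP /(_ z cz P Pz) := @hdet_within k.
rewrite /nbhs /= /within /=; apply: filterS => w h kw.
by rewrite (hdet_jacdet kw); apply: h; exact: subset_closure.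
Qed.

Lemma detM_gt0 k y : closure (W k) y -> 0 < \det (Mjac k y).
Proof.
move=> cy; have cz := block_ref_st_closure cy.
have := md_J_gt0 hG cz; rewrite jacdet_blockE// -det_tr /hdet.
by congr (0 < \det _); apply/matrixP => i j; rewrite !mxE.
Qed.

Lemma jacdet_refE k y : W k y -> jacdet_ref G (y, t) = \det (Mjac k y).
Proof.
move=> Wy; rewrite /jacdet_ref; case: pickP => [l /asboolP /= cl|/(_ k)]; last first.
  by rewrite asboolT //=; exact: subset_closure.
have <- := block_ref_triv Wy cl.
rewrite jacdet_blockE; last by apply: block_ref_st_closure; exact: subset_closure.
by rewrite -det_tr /hdet; congr (\det _); apply/matrixP => i j; rewrite !mxE.
Qed.

Lemma unitM k y : closure (W k) y -> Mjac k y \in unitmx.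
Proof. by move=> /detM_gt0 h; rewrite unitmxE unitfE gt_eqF. Qed.

(** Holds for every x: where no closed block contains the reference point, [jacdet_ref] has the
    default value 1. *)
Lemma J_gt0 x : 0 < J G x t.
Proof.
rewrite /J /jacdet_ref; case: pickP => [k /asboolP /= ck|_]; last exact: ltr01.
by apply: (md_J_gt0 hG); exact: block_ref_st_closure.
Qed.

Lemma J_block k y : W k y -> J G (X y) t = \det (Mjac k y).
Proof. by move=> Wy; rewrite /J XK ?(jacdet_refE Wy)//; apply/subset_closure/block_ref_sub/Wy. Qed.


Lemma compact_ref : compact (closure Omr).
Proof.
apply: bounded_closed_compact; last exact: closed_closure.
have [M [Mr HM]] := md_ref_bounded hG.
exists M; split => // N MN x cx /=; rewrite leNgt; apply/negP => Nx.
have [z [Oz]] : Omr `&` ball x (`|x| - N) !=set0.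
  by apply: cx; apply: nbhsx_ballx; rewrite subr_gt0.
rewrite -ball_normE /ball_ /= => h; have := HM N MN z Oz => /= zN.
have := ler_normB (x - z) (- z); rewrite opprK subrK normrN; lra.
Qed.

Lemma x_of_within s : t_start G <= s <= t_end G ->
  {within closure Omr, continuous (fun y => x_of G y s)}.
Proof.
move=> hs; apply: (within_comp (h := fun y => (y, s)) _ _ (md_continuous hG)) => //.
apply: continuous_subspaceT => y P [[A1 B1] /= [Ay Bt] ABP]; apply: filterS Ay => z Az.
by apply: ABP; split => //=; exact: nbhs_singleton.
Qed.

Lemma rV_hausdorff : hausdorff_space 'rV[R]_p.
Proof. exact: norm_hausdorff. Qed.

Lemma X_image_closed (C : set 'rV[R]_p) : closed C -> C `<=` closure Omr -> closed (X @` C).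
Proof.
move=> cC CO; apply: (compact_closed rV_hausdorff); apply: continuous_compact.
  by apply: continuous_subspaceW CO _; exact: x_of_within.
exact: subclosed_compact cC compact_ref CO.
Qed.

(** X is a continuous bijection on a compact set, so it sends closed sets to closed sets. *)
Lemma Y_within : {within closure Om, continuous Y}.
Proof.
apply/subspace_continuousP => x Ox P; rewrite nbhsE => -[N [oN NYx] NP].
pose K := X @` (closure Omr `&` ~` N).
have cK : closed K.
  apply: X_image_closed; last by move=> y [].
  by apply: closedI; [exact: closed_closure|exact: open_closedC].
have xK : nbhs x (~` K).
  apply: open_nbhs_nbhs; split; first exact: closed_openC.
  by move=> [y [yO yN] yx]; apply: yN; rewrite -(XK yO) yx.
rewrite /nbhs /= /within /=; apply: filterS xK => z zK Oz; apply: NP; apply: contrapT => nN.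
by apply: zK; exists (Y z); [split => //; exact: Y_closure|exact: YK].
Qed.

(** The image under X of the closed reference block is compact, hence a closed set containing the
    moving block. *)
Lemma closure_block k x : closure (V k) x -> closure (W k) (Y x).
Proof.
have cX : closed (X @` closure (W k)).
  by apply: X_image_closed; [exact: closed_closure|apply: closure_subset; exact: block_ref_sub].
have sub : closure (V k) `<=` X @` closure (W k).
  have S : V k `<=` X @` closure (W k).
    by move=> z [y Wy <-]; exists y => //; exact: subset_closure.
  by move=> z /(closure_subset S) /cX.
move=> /sub[y Wy <-]; rewrite XK//; by apply: closure_subset Wy; exact: block_ref_sub.
Qed.

Lemma closure_block_dom k : closure (V k) `<=` closure Om.
Proof. by apply: closure_subset; exact: block_sub. Qed.

Lemma dom_cover x : closure Om x -> exists k, closure (V k) x.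
Proof. by have [_ _ -> _] := md_blocks hG ht; move=> [k _ kx]; exists k. Qed.

Lemma bdryE : bdry Om = closure Om `\` Om /\ bdry Omr = closure Omr `\` Omr.
Proof.
have oO : open Om := md_open hG htc; have oR : open Omr := md_ref_open hG.
by rewrite /bdry (proj1 (interior_id Om) oO) (proj1 (interior_id Omr) oR).
Qed.

Lemma bdry_dom x : bdry Om x -> bdry Omr (Y x).
Proof.
have [-> ->] := bdryE.
move=> [cx nx]; split; first exact: Y_closure.
by move=> /domrP; rewrite YK.
Qed.

Lemma bdry_ref y : bdry Omr y -> bdry Om (X y).
Proof.
have [-> ->] := bdryE.
move=> [cy ny]; split; first exact: X_closure.
by move=> /domP; rewrite XK.
Qed.

(* On the boundary of a block the derivative in time is not part of the C^2
   hypothesis; the mean value estimate passes to the limit from inside. *)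
Lemma x_of_time_derive k i y : closure (W k) y ->
  is_derive t 1 (fun s => x_of G y s 0 i) (bder k i None (y, t)).
Proof.
move=> cy; set g := bder k i None.
have est e : 0 < e -> \forall s \near t, `|x_of G y s 0 i - x_of G y t 0 i - g (y, t) * (s - t)| <= e * `|s - t|.
  move=> e0.
  have [/subspace_continuousP cg _] := bder_C1 k i None.
  have : nbhs (g (y, t)) [set r | `|r - g (y, t)| <= e].
    by apply/nbhs_ballP; exists e => //= r; rewrite /ball /= distrC; exact: ltW.
  move=> /(cg _ (block_ref_st_closure cy)); rewrite /nbhs /= /within /= => -[[A B] /= [Ay Bt] AB].
  have : nbhs t (B `&` [set s | t_start G < s < t_end G]).
    by apply: filterI => //; apply: open_nbhs_nbhs; split; [exact: time_open|].
  move=> /nbhs_ballP[d /= d0 dB]; apply/nbhs_ballP; exists d => // s ds.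
  have [Bs /= hs] := dB s ds.
  have main y' : W k y' -> A y' -> `|x_of G y' s 0 i - x_of G y' t 0 i - g (y, t) * (s - t)| <= e * `|s - t|.
    move=> Wy' Ay'.
    apply: (@increment_le _ (fun s => x_of G y' s 0 i) (fun s => g (y', s))) => r hr.
    have [Br /= hr'] : (B `&` [set s | t_start G < s < t_end G]) r.
      apply: dB; move: ds hr; rewrite /ball /= !ltr_norml ge_min le_max => /andP[d1 d2] /andP[/orP r1 /orP r2].
      by apply/andP; split; case: r1 => ?; case: r2 => ?; lra.
    have kr : block_ref_st (G := G) k (y', r) by [].
    split; first exact: is_derive_slice_time (bder_derive i None kr).
    by apply: (AB (y', r)) => //; exact: subset_closure.
  (* With s fixed, the estimate for y' inside the block is closed under y' tending to y. *)
  have PF := within_nbhs_proper cy.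
  have hsc : t_start G <= s <= t_end G by move: hs => /andP[/ltW -> /ltW ->].
  have cyO : closure Omr y by apply: closure_subset cy; exact: block_ref_sub.
  have cv r : t_start G <= r <= t_end G -> x_of G y' r 0 i @[y' --> within (W k) (nbhs y)] --> x_of G y r 0 i.
    move=> hr; have /subspace_continuousP /(_ y cyO) cr := x_of_within hr.
    apply: (@cvg_comp _ _ _ (fun y' => x_of G y' r) (fun v : 'rV[R]_p => v 0 i)); last exact: coord_continuous.
    move=> P /cr; rewrite /nbhs /= /within /=; apply: filterS => z h Wz; apply: h.
    by apply: subset_closure; exact: block_ref_sub Wz.
  have cvn : `|x_of G y' s 0 i - x_of G y' t 0 i - g (y, t) * (s - t)| @[y' --> within (W k) (nbhs y)] -->
      `|x_of G y s 0 i - x_of G y t 0 i - g (y, t) * (s - t)|.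
    apply: cvg_norm; apply: cvgB; last exact: cvg_cst.
    by apply: cvgB; apply: cv.
  have cle : closed [set r : R | r <= e * `|s - t|] by exact: closed_le.
  apply: (closed_cvg _ cle _ _ cvn).
  by rewrite /within /=; apply: filterS Ay => y' Ay' Wy'; exact: main.
have H : (fun h : R => h^-1 *: (((fun s => x_of G y s 0 i) \o shift t) (h *: 1) - x_of G y t 0 i)) @ 0^' --> g (y, t).
  apply/cvgrPdist_le => e e0.
  have /nbhs_ballP[r /= r0 hr] := est _ e0.
  apply/nbhs_ballP; exists r => // h; rewrite /ball /= sub0r normrN => hr' h0.
  have h0' : 0 < `|h| by rewrite normr_gt0.
  have := hr (h *: 1 + t); rewrite [h *: 1]mulr1 /ball /= opprD addrCA subrr addr0 normrN => /(_ hr').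
  rewrite addrK => H.
  have -> : g (y, t) - h^-1 * (x_of G y (h + t) 0 i - x_of G y t 0 i) =
    - h^-1 * (x_of G y (h + t) 0 i - x_of G y t 0 i - g (y, t) * h) by field.
  by rewrite normrM normrN normfV mulrC ler_pdivrMr.
by split; [apply/cvg_ex; exists (g (y, t))|exact: cvg_lim].
Qed.

Lemma xdotE k i x : closure (V k) x -> xdot G x t 0 i = bder k i None (Y x, t).
Proof.
by move=> /closure_block cx; rewrite mxE derive1E; have [_ ->] := x_of_time_derive i cx.
Qed.

Lemma bder_Y_within k i o : {within closure (V k), continuous (fun x => bder k i o (Y x, t))}.
Proof.
apply: (within_comp (h := Y) (B := closure (W k)) _ _ (@bder_within k i o)).
  by apply: continuous_subspaceW Y_within; exact: closure_block_dom.
by move=> x; exact: closure_block.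
Qed.

(** On each closed block [xdot] is the composition of a continuous extension with Y, also on the
    interfaces, so the pieces paste together. *)
Lemma xdot_within i : {within closure Om, continuous (fun x => xdot G x t 0 i)}.
Proof.
apply: (@within_cover _ _ n _ (fun k => closure (V k))).
- by move=> k; exact: closed_closure.
- by move=> x /dom_cover[k kx]; exists k.
- move=> k; apply: within_eq (@bder_Y_within k i None) => x kx; by rewrite (xdotE i kx).
Qed.

Lemma Y_lin_approx k y : W k y -> lin_approx Y (X y) (invmx (Mjac k y)).
Proof.
move=> Wy; have Vx := block_refP Wy.
have yO : closure Omr y by apply/subset_closure/block_ref_sub/Wy.
apply: (lin_approx_inverse (X := X)); [|exact: X_lin_approx|exact: XK| |].
- by apply: unitM; exact: subset_closure.
- have := within_open_cvg (@block_open k) Vx _ Y_within; rewrite XK//; apply.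
  by move=> z Vz; apply/subset_closure/block_sub/Vz.
- apply: filterS (open_nbhs_nbhs (conj (@block_open k) Vx)) => z Vz.
  by apply: YK; apply/subset_closure/block_sub/Vz.
Qed.

(** The inverse matrix by cofactors, so that continuity up to the boundary of the block follows from
    that of the entries. *)
Definition Minv k (j i : 'I_p) x : R := (\det (Mjac k (Y x)))^-1 * cofactor (Mjac k (Y x)) i j.

Lemma MY_cvg k x i j : closure (V k) x ->
  Mjac k (Y z) i j @[z --> within (closure (V k)) (nbhs x)] --> Mjac k (Y x) i j.
Proof.
move=> kx; under eq_fun do rewrite mxE; rewrite mxE.
by have /subspace_continuousP := @bder_Y_within k j (Some i); apply.
Qed.

Lemma Minv_within k j i : {within closure (V k), continuous (Minv k j i)}.
Proof.
apply/subspace_continuousP => x kx; apply: cvgM.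
  apply: cvgV; first by rewrite gt_eqF// detM_gt0//; exact: closure_block.
  by apply: cvg_det => *; exact: MY_cvg.
by apply: cvg_cofactor => *; exact: MY_cvg.
Qed.

Lemma MinvE k i j x : V k x -> invmx (Mjac k (Y x)) j i = Minv k j i x.
Proof. by move=> Vx; rewrite invmxE//; apply/unitM/subset_closure/blockP. Qed.

(** This is where second derivatives of the mapping enter: [xdot] is the time derivative composed
    with Y, and the chain rule produces mixed derivatives times the inverse Jacobian. *)
Lemma xdot_C1 k i : Ck_closure (@space_dir R p) 1 (V k) (fun x => xdot G x t 0 i).
Proof.
split.
  by apply: continuous_subspaceW (@xdot_within i); exact: closure_block_dom.
move=> j.
have [_ dg] := bder_C1 k i None.
pose g l : field R p := sval (cid (dg (Some l))).
have g1 l z : block_ref_st (G := G) k z -> is_derive z (spacetime_dir R (Some l)) (bder k i None) (g l z).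
  exact: (svalP (cid (dg (Some l)))).1.
have g2 l : {within closure (block_ref_st (G := G) k), continuous (g l)}.
  exact: (svalP (cid (dg (Some l)))).2.1.
have g3 l : {within closure (W k), continuous (fun y => g l (y, t))}.
  by apply: slice_within (@g2 l) => y; exact: block_ref_st_closure.
exists (fun x => \sum_l g l (Y x, t) * Minv k j l x); split.
  move=> x Vx; have Wy := blockP Vx.
  have xX : X (Y x) = x by apply: YK; apply/subset_closure/block_sub/Vx.
  have ga : lin_approx1 (fun y => bder k i None (y, t)) (Y x) (fun l => g l (Y x, t)).
    apply: (@lin_approx_partials _ _ _ (fun y => bder k i None (y, t)) (fun l y => g l (y, t))
      (Y x) (@block_ref_open k) Wy).
      by move=> l z Wz; apply: is_derive_slice_space; apply: (@g1 l).
    by move=> l; apply: (within_open_cvg (@block_ref_open k) Wy _ (@g3 l)); exact: subset_closure.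
  have Ya := Y_lin_approx Wy; rewrite xX in Ya.
  have := lin_approx1_is_derive j (lin_approx1_comp Ya ga).
  under eq_bigr do rewrite MinvE//.
  apply: near_eq_is_derive; apply: filterS (open_nbhs_nbhs (conj (@block_open k) Vx)) => z Vz.
  by rewrite (xdotE i (subset_closure Vz)).
split => //.
apply/subspace_continuousP => x kx; apply: cvg_sumr => l; apply: cvgM; last first.
  by have /subspace_continuousP := @Minv_within k j l; apply.
have /subspace_continuousP : {within closure (V k), continuous (fun x => g l (Y x, t))}.
  apply: (within_comp (h := Y) (B := closure (W k)) _ _ (@g3 l)).
    by apply: continuous_subspaceW Y_within; exact: closure_block_dom.
  by move=> z; exact: closure_block.
by apply.
Qed.

Lemma dom_bounded : exists C, forall x, closure Om x -> `|x| <= C.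
Proof.
have : compact (closure Om).
  rewrite -(md_image_closure hG htc); apply: continuous_compact compact_ref; exact: x_of_within.
move=> /compact_bounded[M [_ HM]]; exists (M + 1) => x xO; apply: HM => //; lra.
Qed.

Lemma dom_compact : compact (closure Om).
Proof.
by rewrite -(md_image_closure hG htc); apply: continuous_compact compact_ref; exact: x_of_within.
Qed.

Lemma closure_dom_st x : closure Om x -> closure (dom_st G) (x, t).
Proof.
move=> xO S [[A B] /= [Ax Bt] AB].
have [a [Oa Aa]] := xO A Ax; exists (a, t); split; first by split.
by apply: AB; split => //=; exact: nbhs_singleton.
Qed.

End geometry.

(** Locality refers to the closed space-time domain, whereas [unhat] undoes [hat] on closed time
    slices. The image of the compact reference cylinder is closed and contains the space-time
    domain, which links the two. *)
Lemma dom_st_closure (R : realType) (p : nat) (G : geometry R p) (hG : moving_domain G) z :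
  closure (dom_st G) z -> t_start G < z.2 < t_end G -> closure (dom G z.2) z.1.
Proof.
pose I := [set s : R | t_start G <= s <= t_end G].
pose Z (w : 'rV[R]_p * R) := (x_of G w.1 w.2, w.2).
pose K := Z @` (closure (dom_ref G) `*` I).
have cI : compact I.
  have -> : I = `[t_start G, t_end G]%classic by apply/seteqP; split => s; rewrite /= in_itv.
  exact: segment_compact.
have cZ : {within closure (dom_ref G) `*` I, continuous Z}.
  apply/subspace_continuousP => w wA P [[A B] /= [Ax Bt] AB].
  have /subspace_continuousP /(_ w wA A Ax) := md_continuous hG.
  rewrite /nbhs /= /within /= => H.
  have HB : nbhs w [set w : 'rV[R]_p * R | B w.2].
    by exists (setT, B) => /=; [split => //; exact: filterT|move=> v []].
  have : nbhs w (fun v : 'rV[R]_p * R => (closure (dom_ref G) `*` I) v -> P (Z v)).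
    by apply: filterS (filterI H HB) => v [h hB] vA; apply: AB; split => //=; exact: h.
  by [].
have cK : closed K.
  apply: compact_closed; first exact: norm_hausdorff.
  by apply: continuous_compact cZ _; apply: compact_setX cI; exact: compact_ref hG.
have SK : dom_st G `<=` K.
  move=> [x s] [/= hs xs]; have hsc : t_start G <= s <= t_end G by move: hs => /andP[/ltW -> /ltW ->].
  move: xs; rewrite -(md_image hG hsc) => -[y Oy <-]; exists (y, s) => //; split => //=.
  exact: subset_closure.
move=> /(closure_subset SK) /cK[[y s] [/= Oy Is] <-] /= _.
by rewrite -(md_image_closure hG Is); exists y.
Qed.

(** * Integrals over subdivided domains *)

Section off_null.
Local Open Scope ereal_scope.
Context d (T : measurableType d) (R : realType) (mu : {measure set T -> \bar R}).
Variables (N : set T) (mN : measurable N) (N0 : mu N = 0).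

Let ae_off (P : T -> Prop) : (forall x, ~ N x -> P x) -> {ae mu, forall x, setT x -> P x}.
Proof.
move=> H; exists N; split => // x /= h; apply: contrapT => Nx; apply: h => _; exact: H.
Qed.

(** No measurability is assumed: the integral of a nonnegative function is a supremum over the
    simple functions below it. *)
Let le_nn (f g : T -> \bar R) : (forall x, 0 <= f x) -> (forall x, f x <= g x) ->
  \int[mu]_x f x <= \int[mu]_x g x.
Proof.
move=> f0 fg; have g0 x : 0 <= g x := le_trans (f0 x) (fg x).
rewrite (ge0_integralTE mu f0) (ge0_integralTE mu g0).
apply: ereal_sup_le => _ [h hf <-]; exists h => // x; exact: le_trans (hf x) (fg x).
Qed.

(** Squeezes f between two measurable functions that equal g off N and are 0 and infinite on N; both
    have the integral of g. *)
Let ge0_eq (f g : T -> \bar R) : (forall x, 0 <= f x) -> (forall x, 0 <= g x) ->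
  measurable_fun setT g -> (forall x, ~ N x -> f x = g x) ->
  \int[mu]_x f x = \int[mu]_x g x.
Proof.
move=> f0 g0 mg fg.
have mNC : measurable (~` N) by exact: measurableC.
pose lo := g \_ (~` N).
have mlo : measurable_fun setT lo.
  by apply/(measurable_restrictT _ mNC); exact: measurable_funTS.
pose hi x := if x \in N then +oo else g x.
have mhi : measurable_fun setT hi.
  rewrite -(setUv N); apply/measurable_funU => //; split.
    by apply: (eq_measurable_fun (cst +oo)) => // x xN; rewrite /hi xN.
  apply: (eq_measurable_fun g); last exact: measurable_funTS.
  by move=> x /[!inE] Nx; rewrite /hi memNset.
apply/eqP; rewrite eq_le; apply/andP; split.
  apply: (@le_trans _ _ (\int[mu]_x hi x)).
    apply: le_nn => // x; rewrite /hi; case: ifPn => [_|]; first by rewrite leey.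
    by rewrite notin_setE => /fg ->.
  rewrite (ae_eq_integral g)//; apply: ae_off => x Nx.
  by rewrite /hi memNset.
apply: (@le_trans _ _ (\int[mu]_x lo x)); last first.
  apply: le_nn => x; first by apply: erestrict_ge0 => *.
  rewrite /lo /patch; case: ifPn => //; rewrite inE => /fg <- //.
rewrite (ae_eq_integral lo)//; apply: ae_off => x Nx.
by rewrite /lo /patch mem_set.
Qed.

Lemma integral_eq_off_null (f g : T -> \bar R) :
  measurable_fun setT g -> (forall x, ~ N x -> f x = g x) ->
  \int[mu]_x f x = \int[mu]_x g x.
Proof.
move=> mg fg; rewrite integralE [in RHS]integralE; congr (_ - _); apply: ge0_eq => //.
- exact: measurable_funepos.
- by move=> x /fg h; rewrite !funeposE h.
- exact: measurable_funeneg.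
- by move=> x /fg h; rewrite !funenegE h.
Qed.

End off_null.

Lemma integral_subset_null d (T : measurableType d) (R : realType)
    (mu : {measure set T -> \bar R}) (D E : set T) (f : T -> \bar R) :
  measurable D -> measurable E -> E `<=` D -> mu (D `\` E) = 0%E -> measurable_fun E f ->
  (\int[mu]_(x in D) f x = \int[mu]_(x in E) f x)%E.
Proof.
move=> mD mE ED DE0 mf; rewrite integral_mkcond [RHS]integral_mkcond.
apply: (integral_eq_off_null (N := D `\` E)) => //; first exact: measurableD.
  exact/(measurable_restrictT _ mE).
move=> x nx; rewrite /patch; have [xE|xE] := pselect (E x).
  by rewrite !mem_set//; exact: ED.
have xD : ~ D x by move=> Dx; apply: nx.
by rewrite !memNset.
Qed.

Lemma measurable_fun_bigsetU_seq d (T : measurableType d) d' (T' : measurableType d') (I : Type)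
    (s : seq I) (F : I -> set T) (f : T -> T') :
  (forall i, measurable (F i)) -> (forall i, measurable_fun (F i) f) ->
  measurable_fun (\big[setU/set0]_(i <- s) F i) f.
Proof.
move=> mF mf; elim: s => [|i s IH]; first by rewrite big_nil; exact: measurable_fun_set0.
rewrite big_cons; apply/measurable_funU => //.
by apply: bigsetU_measurable => *; exact: mF.
Qed.

Lemma bigsetU_ord (T : Type) n (F : 'I_n -> set T) :
  \big[setU/set0]_(i < n) F i = \bigcup_k F k.
Proof.
apply/seteqP; split => [x|x [k _ Fx]].
  by rewrite -bigcup_seq => -[k _ Fx]; exists k.
by rewrite -bigcup_seq; exists k => //=; rewrite mem_index_enum.
Qed.

(** Measurability is asked for on the blocks only; the interfaces are null. *)
Lemma subdivision_integral (R : realType) p (A : set 'rV[R]_p) n (blk : 'I_n -> set 'rV[R]_p)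
    (f : 'rV[R]_p -> R) : open A -> subdivision A blk ->
  (forall k, measurable_fun (blk k : set (borel R p)) (f : borel R p -> R)) ->
  (\int[leb R p]_(x in A) (f x)%:E = \sum_(k < n) \int[leb R p]_(x in blk k) (f x)%:E)%E.
Proof.
move=> oA [ob dj _ null] mf.
have mb k : @measurable _ (borel R p) (blk k) by apply: open_borel; case: (ob k).
have mU : @measurable _ (borel R p) (\bigcup_k blk k).
  by rewrite -bigsetU_ord; apply: bigsetU_measurable => *; exact: mb.
have mfU : measurable_fun (\bigcup_k blk k : set (borel R p)) (f : borel R p -> R).
  by rewrite -bigsetU_ord; apply: measurable_fun_bigsetU_seq.
rewrite (@integral_subset_null _ (borel R p) R (leb R p) A (\bigcup_k blk k))//.
- rewrite -bigsetU_ord integral_bigsetU_EFin//.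
  + exact: index_enum_uniq.
  + by apply/trivIsetP => k l _ _ /dj.
  + by apply/measurable_EFinP; rewrite bigsetU_ord.
- exact: open_borel.
- by move=> x [k _ kx]; case: (ob k) => _; exact.
- exact/measurable_EFinP.
Qed.

(** * The energy identity *)

Lemma Rintegral_sum d (T : measurableType d) (R : realType) (mu : {measure set T -> \bar R})
    (A : set T) (I : Type) (s : seq I) (h : I -> T -> R) : measurable A ->
  (forall i, mu.-integrable A (EFin \o h i)) ->
  mu.-integrable A (EFin \o (fun x => \sum_(i <- s) h i x)) /\
  \int[mu]_(x in A) (\sum_(i <- s) h i x) = \sum_(i <- s) \int[mu]_(x in A) h i x.
Proof.
move=> mA ih; elim: s => [|i s [IH1 IH2]].
  under eq_fun do rewrite big_nil; rewrite big_nil; split; first exact: integrable0.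
  by rewrite /Rintegral integral0.
rewrite big_cons -IH2 -RintegralD//.
have E : (fun x => \sum_(j <- i :: s) h j x) = (fun x => h i x + \sum_(j <- s) h j x).
  by apply/funext => x; rewrite big_cons.
rewrite E; split => //.
apply: (eq_integrable mA (fun x => (EFin \o h i) x + (EFin \o (fun x => (\sum_(j <- s) h j x)%R)) x)%E) => //.
exact: integrableD.
Qed.

Section bddm.
Context (R : realType) (p : nat) (A : set 'rV[R]_p).

(** A class closed under sums and products whose members are integrable over sets of finite
    measure. *)
Definition bddm (h : 'rV[R]_p -> R) :=
  measurable_fun (A : set (borel R p)) (h : borel R p -> R) /\
  exists C, forall x, A x -> `|h x| <= C.

Lemma bddmD f g : bddm f -> bddm g -> bddm (fun x => f x + g x).
Proof.
move=> [mf [C fC]] [mg [D gD]]; split; first exact: measurable_funD.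
by exists (C + D) => x Ax; apply: le_trans (ler_normD _ _) _; rewrite lerD ?fC ?gD.
Qed.

Lemma bddmM f g : bddm f -> bddm g -> bddm (fun x => f x * g x).
Proof.
move=> [mf [C fC]] [mg [D gD]]; split; first exact: measurable_funM.
by exists (C * D) => x Ax; rewrite normrM ler_pM ?fC ?gD.
Qed.

Lemma bddm_cst c : bddm (fun=> c).
Proof. by split; [exact: measurable_cst|exists `|c|]. Qed.

Lemma bddm_sum (I : Type) (s : seq I) (h : I -> 'rV[R]_p -> R) : (forall i, bddm (h i)) ->
  bddm (fun x => \sum_(i <- s) h i x).
Proof.
move=> H; elim: s => [|i s IH].
  by under eq_fun do rewrite big_nil; exact: bddm_cst.
by under eq_fun do rewrite big_cons; exact: bddmD.
Qed.

Lemma bddm_integrable (mu : {measure set (borel R p) -> \bar R}) (h : 'rV[R]_p -> R) :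
  @measurable _ (borel R p) A -> (mu A < +oo)%E -> bddm h -> mu.-integrable A (EFin \o h).
Proof.
move=> mA muA [mh [C hC]]; apply: measurable_bounded_integrable => //.
exists C; split; first exact: num_real.
by move=> M CM x Ax /=; apply: le_trans (hC _ Ax) (ltW CM).
Qed.

Lemma within_compact_bddm (K : set 'rV[R]_p) (h : 'rV[R]_p -> R) :
  @measurable _ (borel R p) A -> A `<=` K -> compact K -> {within K, continuous h} -> bddm h.
Proof.
move=> mA AK cK ch; split.
  by apply: within_continuous_borel => //; exact: continuous_subspaceW AK ch.
have : compact (h @` K) by exact: continuous_compact.
move=> /compact_bounded[M [_ HM]]; exists (M + 1) => x /AK Kx.
apply: (HM (M + 1)); [lra|by exists x].
Qed.

End bddm.

Lemma Ck_closure_mul (R : realType) (V : normedModType R) (I : Type) (e : I -> V) (S : set V) (f g : V -> R) :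
  Ck_closure e 1 S f -> Ck_closure e 1 S g -> Ck_closure e 1 S (fun x => f x * g x).
Proof.
have cM (h k : V -> R) : {within closure S, continuous h} -> {within closure S, continuous k} ->
    {within closure S, continuous (fun x => h x * k x)}.
  move=> /subspace_continuousP ch /subspace_continuousP ck; apply/subspace_continuousP => x Sx.
  by apply: cvgM; [exact: ch|exact: ck].
have cD (h k : V -> R) : {within closure S, continuous h} -> {within closure S, continuous k} ->
    {within closure S, continuous (fun x => h x + k x)}.
  move=> /subspace_continuousP ch /subspace_continuousP ck; apply/subspace_continuousP => x Sx.
  by apply: cvgD; [exact: ch|exact: ck].
move=> [cf df] [cg dg]; split; first exact: cM.
move=> i; have [f' [df' [cf' _]]] := df i; have [g' [dg' [cg' _]]] := dg i.
exists (fun x => f x * g' x + g x * f' x); split.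
  by move=> z Sz; exact: is_deriveM (df' z Sz) (dg' z Sz).
by split => //; apply: cD; exact: cM.
Qed.

Section energy.
Context (R : realType) (p : nat) (G : geometry R p) (hG : moving_domain G) (t : R).
Hypothesis ht : t_start G < t < t_end G.
Notation n := (nblocks G).
Notation X := (fun y => x_of G y t).
Notation Y := (fun x => xhat_of G x t).
Notation W := (@block_ref _ _ G).
Notation V := (fun k : 'I_n => block k t).
Notation Om := (dom G t).
Notation Omr := (dom_ref G).

Let htc : t_start G <= t <= t_end G.
Proof. by move: ht => /andP[/ltW -> /ltW ->]. Qed.

Lemma dom_open : open Om. Proof. exact: md_open hG _ htc. Qed.
Lemma dom_ref_open : open Omr. Proof. exact: md_ref_open hG. Qed.
Lemma dom_borel : @measurable _ (borel R p) Om. Proof. by apply: open_borel; exact: dom_open. Qed.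

Lemma leb_bounded (A : set 'rV[R]_p) C : @measurable _ (borel R p) A ->
  (forall x, A x -> `|x| <= C) -> (leb R p A < +oo)%E.
Proof.
move=> mA AC; apply: (@le_lt_trans _ _ (leb R p (hbox (const_mx (- C)) (const_mx (C + 1))))).
  apply: le_measure; rewrite ?inE//; first exact: measurable_hbox.
  move=> x /AC xC i; rewrite !mxE; have := le_trans (coord_le_norm x i) xC.
  by rewrite ler_norml => /andP[? ?]; apply/andP; split; lra.
by rewrite leb_hbox ltry.
Qed.

Lemma dom_leb_fin : (leb R p Om < +oo)%E.
Proof.
have [C HC] := dom_bounded hG ht; apply: (leb_bounded dom_borel) => x Ox.
by apply: HC; exact: subset_closure.
Qed.

Lemma dom_integrable h : bddm Om h -> (leb R p).-integrable Om (EFin \o h).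
Proof. exact: bddm_integrable dom_borel dom_leb_fin. Qed.

Lemma dom_within_bddm h : {within closure Om, continuous h} -> bddm Om h.
Proof.
apply: within_compact_bddm; [exact: dom_borel|exact: subset_closure|exact (dom_compact hG ht)].
Qed.

(** [Fh] and F are compared inside the blocks only, where J is the determinant of the mapping; its
    conventional values on the interfaces never enter. *)
Lemma integral_dom_ref (F Fh : 'rV[R]_p -> R) :
  (forall k (x : 'rV[R]_p), V k x -> F z @[z --> x] --> F x) -> (exists C, forall x, Om x -> `|F x| <= C) ->
  (forall k y, W k y -> Fh y = F (X y) * J G (X y) t) ->
  (\int[leb R p]_(y in Omr) (Fh y)%:E = \int[leb R p]_(x in Om) (F x)%:E)%E.
Proof.
move=> cF [C FC] FhE.
have cX k (y : 'rV[R]_p) : W k y -> X z @[z --> y] --> X y.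
  by move=> Wy; apply: lin_approx_cvg (X_lin_approx hG ht Wy).
have cdet k (y : 'rV[R]_p) : W k y -> \det (Mjac hG t k z) @[z --> y] --> \det (Mjac hG t k y).
  move=> Wy; apply: (@cvg_det _ _ _ (nbhs_filter y)) => i j; under eq_fun do rewrite mxE; rewrite mxE.
  apply: (within_open_cvg (block_ref_open hG (k := k)) Wy (@subset_closure _ _)).
  exact: bder_within.
have detp k y : W k y -> `|\det (Mjac hG t k y)| = \det (Mjac hG t k y).
  by move=> Wy; rewrite gtr0_norm// detM_gt0//; exact: subset_closure.
have FhW k y : W k y -> Fh y = F (X y) * `|\det (Mjac hG t k y)|.
  by move=> Wy; rewrite (FhE k)// (J_block hG ht Wy) detp.
have cabs k (y : 'rV[R]_p) : W k y -> `|\det (Mjac hG t k z)| @[z --> y] --> `|\det (Mjac hG t k y)|.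
  by move=> Wy; exact (cvg_norm (cdet k y Wy)).
rewrite (subdivision_integral dom_ref_open (md_ref_blocks hG)); last first.
  move=> k; apply: (eq_measurable_fun (fun y : borel R p => F (X y) * `|\det (Mjac hG t k y)|)).
    by move=> y /[!inE] Wy; rewrite (FhW k).
  apply: open_continuous_borel; first exact: block_ref_open.
  move=> y Wy; apply: cvgM (cabs _ _ Wy); apply: cvg_comp (cX _ _ Wy) _.
  by apply: (cF k); exact: block_refP.
rewrite (subdivision_integral dom_open (md_blocks hG ht)); last first.
  by move=> k; apply: open_continuous_borel; [exact: block_open|exact: cF].
apply: eq_bigr => k _.
have VO : V k `<=` Om by exact: block_sub.
have Vb : (leb R p (V k) < +oo)%E.
  have [D HD] := dom_bounded hG ht; apply: (leb_bounded (open_borel (block_open hG ht (k := k)))) => x Vx.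
  by apply/HD/subset_closure/VO.
have YV x : V k x -> W k (Y x) by exact: blockP.
have WO y : W k y -> closure Omr y by move=> Wy; apply/subset_closure/(block_ref_sub hG)/Wy.
rewrite (@change_of_variables _ _ (W k) (V k) X Y (Mjac hG t k) F C).
- by apply: eq_integral => y /[!inE] Wy; rewrite (FhW k).
- exact: block_ref_open.
- exact: block_open.
- by move=> y; exact: block_refP.
- exact: YV.
- by move=> y /WO; exact: XK.
- by move=> x Vx; apply: (YK hG ht); apply/subset_closure/VO.
- by move=> y Wy; apply: (unitM hG ht); exact: subset_closure.
- by move=> y; exact: X_lin_approx.
- by move=> y; exact: Y_lin_approx.
- exact: cabs.
- exact: cF.
- exact: Vb.
- by move=> x /VO; exact: FC.
Qed.

Lemma pderiv_block k i (f : 'rV[R]_p -> R) : Ck_closure (@space_dir R p) 1 (V k) f ->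
  exists g, {within closure (V k), continuous g} /\ forall x, V k x -> pderiv G t i f x = g x.
Proof.
move=> [_ /(_ i)[g [dg [cg _]]]]; exists g; split => // x Vx.
by rewrite /pderiv patchE mem_set; [have [_ ->] := dg x Vx|exists k].
Qed.

Lemma pderiv_cvg k i (f : 'rV[R]_p -> R) (x : 'rV[R]_p) : Ck_closure (@space_dir R p) 1 (V k) f -> V k x ->
  pderiv G t i f z @[z --> x] --> pderiv G t i f x.
Proof.
move=> /(pderiv_block i)[g [cg gE]] Vx; rewrite (gE x Vx) => P.
have oV := block_open hG ht (k := k).
move=> /(within_open_cvg oV Vx (@subset_closure _ _) cg) H0.
have H : \forall z \near x, P (g z) by exact: H0.
apply: filterS (filterI H (open_nbhs_nbhs (conj oV Vx))) => z [Pz Vz].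
by rewrite /= gE.
Qed.

Lemma pderiv_bddm i (f : 'rV[R]_p -> R) : (forall k, Ck_closure (@space_dir R p) 1 (V k) f) ->
  bddm Om (pderiv G t i f).
Proof.
move=> H.
have oV k : open (V k) := block_open hG ht (k := k).
have mU : @measurable _ (borel R p) (\bigcup_(k in [set: 'I_n]) V k).
  by apply: open_borel; apply: bigcup_open => k _; exact: oV.
split.
  apply: measurable_funTS; apply/(measurable_restrictT _ mU); rewrite -bigsetU_ord.
  apply: measurable_fun_bigsetU_seq => k; first exact: open_borel.
  apply: (eq_measurable_fun (pderiv G t i f : borel R p -> R)).
    by move=> x /[!inE] Vx; rewrite /pderiv patchE mem_set//; exists k.
  by apply: open_continuous_borel => // x Vx; exact (pderiv_cvg (H k) Vx).
have bd k : exists C, forall x, V k x -> `|pderiv G t i f x| <= C.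
  have [g [cg gE]] := pderiv_block i (H k).
  have cK : compact (closure (V k)).
    by apply: subclosed_compact (dom_compact hG ht) (closure_block_dom hG ht (k := k)); exact: closed_closure.
  have [_ [C HC]] := within_compact_bddm (open_borel (oV k)) (@subset_closure _ _) cK cg.
  by exists C => x Vx; rewrite gE// HC.
pose C k := sval (cid (bd k)).
(* A common bound for all blocks; on the interfaces [pderiv] is 0. *)
exists (\sum_k `|C k|) => x _.
have [[k _ Vx]|nx] := pselect ((\bigcup_(k in [set: 'I_n]) V k) x).
  apply: le_trans (svalP (cid (bd k)) x Vx) _; apply: le_trans (ler_norm _) _.
  by rewrite (bigD1 k)//= lerDl sumr_ge0.
by rewrite /pderiv patchE memNset// normr0 sumr_ge0.
Qed.

Section field.
Variables (D : field R p -> 'rV[R]_p * R -> option R) (phi : field R p).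
Hypothesis Uphi : space_U G D phi.
Notation f := (slice phi t).
Notation u := (slice (op_val D phi) t).
Let xf i := fun x => xdot G x t 0 i * f x.

Lemma f_within : {within closure Om, continuous f}.
Proof.
case: Uphi => -[c _] _; apply: slice_within c => x; exact (closure_dom_st ht (x := x)).
Qed.

Lemma u_within : {within closure Om, continuous u}.
Proof.
case: Uphi => _ [g [cg gE]].
apply: (within_eq (f := fun x => g (x, t))).
  by move=> x Ox; rewrite /slice /op_val gE//; exact (closure_dom_st ht Ox).
by apply: slice_within cg => x; exact (closure_dom_st ht (x := x)).
Qed.

Lemma f_C1 k : Ck_closure (@space_dir R p) 1 (V k) f.
Proof.
case: Uphi => -[_ dphi] _.
split; first by apply: continuous_subspaceW f_within; exact: closure_block_dom.
move=> i; have [g [dg [cg _]]] := dphi (Some i).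
exists (fun x => g (x, t)); split.
  move=> x Vx; apply: is_derive_slice_space; apply: dg; split => //=; exact: (block_sub hG ht) Vx.
split => //; apply: slice_within cg => x kx; apply: (closure_dom_st ht).
exact: (closure_block_dom hG ht) kx.
Qed.

Lemma xf_within i : {within closure Om, continuous (xf i)}.
Proof.
have /subspace_continuousP c1 := xdot_within hG ht (i := i).
have /subspace_continuousP c2 := f_within.
by apply/subspace_continuousP => x Ox; apply: cvgM; [exact: c1|exact: c2].
Qed.

Lemma xf_C1 k i : Ck_closure (@space_dir R p) 1 (V k) (xf i).
Proof. by apply: Ck_closure_mul; [exact: xdot_C1|exact: f_C1]. Qed.

Lemma DmE x : Dm G phi (x, t) = 2^-1 * \sum_i (xdot G x t 0 i * pderiv G t i f x + pderiv G t i (xf i) x).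
Proof. by rewrite /Dm /= -big_split. Qed.

Lemma Dm_bddm : bddm Om (fun x => Dm G phi (x, t)).
Proof.
under eq_fun do rewrite DmE; apply: bddmM; first exact: bddm_cst.
apply: bddm_sum => i; apply: bddmD; last by apply: pderiv_bddm => k; exact: xf_C1.
apply: bddmM; first exact/dom_within_bddm/xdot_within.
by apply: pderiv_bddm => k; exact: f_C1.
Qed.

Lemma Dm_cvg k (x : 'rV[R]_p) : V k x -> Dm G phi (z, t) @[z --> x] --> Dm G phi (x, t).
Proof.
move=> Vx; under eq_fun do rewrite DmE; rewrite DmE; apply: (@cvgM _ _ (nbhs x) _ (fun=> 2^-1)); first exact: cvg_cst.
apply: (@cvg_sumr _ _ _ (nbhs_filter x)) => i; apply: cvgD; last by apply: (pderiv_cvg (k := k)) Vx; exact: xf_C1.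
apply: cvgM; last by apply: (pderiv_cvg (k := k)) Vx; exact: f_C1.
apply: (within_open_cvg dom_open _ (@subset_closure _ _)); first exact: (block_sub hG ht) Vx.
exact: xdot_within.
Qed.

Lemma bdry_closed : closed (bdry Om).
Proof.
have [-> _] := bdryE hG ht; rewrite setDE; apply: closedI; first exact: closed_closure.
by apply: open_closedC; exact: dom_open.
Qed.

(** Splitting the sum needs each summand integrable: f and the velocity are bounded on the compact
    boundary, and the components of the normal are at most 1 in absolute value almost everywhere. *)
Lemma surf_sum : surf_ip (bdry Om) f (fun x => dotp (normal G x t) (xdot G x t) * f x) =
  \sum_i surf_ip (bdry Om) f (fun x => normal G x t 0 i * xf i x).
Proof.
have [mu muE] := surface_measureP R p.
rewrite /surf_ip -muE.
pose h i x := f x * (normal G x t 0 i * xf i x).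
have mB : @measurable _ (borel R p) (bdry Om) by apply: closed_borel; exact: bdry_closed.
have ih i : mu.-integrable (bdry Om) (EFin \o h i).
  have bB g : {within closure Om, continuous g} -> bddm (bdry Om) g.
    apply: within_compact_bddm => //; last exact (dom_compact hG ht).
    by move=> x [].
  have [mf [C fC]] := bB _ f_within; have [mxf [C' xfC]] := bB _ (@xf_within i).
  have mn := md_normal_measurable hG ht i.
  have mh : measurable_fun (bdry Om : set (borel R p)) (h i : borel R p -> R).
    by apply: measurable_funM => //; exact: measurable_funM.
  apply/integrableP; split; first exact/measurable_EFinP.
  apply: (@le_lt_trans _ _ (\int[mu]_(x in bdry Om) (`|C| * `|C'|)%:E)%E); last first.
    rewrite integral_cst//.
    have mub : (mu (bdry Om) < +oo)%E by rewrite [X in (X _ < _)%E]muE; exact: (md_surface_finite hG ht).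
    by apply: lte_mul_pinfty mub; rewrite ?lee_fin ?mulr_ge0.
  apply: ae_ge0_le_integral => //.
    by apply: measurableT_comp => //; exact/measurable_EFinP.
  (* A component outside [-1, 1] contradicts unit length, so this Borel set lies inside the null set
     of bad normals. *)
  have mN : @measurable _ (borel R p) (bdry Om `&` (fun x => normal G x t 0 i) @^-1` (~` `[-1, 1]%classic)).
    by apply: mn => //; apply: measurableC; exact: measurable_itv.
  exists (bdry Om `&` (fun x => normal G x t 0 i) @^-1` (~` `[-1, 1]%classic)); split => //.
    apply/eqP; rewrite eq_le measure_ge0 andbT [X in (X _ <= _)%E]muE.
    rewrite -[leRHS](md_normal hG ht); apply: le_surface => x [Bx nx]; split => // -[n1 _].
    apply: nx => /=; rewrite in_itv /= -ler_norml -n1; exact: coord_le_eucl.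
  move=> x /= /not_implyP[Bx hx]; split => // nx; apply: hx.
  rewrite /= lee_fin /h !normrM ler_pM ?mulr_ge0//.
    by apply: le_trans (fC _ Bx) (ler_norm _).
  rewrite -[leRHS]mul1r ler_pM ?mulr_ge0//; first by move: nx; rewrite in_itv /= -ler_norml.
  by rewrite -normrM; apply: le_trans (xfC _ Bx) (ler_norm _).
have [_ E] := Rintegral_sum (index_enum 'I_p) mB ih.
rewrite -[RHS]E /Rintegral; congr (fine _); apply: eq_integral => x _; congr EFin.
rewrite /h /dotp mulr_suml mulr_sumr; apply: eq_bigr => i _.
by rewrite /xf !mulrA.
Qed.

(** For each i, integration by parts against [xf i] produces the volume term of the other half of
    [Dm] with the opposite sign, so only the boundary survives. *)
Lemma Dm_energy : vol_ip Om f (fun x => Dm G phi (x, t)) =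
  2^-1 * surf_ip (bdry Om) f (fun x => dotp (normal G x t) (xdot G x t) * f x).
Proof.
have bf := dom_within_bddm f_within.
have bxf i := dom_within_bddm (@xf_within i).
have bpf i : bddm Om (pderiv G t i f) by apply: pderiv_bddm => k; exact: f_C1.
have bpxf i : bddm Om (pderiv G t i (xf i)) by apply: pderiv_bddm => k; exact: xf_C1.
pose h i x := pderiv G t i f x * xf i x + f x * pderiv G t i (xf i) x.
have bh i : bddm Om (h i) by apply: bddmD; exact: bddmM.
have [ih E] := Rintegral_sum (index_enum 'I_p) dom_borel (fun i => dom_integrable (bh i)).
rewrite surf_sum.
transitivity (\int[leb R p]_(x in Om) (2^-1 * \sum_i h i x)).
  rewrite -[LHS]/(\int[leb R p]_(x in Om) (f x * Dm G phi (x, t))) /Rintegral; congr (fine _); apply: eq_integral => x _; congr EFin.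
  rewrite DmE mulrCA; congr (_ * _); rewrite mulr_sumr; apply: eq_bigr => i _.
  by rewrite /h /xf; ring.
rewrite RintegralZl//; last exact: dom_borel.
congr (_ * _); rewrite E; apply: eq_bigr => i _.
rewrite RintegralD; [|exact: dom_borel|by apply: dom_integrable; exact: bddmM..].
have := md_ibp hG ht (f := f) (g := xf i) i => /(_ _ _) ibp.
have -> : \int[leb R p]_(x in Om) (f x * pderiv G t i (xf i) x) = vol_ip Om f (pderiv G t i (xf i)) by [].
rewrite ibp; last 2 first.
- by split; [exact: f_within|exact: f_C1].
- by split; [exact: xf_within|move=> k; exact: xf_C1].
by rewrite addNKr.
Qed.

Lemma unhat_hat s x : t_start G < s < t_end G -> closure (dom G s) x ->
  unhat G (hat G phi) (x, s) = phi (x, s).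
Proof.
move=> hs xs; rewrite /unhat /hat /= (YK hG hs xs) mulKf//.
by rewrite gt_eqF// sqrtr_gt0 (J_gt0 hG hs).
Qed.

Lemma unhat_hat_local (Z : Type) (A : field R p -> 'rV[R]_p * R -> option Z) x :
  local_operator G A -> closure Om x -> A (unhat G (hat G phi)) (x, t) = A phi (x, t).
Proof.
move=> hA Ox; apply: hA; first exact (closure_dom_st ht Ox).
(* Being at an interior time is an open condition, so points of the closed space-time domain near
   (x, t) also lie on closed slices where [unhat_hat] applies. *)
have nt : nbhs (x, t) [set w : 'rV[R]_p * R | t_start G < w.2 < t_end G].
  exists (setT, [set s : R | t_start G < s < t_end G]) => /=; last by move=> v [].
  by split; [exact: filterT|apply: open_nbhs_nbhs; split; [exact: time_open|]].
apply: filterS nt => -[y s] /= hs ys; apply: unhat_hat => //.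
exact: (dom_st_closure hG ys hs).
Qed.

(** Blocks are open and the two fields agree on them, so their spatial derivatives agree as well. *)
Lemma Dm_unhat_hat x : (\bigcup_(k in [set: 'I_n]) V k) x ->
  Dm G (unhat G (hat G phi)) (x, t) = Dm G phi (x, t).
Proof.
move=> [k _ Vx]; rewrite /Dm /=; congr (_ * (_ + _)).
  apply: eq_bigr => i _; congr (_ * _).
  rewrite /pderiv !patchE; case: ifP => // _.
  apply: near_eq_derive; apply: filterS (open_nbhs_nbhs (conj (block_open hG ht (k := k)) Vx)) => z Vz.
  by apply: unhat_hat => //; apply/subset_closure/(block_sub hG ht)/Vz.
apply: eq_bigr => i _; rewrite /pderiv !patchE; case: ifP => // _.
apply: near_eq_derive; apply: filterS (open_nbhs_nbhs (conj (block_open hG ht (k := k)) Vx)) => z Vz.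
by congr (_ * _); apply: unhat_hat => //; apply/subset_closure/(block_sub hG ht)/Vz.
Qed.

Lemma hat_sqnorm : vol_sqnorm Omr (slice (hat G phi) t) = vol_sqnorm Om f.
Proof.
congr (fine _); apply: (@integral_dom_ref (fun x => f x * f x)).
- move=> k x Vx; have Ox : Om x by apply: (block_sub hG ht) Vx.
  have cf := within_open_cvg dom_open Ox (@subset_closure _ _) f_within.
  exact (cvgM cf cf).
- by have [] := bddmM (dom_within_bddm f_within) (dom_within_bddm f_within).
move=> k y Wy; rewrite /slice /hat /= mulrACA -expr2 sqr_sqrtr; last exact/ltW/(J_gt0 hG ht).
by rewrite mulrC.
Qed.

Lemma hat_energy : local_operator G D ->
  vol_ip Omr (slice (hat G phi) t) (slice (hat_D G D (hat G phi)) t) =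
  vol_ip Om f u
  + 2^-1 * surf_ip (bdry Om) f (fun x => dotp (normal G x t) (xdot G x t) * f x).
Proof.
move=> hD.
have bf := dom_within_bddm f_within; have bu := dom_within_bddm u_within.
have bD := Dm_bddm.
rewrite -Dm_energy -[X in X + _]/(\int[leb R p]_(x in Om) (f x * u x)).
rewrite -[X in _ + X]/(\int[leb R p]_(x in Om) (f x * Dm G phi (x, t))).
rewrite -RintegralD; [|exact: dom_borel|by apply: dom_integrable; exact: bddmM..].
congr (fine _); apply: (@integral_dom_ref (fun x => f x * u x + f x * Dm G phi (x, t))).
- move=> k x Vx; have Ox : Om x by apply: (block_sub hG ht) Vx.
  have cf := within_open_cvg dom_open Ox (@subset_closure _ _) f_within.
  have cu := within_open_cvg dom_open Ox (@subset_closure _ _) u_within.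
  exact (cvgD (cvgM cf cu) (cvgM cf (Dm_cvg Vx))).
- by have [] := bddmD (bddmM bf bu) (bddmM bf bD).
move=> k y Wy; have Vx := block_refP t Wy.
have xO : closure Om (X y) by apply/subset_closure/(block_sub hG ht)/Vx.
rewrite /slice /hat_D /hat /= Dm_unhat_hat; last by exists k.
(* Each factor brings a square root of J; their product is the volume factor of the change of
   variables. *)
rewrite /op_val unhat_hat_local// mulrACA -expr2 sqr_sqrtr; last exact/ltW/(J_gt0 hG ht).
by rewrite mulrDr mulrC.
Qed.

End field.
End energy.

Theorem proposition2p6 (R : realType) (p : nat) (hp : (0 < p)%N)
    (G : geometry R p) (hG : moving_domain G) (q : nat)
    (D : field R p -> 'rV[R]_p * R -> option R)
    (B : field R p -> 'rV[R]_p * R -> option 'rV[R]_q)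
    (hD : local_operator G D) (hB : local_operator G B) (alpha : R) :
  (forall phi : field R p, space_U G D phi ->
     (forall t x, t_start G < t < t_end G -> bdry (dom G t) x ->
        B phi (x, t) = Some 0) ->
     forall t, t_start G < t < t_end G ->
       vol_ip (dom G t) (slice phi t) (slice (op_val D phi) t)
       + 2^-1 * surf_ip (bdry (dom G t)) (slice phi t)
                  (fun x => dotp (normal G x t) (xdot G x t) * slice phi t x)
       <= alpha * vol_sqnorm (dom G t) (slice phi t))
  <->
  (forall phih : field R p, space_Uhat G D phih ->
     (forall t y, t_start G < t < t_end G -> bdry (dom_ref G) y ->
        hat_B G B phih (y, t) = Some 0) ->
     forall t, t_start G < t < t_end G ->
       vol_ip (dom_ref G) (slice phih t) (slice (hat_D G D phih) t)
       <= alpha * vol_sqnorm (dom_ref G) (slice phih t)).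
Proof.
split=> H.
  move=> _ [phi Uphi <-] bc t ht; rewrite (hat_energy hG ht Uphi hD) (hat_sqnorm hG ht Uphi).
  apply: H => // s x hs Bx.
  have xO : closure (dom G s) x by case: Bx.
  (* The transformed condition at the reference point of x is the condition on phi at x, because
     locality lets B see phi itself. *)
  have := bc s _ hs (bdry_dom hG hs Bx).
  by rewrite /hat_B /= (YK hG hs xO) (unhat_hat_local hG hs phi hB xO).
move=> phi Uphi bc t ht; rewrite -(hat_energy hG ht Uphi hD) -(hat_sqnorm hG ht Uphi).
apply: H => //; first by exists phi.
move=> s y hs By; have Bx := bdry_ref hG hs By.
have xO : closure (dom G s) (x_of G y s) by case: Bx.
by rewrite /hat_B /= (unhat_hat_local hG hs phi hB xO); exact: bc.
Qed.
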